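(* Let $X$ be an irreducible $n$-variety. Then there is an irreducible $n$-variety $Y$, unique up to birational isomorphism of $n$-varieties, such that $\operatorname{RMaps}_{\operatorname{PGL}_n}(X,\operatorname{M}_n)\cong k_n(Y)$ as $k$-algebras. Moreover, $X$ and $Y$ are birationally isomorphic as $\operatorname{PGL}_n$-varieties.
   Context: $k$ is an algebraically closed field of arbitrary characteristic and $n\ge 1$ is a fixed integer. All rings and algebras are associative with $1$; subrings and homomorphisms respect $1$. $\operatorname{M}_n$ is the algebra of $n\times n$ matrices over $k$; $\operatorname{PGL}_n$ acts on $\operatorname{M}_n$ by conjugation and on $(\operatorname{M}_n)^m$ by simultaneous conjugation. $U_{m,n}\subseteq(\operatorname{M}_n)^m$ is the $\operatorname{PGL}_n$-stable Zariski open set of $m$-tuples that generate $\operatorname{M}_n$ as a $k$-algebra. An $n$-variety is a $\operatorname{PGL}_n$-stable subset $X$ of some $U_{m,n}$ that is Zariski closed in $U_{m,n}$. The generic matrix ring $G_{m,n}=k\{X_1,\dots,X_m\}$ is the $k$-subalgebra of $\operatorname{M}_n(k[x_{i,j}^{(h)}])$ generated by the generic matrices $X_h=(x_{i,j}^{(h)})_{i,j}$, $1\le h\le m$; its elements can be evaluated at points of $(\operatorname{M}_n)^m$. For an $n$-variety $X\subseteq U_{m,n}$, $\mathcal I(X)=\{p\in G_{m,n}\mid p(a)=0\ \forall a\in X\}$ and $k_n[X]=G_{m,n}/\mathcal I(X)$, whose elements are viewed as $\operatorname{PGL}_n$-equivariant functions $X\to\operatorname{M}_n$. For irreducible $X$,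 $k_n[X]$ is a prime PI-algebra of PI-degree $n$, and $k_n(X)$ denotes its total ring of fractions, a central simple algebra of degree $n$. Every element of $k_n(X)$ has the form $pc^{-1}$ with $p,c\in k_n[X]$ and $c$ central and nonzero; $c$ takes scalar values, nonzero on a dense open subset, so elements of $k_n(X)$ are viewed as $\operatorname{PGL}_n$-equivariant rational maps $X\dashrightarrow\operatorname{M}_n$. $\operatorname{RMaps}_{\operatorname{PGL}_n}(X,\operatorname{M}_n)$ is the $k$-algebra of all $\operatorname{PGL}_n$-equivariant rational maps $X\dashrightarrow\operatorname{M}_n$. For irreducible $n$-varieties $X\subseteq U_{m,n}$, $Y\subseteq U_{l,n}$, a rational map of $n$-varieties $X\dashrightarrow Y$ is a rational map of the form $(f_1,\dots,f_l)$ with each $f_i\in k_n(X)$. $X$ and $Y$ are birationally isomorphic as $n$-varieties if there are dominant rational maps of $n$-varieties $X\dashrightarrow Y$ and $Y\dashrightarrow X$ that are mutually inverse as rational maps; they are birationally isomorphic as $\operatorname{PGL}_n$-varieties if there is a $\operatorname{PGL}_n$-equivariant birational isomorphism between them. *)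

(* Defs.v *)
From HB Require Import structures.
From mathcomp Require Import all_boot all_algebra.
From mathcomp Require Import boolp classical_sets functions.
From mathcomp.multinomials Require Export mpoly.
From mathcomp Require Export all_boot all_algebra.

Set Implicit Arguments.
Unset Strict Implicit.
Unset Printing Implicit Defensive.

Import GRing.Theory.
Local Open Scope ring_scope.
Local Open Scope quotient_scope.

(* Matrices have size n.+1 throughout: the degree is at least 1. *)

(* The quotient rings of ring_quotient are commutative, hence this version. *)
Record biideal (A : nzRingType) := Biideal {
  biideal_pred :> A -> Prop;
  biideal0 : biideal_pred 0;
  biidealB : forall x y,
    biideal_pred x -> biideal_pred y -> biideal_pred (x - y);
  biidealMl : forall a x, biideal_pred x -> biideal_pred (a * x);
  biidealMr : forall a x, biideal_pred x -> biideal_pred (x * a);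
  biideal_proper : ~ biideal_pred 1 }.

Section QuotientAlgebra.
Variables (k : comNzRingType) (A : algType k) (I : biideal A).

Definition biideal_mem : {pred A} := fun x => `[< I x >].

Lemma biideal_memP x : reflect (I x) (x \in biideal_mem).
Proof. exact: asboolP. Qed.

Fact biideal_zmod : zmod_closed biideal_mem.
Proof.
split=> [|x y /biideal_memP Ix /biideal_memP Iy]; apply/biideal_memP.
- exact: biideal0.
- exact: biidealB.
Qed.

HB.instance Definition _ := GRing.isZmodClosed.Build A biideal_mem biideal_zmod.

Definition quotalg := Quotient.quot biideal_mem.

HB.instance Definition _ := GRing.Zmodule.on quotalg.
HB.instance Definition _ := EqQuotient.on quotalg.

Definition to_quot (x : A) : quotalg := \pi_quotalg x.

Lemma to_quotP x y : to_quot x = to_quot y <-> I (x - y).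
Proof.
split=> [/eqP|Ixy]; first by rewrite /to_quot -Quotient.idealrBE => /biideal_memP.
by apply/eqP; rewrite /to_quot -Quotient.idealrBE; apply/biideal_memP.
Qed.

Lemma repr_quotK (u : quotalg) : to_quot (repr u) = u.
Proof. exact: reprK. Qed.

Lemma repr_to_quot x : I (repr (to_quot x) - x).
Proof. by apply/to_quotP; rewrite repr_quotK. Qed.

Lemma to_quotD x y : to_quot (x + y) = to_quot x + to_quot y.
Proof. by rewrite /to_quot !piE. Qed.

Definition quot_one : quotalg := to_quot 1.
Definition quot_mul (u v : quotalg) : quotalg := to_quot (repr u * repr v).
Definition quot_scale (c : k) (u : quotalg) : quotalg := to_quot (c *: repr u).

Lemma quot_mulE x y : quot_mul (to_quot x) (to_quot y) = to_quot (x * y).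
Proof.
apply/to_quotP.
set x' := repr _; set y' := repr _.
have -> : x' * y' - x * y = (x' - x) * y' - x * (y - y').
  by rewrite mulrBl mulrBr opprB addrA subrK.
apply: biidealB; [apply: biidealMr|apply: biidealMl]; first exact: repr_to_quot.
by rewrite -opprB -[- _]add0r; apply: biidealB; [exact: biideal0|exact: repr_to_quot].
Qed.

Lemma quot_scaleE c x : quot_scale c (to_quot x) = to_quot (c *: x).
Proof.
apply/to_quotP; rewrite -scalerBr -mulr_algl.
by apply: biidealMl; exact: repr_to_quot.
Qed.

Fact quot_mulA : associative quot_mul.
Proof.
move=> x y z; rewrite -[x]repr_quotK -[y]repr_quotK -[z]repr_quotK.
by rewrite !quot_mulE mulrA.
Qed.
Fact quot_mul1 : left_id quot_one quot_mul.
Proof. by move=> x; rewrite -[x]repr_quotK quot_mulE mul1r. Qed.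
Fact quot_mulr1 : right_id quot_one quot_mul.
Proof. by move=> x; rewrite -[x]repr_quotK quot_mulE mulr1. Qed.
Fact quot_mulDl : left_distributive quot_mul +%R.
Proof.
move=> x y z; rewrite -[x]repr_quotK -[y]repr_quotK -[z]repr_quotK.
by rewrite -to_quotD !quot_mulE mulrDl to_quotD.
Qed.
Fact quot_mulDr : right_distributive quot_mul +%R.
Proof.
move=> x y z; rewrite -[x]repr_quotK -[y]repr_quotK -[z]repr_quotK.
by rewrite -to_quotD !quot_mulE mulrDr to_quotD.
Qed.
Fact quot_one_neq0 : quot_one != 0.
Proof.
apply/eqP => E; apply: (@biideal_proper _ I); rewrite -[1]subr0.
by apply/to_quotP; rewrite -/quot_one E /to_quot piE.
Qed.

HB.instance Definition _ := GRing.Zmodule_isNzRing.Build quotalg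
  quot_mulA quot_mul1 quot_mulr1 quot_mulDl quot_mulDr quot_one_neq0.

Fact quot_scaleA a b v : quot_scale a (quot_scale b v) = quot_scale (a * b) v.
Proof. by rewrite -[v]repr_quotK !quot_scaleE scalerA. Qed.
Fact quot_scale1 : left_id 1 quot_scale.
Proof. by move=> v; rewrite -[v]repr_quotK quot_scaleE scale1r. Qed.
Fact quot_scaleDr : right_distributive quot_scale +%R.
Proof.
move=> a x y; rewrite -[x]repr_quotK -[y]repr_quotK.
by rewrite -to_quotD !quot_scaleE scalerDr to_quotD.
Qed.
Fact quot_scaleDl v : {morph quot_scale^~ v : a b / a + b}.
Proof.
by move=> a b; rewrite -[v]repr_quotK !quot_scaleE scalerDl to_quotD.
Qed.

HB.instance Definition _ := GRing.Zmodule_isLmodule.Build k quotalg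
  quot_scaleA quot_scale1 quot_scaleDr quot_scaleDl.

Fact quot_scaleAl (a : k) (u v : quotalg) : a *: (u * v) = (a *: u) * v.
Proof.
rewrite -[u]repr_quotK -[v]repr_quotK.
by rewrite [LHS](congr1 (quot_scale a) (quot_mulE _ _)) quot_scaleE scalerAl
  [RHS](congr1 (quot_mul^~ _) (quot_scaleE _ _)) quot_mulE.
Qed.

HB.instance Definition _ := GRing.Lmodule_isLalgebra.Build k quotalg quot_scaleAl.

Fact quot_scaleAr (a : k) (u v : quotalg) : a *: (u * v) = u * (a *: v).
Proof.
rewrite -[u]repr_quotK -[v]repr_quotK.
by rewrite [LHS](congr1 (quot_scale a) (quot_mulE _ _)) quot_scaleE scalerAr
  [RHS](congr1 (quot_mul _) (quot_scaleE _ _)) quot_mulE.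
Qed.

HB.instance Definition _ := GRing.Lalgebra_isAlgebra.Build k quotalg quot_scaleAr.

End QuotientAlgebra.

Definition is_inverse (B : nzRingType) (s t : B) := s * t = 1 /\ t * s = 1.

Definition regular_elt (A : nzRingType) (s : A) := GRing.lreg s /\ GRing.rreg s.

Definition is_fraction (A B : nzRingType) (j : A -> B) (q : B) :=
  exists p s t, [/\ regular_elt s, is_inverse (j s) t & q = j p * t].

(* Right fractions: in a prime PI-algebra left fractions give the same ring. *)
Definition total_ring_of_fractions (k : comNzRingType) (A Q : algType k)
    (j : {lrmorphism A -> Q}) :=
  [/\ injective j,
      forall s, regular_elt s -> exists t, is_inverse (j s) t
    & forall q, is_fraction j q].

Definition alg_isomorphic (k : comNzRingType) (A B : algType k) :=
  exists phi : {lrmorphism A -> B}, bijective phi.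

(* The k-subalgebra of M_{n+1}(R) generated by a_1, ..., a_m, where R is a
   k-algebra with structure map iota. *)
Inductive generated (k : nzRingType) (R : comNzRingType) (iota : k -> R)
    (n m : nat) (a : 'I_m -> 'M[R]_n.+1) : 'M[R]_n.+1 -> Prop :=
| Gen_scalar c : generated iota a (iota c)%:M
| Gen_var h : generated iota a (a h)
| Gen_add p q : generated iota a p -> generated iota a q ->
    generated iota a (p + q)
| Gen_mul p q : generated iota a p -> generated iota a q ->
    generated iota a (p *m q).

Section MatrixTuples.
Variables (k : closedFieldType) (n m : nat).

Definition point := {ffun 'I_m -> 'M[k]_n.+1}.

HB.instance Definition _ := Choice.on point.
HB.instance Definition _ := isPointed.Build point [ffun=> 0].

Definition generating (a : point) := forall B, generated id a B.

(* The action of PGL is given through GL, i.e., by unit matrices g. *)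
Definition conj_mx (g B : 'M[k]_n.+1) : 'M[k]_n.+1 := g *m B *m invmx g.
Definition conj_pt (g : 'M[k]_n.+1) (a : point) : point :=
  [ffun h => conj_mx g (a h)].

Definition nvars := #|{: 'I_m * 'I_n.+1 * 'I_n.+1}|.
Definition cpoly := {mpoly k[nvars]}.
Definition coord (a : point) (r : 'I_nvars) : k :=
  let: (h, i, j) := enum_val r in a h i j.

Definition zclosed (Z : point -> Prop) :=
  exists S : cpoly -> Prop,
    forall a, Z a <-> forall P, S P -> P.@[coord a] = 0.

Definition generic_mx (h : 'I_m) : 'M[cpoly]_n.+1 :=
  \matrix_(i, j) 'X_(enum_rank (h, i, j)).

(* M_{n+1}(k[x]) as a k-algebra: the scalars of the matrix algebra instance
   are polynomials. *)
Definition polymx := 'M[cpoly]_n.+1.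

HB.instance Definition _ := GRing.NzRing.on polymx.

Definition polymx_scale (c : k) (p : polymx) : polymx := (c%:MP : cpoly) *: p.

Fact polymx_scaleA a b v :
  polymx_scale a (polymx_scale b v) = polymx_scale (a * b) v.
Proof. by rewrite /polymx_scale scalerA rmorphM. Qed.
Fact polymx_scale1 : left_id 1 polymx_scale.
Proof. by move=> v; rewrite /polymx_scale rmorph1 scale1r. Qed.
Fact polymx_scaleDr : right_distributive polymx_scale +%R.
Proof. by move=> a x y; rewrite /polymx_scale scalerDr. Qed.
Fact polymx_scaleDl v : {morph polymx_scale^~ v : a b / a + b}.
Proof. by move=> a b; rewrite /polymx_scale rmorphD scalerDl. Qed.

HB.instance Definition _ := GRing.Zmodule_isLmodule.Build k polymx
  polymx_scaleA polymx_scale1 polymx_scaleDr polymx_scaleDl.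

Fact polymx_scaleAl (a : k) (u v : polymx) : a *: (u * v) = (a *: u) * v.
Proof. exact: scalemxAl. Qed.
HB.instance Definition _ := GRing.Lmodule_isLalgebra.Build k polymx polymx_scaleAl.
Fact polymx_scaleAr (a : k) (u v : polymx) : a *: (u * v) = u * (a *: v).
Proof. exact: scalemxAr. Qed.
HB.instance Definition _ := GRing.Lalgebra_isAlgebra.Build k polymx polymx_scaleAr.

Definition in_genring : {pred polymx} :=
  fun p => `[< generated (@mpolyC nvars k) generic_mx p >].

Fact genring_closed : GRing.subsemialg_closed in_genring.
Proof.
have gen1 : in_genring 1.
  by apply/asboolP; have := Gen_scalar (@mpolyC nvars k) generic_mx 1;
     rewrite mpolyC1.
have genM : {in in_genring &, forall u v, u * v \in in_genring}.
  by move=> u v /asboolP Gu /asboolP Gv; apply/asboolP; exact: Gen_mul.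
split=> //; first split.
- apply/asboolP; have := Gen_scalar (@mpolyC nvars k) generic_mx 0.
  by rewrite mpolyC0 (_ : 0%:M = 0) // raddf0.
- by move=> u v /asboolP Gu /asboolP Gv; apply/asboolP; exact: Gen_add.
- move=> c u /asboolP Gu; apply/asboolP.
  have := Gen_mul (Gen_scalar (@mpolyC nvars k) generic_mx c) Gu.
  by rewrite mul_scalar_mx.
Qed.

HB.instance Definition _ :=
  @GRing.isSubalgClosed.Build k polymx in_genring genring_closed.

Record genring := GenRing { genring_val : polymx; _ : genring_val \in in_genring }.

HB.instance Definition _ := [isSub for genring_val].
HB.instance Definition _ := [Choice of genring by <:].
HB.instance Definition _ := [SubChoice_isSubAlgebra of genring by <:].

Definition eval_mx (p : polymx) (a : point) : 'M[k]_n.+1 :=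
  map_mx (meval (coord a)) p.

Lemma eval_mx0 a : eval_mx 0 a = 0.
Proof. exact: map_mx0. Qed.

Lemma eval_mx1 a : eval_mx 1 a = 1.
Proof. exact: map_mx1. Qed.

Lemma eval_mxD p q a : eval_mx (p + q) a = eval_mx p a + eval_mx q a.
Proof. exact: map_mxD. Qed.

Lemma eval_mxB p q a : eval_mx (p - q) a = eval_mx p a - eval_mx q a.
Proof. exact: map_mxB. Qed.

Lemma eval_mxM p q a : eval_mx (p * q) a = eval_mx p a * eval_mx q a.
Proof. exact: map_mxM. Qed.

Lemma eval_mxZ (D : cpoly) (p : 'M[cpoly]_n.+1) a :
  eval_mx (D *: p) a = D.@[coord a] *: eval_mx p a.
Proof. exact: map_mxZ. Qed.

Lemma eval_mx_scalar (D : cpoly) a : eval_mx D%:M a = D.@[coord a]%:M.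
Proof. exact: map_scalar_mx. Qed.

Lemma eval_generic h a : eval_mx (generic_mx h) a = a h.
Proof. by apply/matrixP => i j; rewrite !mxE mevalXU /coord enum_rankK. Qed.

Section Conjugation.
Variable g : 'M[k]_n.+1.
Hypothesis ug : g \in unitmx.

Lemma conj_mxM B C : conj_mx g (B * C) = conj_mx g B * conj_mx g C.
Proof.
change (g *m (B *m C) *m invmx g
  = (g *m B *m invmx g) *m (g *m C *m invmx g)).
by rewrite !mulmxA mulmxKV.
Qed.

Lemma conj_mx_scalar c : conj_mx g c%:M = c%:M.
Proof. by rewrite /conj_mx scalar_mxC -mulmxA mulmxV // mulmx1. Qed.

Lemma conj_mxD B C : conj_mx g (B + C) = conj_mx g B + conj_mx g C.
Proof. by rewrite /conj_mx mulmxDr mulmxDl. Qed.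

Lemma conj_mxZ c B : conj_mx g (c *: B) = c *: conj_mx g B.
Proof. by rewrite /conj_mx -scalemxAr -scalemxAl. Qed.

Lemma eval_genring (p : genring) a :
  eval_mx (genring_val p) (conj_pt g a) = conj_mx g (eval_mx (genring_val p) a).
Proof.
case: p => p /= /asboolP; elim=> {p} [c|h|p q _ IHp _ IHq|p q _ IHp _ IHq].
- by rewrite !eval_mx_scalar !mevalC conj_mx_scalar.
- by rewrite !eval_generic ffunE.
- by rewrite !eval_mxD IHp IHq conj_mxD.
- by rewrite !eval_mxM IHp IHq conj_mxM.
Qed.

End Conjugation.

Definition mxfun := point -> 'M[k]_n.+1.

HB.instance Definition _ := GRing.NzRing.on mxfun.
HB.instance Definition _ := GRing.Lmodule.on mxfun.

Fact mxfun_scaleAl (c : k) (u v : mxfun) : c *: (u * v) = (c *: u) * v.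
Proof. by apply/funext => a; exact: scalemxAl. Qed.
HB.instance Definition _ := GRing.Lmodule_isLalgebra.Build k mxfun mxfun_scaleAl.
Fact mxfun_scaleAr (c : k) (u v : mxfun) : c *: (u * v) = u * (c *: v).
Proof. by apply/funext => a; exact: scalemxAr. Qed.
HB.instance Definition _ := GRing.Lalgebra_isAlgebra.Build k mxfun mxfun_scaleAr.

Record nvariety := NVariety {
  nvar_pt :> point -> Prop;
  nvar_gen : forall a, nvar_pt a -> generating a;
  nvar_stable : forall g a, g \in unitmx -> nvar_pt a -> nvar_pt (conj_pt g a);
  nvar_closed : exists2 Z, zclosed Z &
    forall a, nvar_pt a <-> Z a /\ generating a }.

Definition irreducible (X : point -> Prop) :=
  (exists a, X a) /\
  forall Z1 Z2, zclosed Z1 -> zclosed Z2 -> (forall a, X a -> Z1 a \/ Z2 a) ->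
    (forall a, X a -> Z1 a) \/ (forall a, X a -> Z2 a).

Record irr_nvariety := IrrNVariety {
  irr_nvar :> nvariety;
  nvar_irr : irreducible irr_nvar }.

Definition nonvanishing (X : point -> Prop) (D : cpoly) :=
  exists2 a, X a & D.@[coord a] != 0.

(* P holds on a nonempty open subset of X; the sets D != 0 form a basis of
   the Zariski topology. For X irreducible, nonempty open means dense open. *)
Definition generically (X : point -> Prop) (P : point -> Prop) :=
  exists2 D, nonvanishing X D &
    forall a, X a -> D.@[coord a] != 0 -> P a.

(* f represents a rational map from X to matrices, namely P / Q; its values
   where Q vanishes are irrelevant. *)
Definition rational (X : point -> Prop) (f : mxfun) :=
  exists (P : polymx) (Q : cpoly), nonvanishing X Q /\
    forall a, X a -> Q.@[coord a] != 0 ->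
      f a = Q.@[coord a]^-1 *: eval_mx P a.

Definition equivariant (X : point -> Prop) (f : mxfun) :=
  forall g, g \in unitmx ->
    generically X (fun a => f (conj_pt g a) = conj_mx g (f a)).

Section Rational.
Variable X : irr_nvariety.

Lemma nonvanishing1 : nonvanishing X 1.
Proof.
have [[a Xa] _] := nvar_irr X.
by exists a; rewrite // meval1 oner_eq0.
Qed.

Lemma nonvanishingM D E :
  nonvanishing X D -> nonvanishing X E -> nonvanishing X (D * E).
Proof.
move=> [a Xa Da] [b Xb Eb]; apply: contrapT => nDE.
have [_ irr] := nvar_irr X.
have clo (F : cpoly) : zclosed (fun c => F.@[coord c] = 0).
  by exists (fun P => P = F) => c; split=> [Fc P ->|]; last exact.
have [c Xc|/(_ a Xa)/eqP|/(_ b Xb)/eqP] := irr _ _ (clo D) (clo E).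
- case: (eqVneq D.@[coord c] 0) => [|Dc]; first by left.
  right; apply: contrapT => /eqP Ec; apply: nDE; exists c => //.
  by rewrite mevalM mulf_neq0.
- by rewrite (negPf Da).
- by rewrite (negPf Eb).
Qed.

Lemma generically_all (P : point -> Prop) :
  (forall a, X a -> P a) -> generically X P.
Proof. by move=> XP; exists 1 => [|a Xa _]; [exact: nonvanishing1|exact: XP]. Qed.

Lemma generically_and (P Q R : point -> Prop) :
  (forall a, X a -> P a -> Q a -> R a) ->
  generically X P -> generically X Q -> generically X R.
Proof.
move=> PQR [D nD DP] [E nE EQ]; exists (D * E); first exact: nonvanishingM.
move=> a Xa; rewrite mevalM mulf_eq0 negb_or => /andP[Da Ea].
by apply: PQR => //; [exact: DP|exact: EQ].
Qed.

Lemma generically_impl (P Q : point -> Prop) :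
  (forall a, X a -> P a -> Q a) -> generically X P -> generically X Q.
Proof. by move=> PQ gP; apply: (generically_and _ gP gP) => a Xa Pa _; exact: PQ. Qed.

Lemma generically_ex (P : point -> Prop) :
  generically X P -> exists2 a, X a & P a.
Proof. by case=> D [a Xa Da] /(_ a Xa Da) Pa; exists a. Qed.

Definition in_rmaps : {pred mxfun} :=
  fun f => `[< rational X f /\ equivariant X f >].

Fact rational_eval (p : polymx) : rational X (eval_mx p).
Proof.
exists p, 1; split=> [|a Xa _]; first exact: nonvanishing1.
by rewrite meval1 invr1 scale1r.
Qed.

Fact in_rmaps_eval (p : genring) : eval_mx (genring_val p) \in in_rmaps.
Proof.
apply/asboolP; split=> [|g ug]; first exact: rational_eval.
by apply: generically_all => a Xa; exact: eval_genring.
Qed.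

Fact rmaps_closed : GRing.subsemialg_closed in_rmaps.
Proof.
have scal c : (fun=> c%:M : 'M[k]_n.+1) \in in_rmaps.
  apply/asboolP; split=> [|g ug]; last first.
    by apply: generically_all => a Xa; rewrite conj_mx_scalar.
  have [P [Q [nQ PQ]]] := rational_eval (c%:MP : cpoly)%:M.
  exists P, Q; split=> // a Xa Qa.
  by rewrite -PQ // eval_mx_scalar mevalC.
have mulc : {in in_rmaps &, forall u v, u * v \in in_rmaps}.
  move=> u v /asboolP[[P [D [nD uE]]] equ] /asboolP[[Q [E [nE vE]]] eqv].
  apply/asboolP; split.
    exists (P * Q), (D * E); split=> [|a Xa]; first exact: nonvanishingM.
    rewrite mevalM mulf_eq0 negb_or => /andP[Da Ea].
    rewrite [LHS]/GRing.mul /= uE // vE // eval_mxM invfM.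
    by rewrite -scalerAl -scalerAr scalerA.
  move=> g ug; apply: (generically_and _ (equ g ug) (eqv g ug)) => a Xa ua va.
  by rewrite /= [LHS](congr2 *%R ua va) conj_mxM.
split=> //; first exact: scal.
- split=> [|u v]; first by have := scal 0; rewrite raddf0.
  move=> /asboolP[[P [D [nD uE]]] equ] /asboolP[[Q [E [nE vE]]] eqv].
  apply/asboolP; split.
    exists ((E *: (P : 'M_n.+1)) + (D *: (Q : 'M_n.+1))), (D * E).
    split=> [|a Xa]; first exact: nonvanishingM.
    rewrite mevalM mulf_eq0 negb_or => /andP[Da Ea].
    rewrite [LHS](congr2 +%R (uE _ Xa Da) (vE _ Xa Ea)) eval_mxD !eval_mxZ.
    rewrite scalerDr !scalerA invfM mulrVK ?unitfE // mulrAC.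
    by rewrite mulVf // mul1r.
  move=> g ug; apply: (generically_and _ (equ g ug) (eqv g ug)) => a Xa ua va.
  by rewrite /= [LHS](congr2 +%R ua va) conj_mxD.
- move=> c u Ru; have -> : c *: u = (fun=> c%:M) * u :> mxfun.
    by apply/funext => a; rewrite /= [RHS]mul_scalar_mx.
  exact: mulc.
Qed.

HB.instance Definition _ :=
  @GRing.isSubalgClosed.Build k mxfun in_rmaps rmaps_closed.

Record rmap_rep := RmapRep { rmap_fun : mxfun; _ : rmap_fun \in in_rmaps }.

HB.instance Definition _ := [isSub for rmap_fun].
HB.instance Definition _ := [Choice of rmap_rep by <:].
HB.instance Definition _ := [SubChoice_isSubAlgebra of rmap_rep by <:].

Definition genzero (f : rmap_rep) := generically X (fun a => rmap_fun f a = 0).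

Definition genzero_biideal : biideal rmap_rep.
Proof.
exists genzero.
- exact: generically_all.
- move=> f g; apply: generically_and => a Xa fa ga.
  by rewrite /= [LHS](congr2 (fun u v => u - v) fa ga) subr0.
- move=> f g; apply: generically_impl => a Xa ga.
  by rewrite /= [LHS](congr1 ( *%R (rmap_fun f a)) ga) mulr0.
- move=> f g; apply: generically_impl => a Xa ga.
  by rewrite /= [LHS](congr1 ( *%R^~ (rmap_fun f a)) ga) mul0r.
- by move=> /generically_ex[a Xa /eqP]; rewrite /= [X in X == _]/GRing.one /= oner_eq0.
Defined.

Definition RMaps : algType k := quotalg genzero_biideal.

Definition rmap_val (f : RMaps) : mxfun := rmap_fun (repr f).

Definition vanishing (p : genring) :=
  forall a, X a -> eval_mx (genring_val p) a = 0.

Definition vanishing_biideal : biideal genring.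
Proof.
exists vanishing.
- by move=> a Xa; exact: eval_mx0.
- by move=> p q Ip Iq a Xa; rewrite [LHS]eval_mxB Ip // Iq // subr0.
- by move=> p q Iq a Xa; rewrite [LHS]eval_mxM Iq // mulr0.
- by move=> p q Iq a Xa; rewrite [LHS]eval_mxM Iq // mul0r.
- have [[a Xa] _] := nvar_irr X.
  by move=> /(_ a Xa)/eqP; rewrite [X in X == _]eval_mx1 oner_eq0.
Defined.

Definition kn_poly : algType k := quotalg vanishing_biideal.

Definition rmap_of_genring (p : genring) : RMaps :=
  to_quot genzero_biideal (RmapRep (in_rmaps_eval p)).

Definition rmap_of_kn_poly (u : kn_poly) : RMaps := rmap_of_genring (repr u).

Lemma rmap_of_kn_polyE p :
  rmap_of_kn_poly (to_quot vanishing_biideal p) = rmap_of_genring p.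
Proof.
apply/to_quotP; apply: generically_all => a Xa.
rewrite /= -[LHS]/(eval_mx _ a - eval_mx _ a) -eval_mxB.
exact: (repr_to_quot vanishing_biideal p).
Qed.

(* f belongs to k_n(X), viewed inside RMaps: the total ring of fractions of
   k_n[X] embeds in RMaps because the regular elements of k_n[X] are invertible
   there, so its elements are the rational maps p s^-1 with s regular. *)
Definition in_kn_frac (f : RMaps) := is_fraction rmap_of_kn_poly f.

(* k_n(X) is the total ring of fractions of k_n[X], determined up to a unique
   isomorphism; Q ranges over its models. *)
Definition isomorphic_to_kn_frac (A : algType k) :=
  exists (Q : algType k) (j : {lrmorphism kn_poly -> Q}),
    total_ring_of_fractions j /\ alg_isomorphic A Q.

End Rational.
End MatrixTuples.

Section RationalMaps.
Variables (k : closedFieldType) (n m l : nat).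
Variables (X : irr_nvariety k n m) (Y : irr_nvariety k n l).

(* An equivariant rational map from X to l-tuples of matrices is an l-tuple of
   elements of RMaps X; its values are meaningful only generically on X. *)
Definition tuple_val (F : 'I_l -> RMaps X) (a : point k n m) : point k n l :=
  [ffun i => rmap_val (F i) a].

Definition maps_into (F : 'I_l -> RMaps X) :=
  generically X (fun a => Y (tuple_val F a)).

(* A closed set containing the image of a nonempty open subset of X contains
   Y. *)
Definition dominant (F : 'I_l -> RMaps X) :=
  forall Z, zclosed Z -> generically X (fun a => Z (tuple_val F a)) ->
    forall b, Y b -> Z b.

End RationalMaps.

Section Birational.
Variables (k : closedFieldType) (n m l : nat).
Variables (X : irr_nvariety k n m) (Y : irr_nvariety k n l).

(* For dominant F and G the composites do not depend, generically, on the
   representatives chosen by tuple_val. *)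
Definition mutually_inverse (F : 'I_l -> RMaps X) (G : 'I_m -> RMaps Y) :=
  generically X (fun a => tuple_val G (tuple_val F a) = a) /\
  generically Y (fun b => tuple_val F (tuple_val G b) = b).

Definition inverse_dominant (F : 'I_l -> RMaps X) (G : 'I_m -> RMaps Y) :=
  [/\ maps_into Y F /\ maps_into X G,
      dominant Y F /\ dominant X G
    & mutually_inverse F G].

(* G is automatically equivariant when F is. *)
Definition PGL_birational :=
  exists (F : 'I_l -> RMaps X) (G : 'I_m -> RMaps Y), inverse_dominant F G.

Definition nvar_birational :=
  exists (F : 'I_l -> RMaps X) (G : 'I_m -> RMaps Y),
    [/\ inverse_dominant F G, forall i, in_kn_frac (F i)
      & forall i, in_kn_frac (G i)].

End Birational.

(* Main.v *)
From HB Require Import structures.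
Require Import Defs.
From mathcomp Require Import boolp functions zify ring closed_field.

Set Implicit Arguments.
Unset Strict Implicit.
Unset Printing Implicit Defensive.

Import GRing.Theory.
Local Open Scope ring_scope.
Local Open Scope quotient_scope.

(** Write A for RMaps X. The point is that A is generated, up to central
denominators, by the coordinate maps X_1, ..., X_m and finitely many scalar
maps c_1, ..., c_r. Once this is known, let Y be the closure, inside the tuples
that generate the matrix algebra, of the image of the equivariant rational map
F = (X_1, ..., X_m, c_1, ..., c_r). The projection to the first m coordinates
inverts F, so X and Y are birational as PGL-varieties [extended_birational],
and p |-> p(F) identifies k_n[Y] with the subalgebra of A generated by F, whose
ring of fractions is A [extended_kn_frac].

To see the finite generation, embed A in the matrices over the function field K
of X by an injective homomorphism [rho]; its image consists of the matrices M
with sigma_g(M) = g M g^-1 for all g, where sigma_g is the action of g on K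
[rho_equiv], [equiv_rho]. Comparing coefficients shows that a basis of the
matrices over K that consists of elements of A is also a basis of A over the
field L of invariants in K [rho_basis], and elements of the generic matrix
ring provide such a basis [taut_basis]. There remains the finite generation of
L over k, which holds for every intermediate field of K over k [subfield_fg]:
if P_1, ..., P_s generate the ideal of K[t] spanned by the polynomials over L
that vanish at the coordinates x of the generic point, then the coefficients of
the P_i generate L. Indeed r = p(x)/q(x) in L puts p - r q in this ideal while q
is not in it, and linear algebra over the field generated by the coefficients
recovers r.

For uniqueness, let h : k_n[Y] -> A and h' : k_n[Y'] -> A both present A as a
ring of fractions. The evaluation of k_n[Y] at the generic point of Y extends
to A because the matrix algebra is prime [extend_to_fractions]; so A acts by
rational maps, which lie in k_n(Y), on Y [fraction_model] and likewise on Y'.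
Let F on Y be the tuple of the images of the generators of k_n[Y'], and G on Y'
that of the generators of k_n[Y]. These are mutually inverse as soon as F maps
Y dominantly to Y', which means that a polynomial in the matrix entries
vanishes on Y' if and only if it vanishes at F [comparison_same_vanishing].
By construction this is clear only for elements of the generic matrix ring. In
general, fix elements of that ring which give a basis of A over L. Tuples with
the same structure constants for this basis are conjugate
[same_constants_conjugate]. Hence, for a generic point y of Y and a polynomial
P that vanishes at F, the following holds of the structure constants at F(y):
every tuple that has them is a zero of P. By quantifier elimination this is a
constructible condition on the structure constants. As these are elements of L,
they satisfy the same polynomial relations on Y and on Y', so the condition
also holds at the generic point of Y' [vanishing_transfer]. *)

(** * Noetherian rings *)

Section Noetherian.

Inductive in_ideal (R : comNzRingType) (S : R -> Prop) : R -> Prop :=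
| In_ideal0 : in_ideal S 0
| In_idealD a x y : S x -> in_ideal S y -> in_ideal S (a * x + y).

(** Stated for arbitrary generating sets rather than for ideals, since the
    finitely many generators are needed inside a given set. *)
Definition noetherian (R : comNzRingType) := forall S : R -> Prop,
  exists2 s : seq R, (forall x, x \in s -> S x) &
    forall x, S x -> in_ideal (fun y => y \in s) x.

Section Ideal.
Variables (R : comNzRingType) (S : R -> Prop).

Lemma in_ideal_gen x : S x -> in_ideal S x.
Proof.
by move=> Sx; rewrite -[x]mul1r -[_ * x]addr0; apply: In_idealD; [|constructor].
Qed.

Lemma in_ideal_add x y : in_ideal S x -> in_ideal S y -> in_ideal S (x + y).
Proof.
move=> Ix Iy; elim: Ix => [|a u v Su _ IH]; first by rewrite add0r.
by rewrite -addrA; apply: In_idealD.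
Qed.

Lemma in_ideal_mul a x : in_ideal S x -> in_ideal S (a * x).
Proof.
elim=> [|b u v Su _ IH]; first by rewrite mulr0; constructor.
by rewrite mulrDr mulrA; apply: In_idealD.
Qed.

Lemma in_ideal_sub x y : in_ideal S x -> in_ideal S y -> in_ideal S (x - y).
Proof.
by move=> Ix Iy; rewrite -[- y]mulN1r; apply/in_ideal_add/in_ideal_mul.
Qed.

Lemma in_ideal_ind_closed (T : R -> Prop) :
  T 0 -> (forall x y, T x -> T y -> T (x + y)) ->
  (forall a x, T x -> T (a * x)) -> (forall x, S x -> T x) ->
  forall x, in_ideal S x -> T x.
Proof. by move=> T0 TD TM ST x; elim=> [//|a u v Su _]; apply/TD/TM/ST. Qed.

End Ideal.

Lemma in_ideal_trans (R : comNzRingType) (S T : R -> Prop) x :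
  (forall y, S y -> in_ideal T y) -> in_ideal S x -> in_ideal T x.
Proof.
move=> ST; apply: in_ideal_ind_closed => //; first by constructor.
  exact: in_ideal_add.
exact: in_ideal_mul.
Qed.

Lemma in_ideal_finite (R : comNzRingType) (S : R -> Prop) x : in_ideal S x ->
  exists2 s : seq R, (forall y, y \in s -> S y) & in_ideal (fun y => y \in s) x.
Proof.
elim=> [|a u v Su _ [s sS sv]]; first by exists [::] => //; constructor.
exists (u :: s) => [y|]; first by rewrite inE => /orP[/eqP->|/sS].
apply: In_idealD; first exact: mem_head.
by apply: in_ideal_trans sv => y ys; apply: in_ideal_gen; rewrite inE ys orbT.
Qed.

Lemma noetherian_image (R R' : comNzRingType) (f : {rmorphism R -> R'}) :
  (forall y, exists x, f x = y) -> noetherian R -> noetherian R'.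
Proof.
move=> fsurj nR S; have [s sS Ss] := nR (fun x => S (f x)).
exists [seq f x | x <- s] => [y /mapP[x xs ->]|y]; first exact: sS.
have [x <- /Ss] := fsurj y; elim=> [|a u v us _ IH].
  by rewrite rmorph0; constructor.
by rewrite rmorphD rmorphM; apply: In_idealD => //; apply: map_f.
Qed.

Lemma noetherian_field (K : fieldType) : noetherian K.
Proof.
move=> S; have [[x Sx x0]|nS] := pselect (exists2 x, S x & x != 0).
  exists [:: x] => [y|y _]; first by rewrite inE => /eqP->.
  rewrite -[y](divfK x0) -[_ * x]addr0; apply: In_idealD; last by constructor.
  exact: mem_head.
exists [::] => // x Sx; case: (eqVneq x 0) => [->|x0]; first by constructor.
by case: nS; exists x.
Qed.

Lemma in_ideal_finite_sub (R : comNzRingType) (S : R -> Prop) (s : seq R) :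
  (forall y, y \in s -> in_ideal S y) ->
  exists2 t : seq R, (forall y, y \in t -> S y) &
    forall y, y \in s -> in_ideal (fun z => z \in t) y.
Proof.
elim: s => [|y s IH] sI; first by exists [::].
have [z zs|t tS st] := IH; first by apply: sI; rewrite inE zs orbT.
have [u uS yu] := in_ideal_finite (sI y (mem_head _ _)).
exists (u ++ t) => [z|z]; rewrite ?mem_cat; first by case/orP => [/uS|/tS].
rewrite inE => /orP[/eqP->|/st zt].
  by apply: in_ideal_trans yu => w wu; apply: in_ideal_gen; rewrite mem_cat wu.
by apply: in_ideal_trans zt => w wt; apply: in_ideal_gen; rewrite mem_cat wt orbT.
Qed.

(** Hilbert's argument: otherwise one could choose g_0, g_1, ... in the ideal,
    each of minimal degree outside the ideal of the previous ones. The leading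
    coefficients of the g_i generate a finitely generated ideal, so some
    lead(g_N) is a combination of earlier ones, and cancelling it contradicts
    the minimality of deg g_N. *)
Lemma noetherian_poly (R : comNzRingType) : noetherian R -> noetherian {poly R}.
Proof.
move=> nR S; apply: contrapT => nfg.
pose I := in_ideal S; pose span (s : seq {poly R}) := in_ideal (fun y => y \in s).
have esc (s : seq {poly R}) : exists x, (forall y, y \in s -> I y) ->
    [/\ I x, ~ span s x & forall z, I z -> ~ span s z -> (size x <= size z)%N].
  have [sI|nsI] := pselect (forall y, y \in s -> I y); last by exists 0.
  have [x Ix nx] : exists2 x, I x & ~ span s x.
    apply: contrapT => nex; apply: nfg.
    have [t tS st] := in_ideal_finite_sub sI.
    exists t => // x Sx; apply: (in_ideal_trans st).
    apply: contrapT => nx; apply: nex; exists x => //.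
    exact: in_ideal_gen.
  pose P i := `[< exists2 x, I x /\ ~ span s x & size x = i >].
  have exP : exists i, P i by exists (size x); apply/asboolP; exists x.
  case: (ex_minnP exP) => i /asboolP[z [Iz nz] sz] imin.
  exists z => _; split=> // u Iu nu; rewrite sz; apply: imin.
  by apply/asboolP; exists u.
have [pick pickP] := choice esc.
pose G := fix G n := if n is n'.+1 then rcons (G n') (pick (G n')) else [::].
have GI n y : y \in G n -> I y.
  elim: n y => [//|n IH] y /=; rewrite mem_rcons inE => /orP[/eqP->|/IH//].
  by case: (pickP (G n) IH).
pose g n := pick (G n).
have gG i n : (i < n)%N -> g i \in G n.
  elim: n => [//|n IH]; rewrite ltnS leq_eqVlt /= mem_rcons inE.
  by case/orP => [/eqP->|/IH ->]; rewrite ?eqxx ?orbT.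
have gP n : [/\ I (g n), ~ span (G n) (g n) &
    forall z, I z -> ~ span (G n) z -> (size (g n) <= size z)%N].
  exact: pickP (GI n).
have gle i n : (i < n)%N -> (size (g i) <= size (g n))%N.
  move=> lt_in; have [_ _] := gP i; apply; first by case: (gP n).
  have [_ + _] := gP n; apply: contra_not; apply: in_ideal_trans => y yG.
  apply: in_ideal_gen; elim: n lt_in {gG} => [//|n IH] /=.
  rewrite ltnS leq_eqVlt mem_rcons inE => /orP[/eqP ein|/IH ->]; last by rewrite orbT.
  by rewrite -ein yG orbT.
have [s sS Ss] := nR (fun a => exists n, a = lead_coef (g n)).
have [N sN] : exists N, forall a, a \in s -> exists2 i, (i < N)%N & a = lead_coef (g i).
  elim: s sS {Ss} => [|a s IH] sS; first by exists 0.
  have [b bs|N sN] := IH; first by apply: sS; rewrite inE bs orbT.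
  have [i ai] := sS a (mem_head _ _); exists (maxn N i.+1) => b.
  rewrite inE => /orP[/eqP->|/sN[j jN ->]]; first by exists i; rewrite ?leq_maxr.
  by exists j; rewrite // leq_max jN.
have gN0 : g N != 0.
  by apply/eqP => gN0; have [_ + _] := gP N; apply; rewrite gN0; constructor.
set d := (size (g N)).-1.
have sgN : size (g N) = d.+1 by rewrite prednK // lt0n size_poly_eq0.
(* the leading coefficient of g N is reached by the previous polynomials *)
have [f [Gf sf fd]] : exists f,
    [/\ span (G N) f, (size f <= d.+1)%N & f`_d = lead_coef (g N)].
  have : in_ideal (fun a => a \in s) (lead_coef (g N)) by apply: Ss; exists N.
  elim=> [|a u v us _ [f [Gf sf <-]]].
    by exists 0; rewrite size_poly0 coef0; split=> //; constructor.
  have [i iN ->] := sN u us; set e := (size (g i)).-1.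
  have [gi0|gi0] := eqVneq (g i) 0.
    by exists f; rewrite gi0 lead_coef0 mulr0 add0r.
  have sgi : size (g i) = e.+1 by rewrite prednK // lt0n size_poly_eq0.
  have led : (e <= d)%N by rewrite -ltnS -sgi -sgN; apply: gle.
  exists (a%:P * 'X^(d - e) * g i + f); split.
  - by apply: In_idealD => //; apply: gG.
  - rewrite (leq_trans (size_polyD _ _)) // geq_max sf andbT -mulrA.
    apply: leq_trans (size_polyMleq _ _) _.
    have := size_polyMleq 'X^(d - e) (g i); rewrite size_polyXn sgi /= => h.
    have := size_polyC_leq1 a; move: h.
    set A := size _; set B := size _; lia.
  - by rewrite coefD -mulrA coefCM coefXnM ltnNge leq_subr /= subKn.
have [IgN ngN mgN] := gP N.
have GIspan x : span (G N) x -> I x by apply: in_ideal_trans; exact: GI.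
have : (size (g N) <= size (g N - f)%R)%N.
  apply: mgN; first exact/in_ideal_sub/GIspan.
  by move=> h; apply: ngN; rewrite -(subrK f (g N)); apply: in_ideal_add.
rewrite leqNgt => /negP; apply.
have : (size (g N - f)%R <= d.+1)%N.
  by rewrite (leq_trans (size_polyD _ _)) // size_polyN geq_max sgN leqnn.
rewrite sgN leq_eqVlt => /orP[/eqP sgf|//].
have : lead_coef (g N - f) == 0.
  by rewrite /lead_coef sgf /= coefB fd /lead_coef subrr.
by rewrite lead_coef_eq0 -size_poly_eq0 sgf.
Qed.

Lemma mpoly_ring_ind (R : comNzRingType) n (P : {mpoly R[n]} -> Prop) :
  (forall c, P c%:MP) -> (forall i, P 'X_i) ->
  (forall p q, P p -> P q -> P (p + q)) ->
  (forall p q, P p -> P q -> P (p * q)) -> forall p, P p.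
Proof.
move=> PC PX PD PM; elim/mpolyind => [|c m p _ _ Pp]; first by rewrite -mpolyC0.
apply: (PD) => //; rewrite -mul_mpolyC; apply: (PM) => //; rewrite mpolyXE_id.
apply: (big_ind P) => [|//|i _]; first by rewrite -mpolyC1.
by elim: (m i) => [|e IH]; rewrite ?expr0 -?mpolyC1 ?exprS; [exact: PC|exact: PM].
Qed.

Lemma noetherian_mpoly (K : fieldType) n : noetherian {mpoly K[n]}.
Proof.
elim: n => [|n IH].
  apply: (@noetherian_image K _ (@mpolyC 0 K)); last exact: noetherian_field.
  elim/mpoly_ring_ind => [c|i|p q [a <-] [b <-]|p q [a <-] [b <-]].
  - by exists c.
  - by case: i.
  - by exists (a + b); rewrite rmorphD.
  - by exists (a * b); rewrite rmorphM.
pose w : {rmorphism {mpoly K[n]} -> {mpoly K[n.+1]}} := @mwiden n K.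
have cX : commr_rmorph w ('X_(ord_max : 'I_n.+1)) by move=> p; apply: mulrC.
apply: (@noetherian_image _ _ (horner_morph cX : {rmorphism _ -> _})); last exact: noetherian_poly.
elim/mpoly_ring_ind => [c|i|p q [a <-] [b <-]|p q [a <-] [b <-]].
- by exists (c%:MP)%:P; rewrite /= /horner_morph map_polyC hornerC /= mwidenC.
- have [->|ni] := eqVneq i ord_max; first by exists 'X; rewrite /= /horner_morph map_polyX hornerX.
  have lt_in : (i < n)%N.
    by move: ni; rewrite -val_eqE ltn_neqAle -ltnS ltn_ord andbT.
  exists ('X_(Ordinal lt_in))%:P; rewrite /= /horner_morph map_polyC hornerC /= mwidenX mnmwiden1.
  by congr 'X_[U_(_)]; apply: val_inj.
- by exists (a + b); rewrite rmorphD.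
- by exists (a * b); rewrite rmorphM.
Qed.

End Noetherian.

(** * Finitely generated subfields *)

Section Subfield.
Variables (K : fieldType) (T : Type).

(** Finite linear combinations, written so that an induction on the list of
    generators removes one generator at a time. *)
Fixpoint in_span (s : seq (T -> K)) (x : T -> K) :=
  if s is u :: s' then exists c, in_span s' (fun t => x t - c * u t)
  else forall t, x t = 0.

Lemma eq_in_span s x y : x =1 y -> in_span s x -> in_span s y.
Proof. by move=> /funext ->. Qed.

Variable S : K -> Prop.
Hypotheses (SB : forall x y, S x -> S y -> S (x - y))
  (SM : forall x y, S x -> S y -> S (x * y)) (SV : forall x, S x -> S x^-1).

Definition with_values (x : T -> K) := forall t, S (x t).

Fixpoint all_with_values (s : seq (T -> K)) :=
  if s is u :: s' then with_values u /\ all_with_values s' else True.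

(** A scalar r that relates two vectors v, w with entries in a subfield S,
    modulo a subspace defined over S that does not contain w, lies in S:
    Gaussian elimination of the generators ends with v = r w and w != 0. *)
Lemma subfield_descent s (v w : T -> K) r :
  all_with_values s -> with_values v -> with_values w ->
  in_span s (fun t => v t - r * w t) -> ~ in_span s w -> S r.
Proof.
have [N] := ubnP (size s); elim: N => // N IH in s v w *.
case: s => [|u s] /= sN => [_ Sv Sw vw nw|[Su Ss] Sv Sw [c vw] nw].
  have /existsNP[t /eqP wt] := nw.
  have /eqP := vw t; rewrite subr_eq0 => /eqP /(canLR (mulfK wt)) <-.
  by apply/SM/SV.
have [[t0 /eqP ut0]|/forallNP u0] := pselect (exists t, ~ u t = 0);
    last first.
  have {}u0 t : u t = 0 by exact: (contrapT (u0 t)).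
  apply: (IH s v w) => //; first by apply: eq_in_span vw => t; rewrite u0 mulr0 subr0.
  move=> sw; apply: nw; exists 0; apply: eq_in_span sw => t.
  by rewrite mul0r subr0.
(* clear the coordinate t0 in all vectors but the pivot u *)
pose red (x : T -> K) t := x t - x t0 / u t0 * u t.
have Sred x : with_values x -> with_values (red x).
  by move=> Sx t; apply/SB/SM => //; apply/SM/SV.
have red_span l x : in_span l x -> in_span (map red l) (red x).
  elim: l x => [|a l IHl] x /=; first by move=> x0 t; rewrite /red !x0 !mul0r subr0.
  move=> [d /IHl xl]; exists d; apply: eq_in_span xl => t.
  by rewrite /red; field.
have span_red l x : in_span (map red l) x -> exists d, in_span l (fun t => x t - d * u t).
  elim: l x => [|a l IHl] x /=; first by move=> x0; exists 0 => t; rewrite x0 mul0r subr0.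
  move=> [d /IHl [e xl]]; exists (e - d * (a t0 / u t0)), d.
  by apply: eq_in_span xl => t; rewrite /red; field.
apply: (IH (map red s) (red v) (red w)); rewrite ?size_map //; try exact: Sred.
- by elim: s Ss {IH sN vw nw red_span span_red} => //= a s IHs [Sa /IHs]; split; first exact: Sred.
- by apply: eq_in_span (red_span _ _ vw) => t; rewrite /red; field.
- move=> /span_red[d wd]; apply: nw; exists (w t0 / u t0 + d).
  by apply: eq_in_span wd => t; rewrite /red; ring.
Qed.

End Subfield.

Section FinGen.
Variables (k K : fieldType) (iota : {rmorphism k -> K}).

(** Membership in the field generated over k by the c_i. *)
Definition ratio_of r (c : 'I_r -> K) (z : K) :=
  exists p q : {mpoly k[r]}, mmap iota c q != 0 /\ z * mmap iota c q = mmap iota c p.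

Variables (N : nat) (x : 'I_N -> K) (L : K -> Prop).
Hypotheses (genK : forall z, ratio_of x z) .
Hypotheses (LC : forall a, L (iota a))
  (LB : forall z w, L z -> L w -> L (z - w))
  (LM : forall z w, L z -> L w -> L (z * w)).

Section Ratio.
Variables (r : nat) (c : 'I_r -> K).

Lemma ratioC a : ratio_of c (iota a).
Proof. by exists a%:MP, 1; rewrite rmorph1 mmapC mulr1 oner_eq0. Qed.

Lemma ratioX i : ratio_of c (c i).
Proof. by exists 'X_i, 1; rewrite rmorph1 mmapX mmap1U mulr1 oner_eq0. Qed.

Lemma ratioB z w : ratio_of c z -> ratio_of c w -> ratio_of c (z - w).
Proof.
move=> [p [q [q0 zE]]] [p' [q' [q'0 wE]]]; exists (p * q' - p' * q), (q * q').
by rewrite rmorphB !rmorphM /= mulf_neq0 // -zE -wE; split=> //; ring.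
Qed.

Lemma ratioM z w : ratio_of c z -> ratio_of c w -> ratio_of c (z * w).
Proof.
move=> [p [q [q0 zE]]] [p' [q' [q'0 wE]]]; exists (p * p'), (q * q').
by rewrite !rmorphM /= mulf_neq0 // -zE -wE; split=> //; ring.
Qed.

Lemma ratioV z : ratio_of c z -> ratio_of c z^-1.
Proof.
move=> [p [q [q0 zE]]]; have [->|z0] := eqVneq z 0.
  by rewrite invr0 -(rmorph0 iota); apply: ratioC.
by exists q, p; rewrite -zE mulf_neq0 // mulKf.
Qed.

End Ratio.

Definition coeffs_in (P : {mpoly K[N]}) := forall m, L P@_m.

(** Here L is a ring between k and K = k(x_1, ..., x_N). Take finitely many
    generators P_i of the ideal of all polynomials over L that vanish at x;
    their coefficients generate L. For z = p(x)/q(x) in L the polynomial p - z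
    q lies in the ideal of the P_i and q does not, so [subfield_descent]
    applies, with monomials as coordinates and the shifts of the P_i by
    monomials as generators. *)
Lemma subfield_fg : exists r (c : 'I_r -> K),
  (forall i, L (c i)) /\ forall z, L z -> ratio_of c z.
Proof.
have [s sP sgen] := @noetherian_mpoly K N (fun P => coeffs_in P /\ P.@[x] = 0).
(* the coefficients of the finitely many relations in s *)
pose cs := flatten [seq [seq P@_m | m <- msupp P] | P <- s].
exists (size cs), (fun i => cs`_i); split=> [i|z Lz].
  have /flatten_mapP[P Ps /mapP[m _ ->]] := mem_nth 0 (ltn_ord i).
  by have [] := sP P Ps.
set c := fun i => _.
have cP P m : P \in s -> ratio_of c P@_m.
  move=> Ps; have [mP|/memN_msupp_eq0 ->] := boolP (m \in msupp P); last first.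
    by rewrite -(rmorph0 iota); apply: ratioC.
  have Pcs : P@_m \in cs by apply/flatten_mapP; exists P => //; apply: map_f.
  have lt_i : (index P@_m cs < size cs)%N by rewrite index_mem.
  by have := ratioX c (Ordinal lt_i); rewrite /c /= nth_index.
have [p [q [q0 zE]]] := genK z.
pose up (f : {mpoly k[N]}) : {mpoly K[N]} := map_mpoly iota f.
have upE f : (up f).@[x] = mmap iota x f.
  elim/mpoly_ring_ind: f => [a|i|f g IHf IHg|f g IHf IHg].
  - by rewrite /up map_mpolyC // mevalC mmapC.
  - by rewrite /up map_mpolyX mevalXU mmapX mmap1U.
  - by rewrite /up !rmorphD /= -!/(up _) IHf IHg.
  - by rewrite /up !rmorphM /= -!/(up _) IHf IHg.
have zrel : in_ideal (fun P => P \in s) (up p - z *: up q).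
  apply: sgen; split; last by rewrite mevalB mevalZ !upE -zE subrr.
  move=> m; rewrite mcoeffB mcoeffZ !mcoeff_map_mpoly.
  by apply: LB; [|apply: LM => //]; apply: LC.
pose vec (f : {mpoly K[N]}) m := f@_m.
have [l lc zl] : exists2 l : seq {mpoly K[N]},
   (forall f, f \in l -> f.@[x] = 0 /\ forall m, ratio_of c f@_m) &
   in_span (map vec l) (vec (up p - z *: up q)).
  elim: zrel => [|a P f Ps _ [l lc lf]].
    by exists [::] => // t; rewrite /vec mcoeff0.
  exists ([seq 'X_[m] * P | m <- msupp a] ++ l) => [g|].
    rewrite mem_cat => /orP[/mapP[m _ ->]|/lc//].
    have [_ Px0] := sP P Ps; rewrite mevalM Px0 mulr0; split=> // m'.
    rewrite [P]mpolyE mulr_sumr raddf_sum /=.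
    apply: big_ind => [|u v ru rv|m1 _]; first by rewrite -(rmorph0 iota); apply: ratioC.
      rewrite -[v]opprK; apply: ratioB => //; rewrite -sub0r; apply: ratioB => //.
      by rewrite -(rmorph0 iota); apply: ratioC.
    rewrite -scalerAr -mpolyXD mcoeffZ mcoeffX; apply: ratioM; first exact: cP.
    by rewrite -(rmorph_nat iota); apply: ratioC.
  rewrite [in a * P](mpolyE a) mulr_suml.
  elim: (msupp a) => [|m u IHu] /=; first by rewrite big_nil add0r.
  exists a@_m; apply: eq_in_span IHu => t.
  by rewrite big_cons /vec !mcoeffD -scalerAl mcoeffZ; ring.
have rup f m : ratio_of c (up f)@_m by rewrite mcoeff_map_mpoly; apply: ratioC.
apply: (@subfield_descent K _ (ratio_of c) _ _ _ (map vec l) (vec (up p)) (vec (up q))).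
- exact: ratioB.
- exact: ratioM.
- exact: ratioV.
- elim: l lc {zl} => //= f l IHl lc; split=> [m|].
    by case: (lc f (mem_head _ _)) => _; apply.
  by apply: IHl => g gl; apply: lc; rewrite inE gl orbT.
- by move=> m; apply: rup.
- by move=> m; apply: rup.
- by apply: eq_in_span zl => m; rewrite /vec mcoeffB mcoeffZ.
(* q does not vanish at x, while all the relations do *)
- move=> ql; move: q0; rewrite -upE => /eqP; apply.
  elim: l (up q) ql lc {zl} => [|f l IHl] g /=.
    move=> g0 _; suff -> : g = 0 by apply: meval0.
    by apply/mpolyP => m; rewrite mcoeff0; apply: g0.
  move=> [d gl] lc; have [fx _] := lc f (mem_head _ _).
  have := IHl (g - d *: f); rewrite mevalB mevalZ fx mulr0 subr0; apply.
    by apply: eq_in_span gl => m; rewrite /vec mcoeffB mcoeffZ.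
  by move=> h hl; apply: lc; rewrite inE hl orbT.
Qed.
End FinGen.

(** * Constructible sets *)

Section Constructible.
Variables (k : closedFieldType) (N : nat).

Inductive constructible : (('I_N -> k) -> Prop) -> Prop :=
| Con_zero p : constructible (fun z => p.@[z] = 0)
| Con_not A : constructible A -> constructible (fun z => ~ A z)
| Con_and A B : constructible A -> constructible B ->
    constructible (fun z => A z /\ B z).

Lemma eq_constructible (A B : ('I_N -> k) -> Prop) :
  (forall z, A z <-> B z) -> constructible A -> constructible B.
Proof. move=> AB; have -> : B = A by apply/funext => z; apply/propext; split=> /AB.
by []. Qed.

Lemma constructible_or (A B : ('I_N -> k) -> Prop) :
  constructible A -> constructible B -> constructible (fun z => A z \/ B z).
Proof.
move=> cA cB; apply: eq_constructible (Con_not (Con_and (Con_not cA) (Con_not cB))).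
move=> z; split=> [|[Az|Bz] []//].
by move=> nAB; apply: contrapT => AB; apply: nAB; split=> ?; apply: AB; [left|right].
Qed.

Let env (z : 'I_N -> k) := codom z.

Lemma nth_env z (i : 'I_N) : (env z)`_i = z i.
Proof. by rewrite (nth_map i) ?size_enum_ord // nth_ord_enum. Qed.

Lemma term_mpoly (t : GRing.term k) : GRing.rterm t ->
  exists p : {mpoly k[N]}, forall z, GRing.eval (env z) t = p.@[z].
Proof.
elim: t => //=.
- move=> i _; have [lt_iN|le_Ni] := ltnP i N.
    by exists 'X_(Ordinal lt_iN) => z; rewrite mevalXU -nth_env.
  by exists 0 => z; rewrite meval0 nth_default // size_codom card_ord.
- by move=> c _; exists c%:MP => z; rewrite mevalC.
- by move=> i _; exists (i%:R)%:MP => z; rewrite mevalC.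
- move=> t IHt u IHu /andP[/IHt[p pE] /IHu[q qE]].
  by exists (p + q) => z; rewrite mevalD pE qE.
- by move=> t IHt /IHt[p pE]; exists (- p) => z; rewrite mevalN pE.
- by move=> t IHt i /IHt[p pE]; exists (p *+ i) => z; rewrite mevalMn pE.
- move=> t IHt u IHu /andP[/IHt[p pE] /IHu[q qE]].
  by exists (p * q) => z; rewrite mevalM pE qE.
- by move=> t IHt i /IHt[p pE]; exists (p ^+ i) => z; rewrite rmorphXn /= pE.
Qed.

Lemma mpoly_term R (p : {mpoly k[R]}) : exists2 t : GRing.term k, GRing.rterm t &
  forall e : seq k, GRing.eval e t = p.@[fun i => e`_i].
Proof.
elim/mpoly_ring_ind: p => [c|i|p q [t rt tE] [u ru uE]|p q [t rt tE] [u ru uE]].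
- by exists (GRing.Const c) => // e; rewrite mevalC.
- by exists (GRing.Var k i) => // e; rewrite mevalXU.
- by exists (GRing.Add t u) => [|e] /=; rewrite ?rt ?mevalD ?tE ?uE.
- by exists (GRing.Mul t u) => [|e] /=; rewrite ?rt ?mevalM ?tE ?uE.
Qed.

Lemma qf_constructible (f : GRing.formula k) : GRing.qf_form f -> GRing.rformula f ->
  constructible (fun z => GRing.qf_eval (env z) f).
Proof.
have conT : constructible (fun=> True).
  by apply: eq_constructible (Con_zero 0) => z; rewrite meval0.
elim: f => //=.
- case=> _ _ //; first by apply: eq_constructible conT.
  by apply: eq_constructible (Con_not conT) => z; split.
- move=> t u _ /andP[rt ru].
  have [p pE] := term_mpoly rt; have [q qE] := term_mpoly ru.
  apply: eq_constructible (Con_zero (p - q)) => z.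
  by rewrite mevalB -pE -qE -subr_eq0; split=> /eqP.
- move=> f IHf g IHg /andP[qf qg] /andP[rf rg].
  by apply: eq_constructible (Con_and (IHf qf rf) (IHg qg rg)) => z; split=> /andP.
- move=> f IHf g IHg /andP[qf qg] /andP[rf rg].
  by apply: eq_constructible (constructible_or (IHf qf rf) (IHg qg rg)) => z; split=> /orP.
- move=> f IHf g IHg /andP[qf qg] /andP[rf rg].
  apply: eq_constructible (constructible_or (Con_not (IHf qf rf)) (IHg qg rg)) => z.
  by rewrite -implyE; split=> /implyP.
- move=> f IHf qf rf; apply: eq_constructible (Con_not (IHf qf rf)) => z.
  by split=> /negP.
Qed.

Definition join_env M (z : 'I_N -> k) (b : 'I_M -> k) (i : 'I_(N + M)) :=
  match fintype.split i with inl i => z i | inr j => b j end.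

(** Quantifier elimination for algebraically closed fields, in the only form
    needed below: the points z over which one polynomial system in b implies
    an equation form a constructible set. *)
Lemma constructible_forall M (es : seq {mpoly k[N + M]}) (P : {mpoly k[N + M]}) :
  constructible (fun z => forall b : 'I_M -> k,
    (forall e, e \in es -> e.@[join_env z b] = 0) -> P.@[join_env z b] = 0).
Proof.
have [f rf fE] : exists2 f : GRing.formula k, GRing.rformula f & forall e,
    GRing.holds e f <-> ((forall q, q \in es -> q.@[fun i => e`_i] = 0) ->
      P.@[fun i => e`_i] = 0).
  elim: es => [|q es [f rf fE]].
    have [t rt tE] := mpoly_term P.
    exists (GRing.Equal t (GRing.NatConst k 0)) => [|e] /=; first by rewrite rt.
    by rewrite tE; split=> [//|]; apply.
  have [t rt tE] := mpoly_term q.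
  exists (GRing.Implies (GRing.Equal t (GRing.NatConst k 0)) f) => [|e] /=.
    by rewrite rt rf.
  rewrite tE fE; split=> [H esP|H qe esP]; apply: H.
  - by apply: esP; apply: mem_head.
  - by move=> r res; apply: esP; rewrite inE res orbT.
  - by move=> r; rewrite inE => /orP[/eqP->|/esP].
pose F := foldr (@GRing.Forall k) f (iota N M).
have rF : GRing.rformula F by rewrite /F; elim: (iota N M).
pose q := GRing.quantifier_elim (@ClosedFieldQE.ex_elim k) F.
have cl : GRing.closed_field_axiom k by exact: GRing.solve_monicpoly.
have /andP[qq rq] := GRing.quantifier_elim_wf (@ClosedFieldQE.wf_ex_elim k) rF.
apply: eq_constructible (qf_constructible qq rq) => z.
have qP := GRing.quantifier_elim_rformP (@ClosedFieldQE.wf_ex_elim k)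
  (ClosedFieldQE.holds_ex_elim cl) (env z) rF.
apply: (iff_trans (B := GRing.holds (env z) F)); first by split=> /qP.
pose ext e i : k := (e : seq k)`_(@nat_of_ord (N + M) i).
have joinE (b : 'I_M -> k) e : (forall i, e`_(@nat_of_ord N i) = z i) ->
    (forall j, e`_(N + @nat_of_ord M j) = b j) -> ext e = join_env z b.
  move=> ez eb; apply/funext => i; rewrite /ext /join_env.
  by case: split_ordP => j ->; rewrite /= ?ez ?eb.
rewrite /F -GRing.foldForallP; split=> [H b|H e agr].
  set e := env z ++ codom b.
  have <- : ext e = join_env z b; last first.
    apply/fE; apply: H => i; rewrite !inE mem_iota => iN.
    rewrite /e nth_cat size_codom card_ord; case: ltnP => // le_Ni.
    rewrite !nth_default // ?size_codom ?card_ord //.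
    by move: iN; rewrite le_Ni /= -leqNgt leq_subRL.
  apply: joinE => j; rewrite /e nth_cat size_codom card_ord.
    by rewrite ltn_ord nth_env.
  rewrite ltnNge leq_addr /= addKn.
  by rewrite (nth_map j) ?size_enum_ord // nth_ord_enum.
have eE : ext e = join_env z (fun j => e`_(N + j)).
  apply: joinE => // i; rewrite -agr ?nth_env // !inE mem_iota.
  by rewrite leqNgt ltn_ord.
by apply/fE => /= esP; move: (H (fun j => e`_(N + j))); rewrite -eE; apply.
Qed.
End Constructible.

(** * The function field of an irreducible n-variety *)

Section FunctionField.
Variables (k : closedFieldType) (n m : nat) (X : irr_nvariety k n m).

Notation gen := (generically X).

(** Finite intersections of nonempty open subsets of an irreducible set are
    nonempty. *)
Lemma gen_forall (I : finType) (P : I -> point k n m -> Prop) :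
  (forall i, gen (P i)) -> gen (fun a => forall i, P i a).
Proof.
move=> gP; have : gen (fun a => forall i, i \in enum I -> P i a).
  elim: (enum I) => [|i s IH]; first by apply: generically_all.
  apply: (generically_and _ (gP i) IH) => a _ Pi Ps j.
  by rewrite inE => /orP[/eqP->|/Ps].
by apply: generically_impl => a _ Pa i; apply: Pa; rewrite mem_enum.
Qed.

Lemma gen_and (P Q : point k n m -> Prop) :
  gen P -> gen Q -> gen (fun a => P a /\ Q a).
Proof. by apply: generically_and => a _. Qed.

Lemma generically_and3 (P Q R S : point k n m -> Prop) :
  (forall a, X a -> P a -> Q a -> R a -> S a) -> gen P -> gen Q -> gen R -> gen S.
Proof.
move=> PQRS gP gQ gR; apply: (generically_and _ (gen_and gP gQ) gR).
by move=> a Xa [Pa Qa]; apply: PQRS.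
Qed.

Lemma generically_and4 (P Q R S T : point k n m -> Prop) :
  (forall a, X a -> P a -> Q a -> R a -> S a -> T a) ->
  gen P -> gen Q -> gen R -> gen S -> gen T.
Proof.
move=> PQRST gP gQ gR gS; apply: (generically_and3 _ (gen_and gP gQ) gR gS).
by move=> a Xa [Pa Qa]; apply: PQRST.
Qed.

(** The composite of D with conjugation by g. *)
Definition conj_poly (g : 'M[k]_n.+1) (D : cpoly k n m) : cpoly k n m :=
  D \mPo [tuple (let: (h, i, j) := enum_val r in
   \sum_s \sum_t (g i s)%:MP * 'X_(enum_rank (h, s, t)) * (invmx g t j)%:MP) | r < nvars n m].

Lemma conj_polyE g D b : (conj_poly g D).@[coord b] = D.@[coord (conj_pt g b)].
Proof.
rewrite comp_mpoly_meval; apply: meval_eq => r; rewrite tnth_mktuple /coord.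
case: (enum_val r) => [[h i] j]; rewrite ffunE /conj_mx !mxE raddf_sum /=.
under [RHS]eq_bigr do rewrite mxE mulr_suml.
rewrite exchange_big; apply: eq_bigr => s _.
rewrite raddf_sum; apply: eq_bigr => t _ /=.
by rewrite !mevalM !mevalC mevalXU /coord enum_rankK.
Qed.

Lemma conj_ptK (g : 'M[k]_n.+1) : g \in unitmx ->
  cancel (@conj_pt k n m (invmx g)) (conj_pt g).
Proof.
move=> ug a; apply/ffunP => h; rewrite !ffunE /conj_mx.
by rewrite invmxK !mulmxA mulmxV // mul1mx -mulmxA mulmxV // mulmx1.
Qed.

Lemma nonvanishing_conj g D : g \in unitmx ->
  nonvanishing X D -> nonvanishing X (conj_poly g D).
Proof.
move=> ug [a Xa Da]; exists (conj_pt (invmx g) a).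
  by apply: nvar_stable; rewrite ?unitmx_inv.
by rewrite conj_polyE conj_ptK.
Qed.

(** Conjugation by g is a homeomorphism of X. *)
Lemma gen_translate g (P : point k n m -> Prop) : g \in unitmx ->
  gen P -> gen (fun a => P (conj_pt g a)).
Proof.
move=> ug [D nD DP]; exists (conj_poly g D); first exact: nonvanishing_conj.
by move=> a Xa; rewrite conj_polyE; apply: DP; apply: nvar_stable.
Qed.

(** An alias, so that pointwise operations on it form a commutative ring. *)
Definition sfun := point k n m -> k.
HB.instance Definition _ := GRing.ComNzRing.on sfun.

Definition rat_fun (f : sfun) := exists P Q : cpoly k n m, nonvanishing X Q /\
  forall a, X a -> Q.@[coord a] != 0 -> f a = P.@[coord a] / Q.@[coord a].

Definition in_rat : {pred sfun} := fun f => `[< rat_fun f >].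

Lemma rat_poly (P : cpoly k n m) : rat_fun (fun a => P.@[coord a]).
Proof.
exists P, 1; split=> [|a Xa _]; first exact: nonvanishing1.
by rewrite meval1 divr1.
Qed.

Fact in_rat_closed : GRing.subring_closed in_rat.
Proof.
split=> [|f g /asboolP[P [Q [nQ fE]]] /asboolP[R [S [nS gE]]]
  |f g /asboolP[P [Q [nQ fE]]] /asboolP[R [S [nS gE]]]]; apply/asboolP.
- have [P [Q [nQ PQ]]] := rat_poly 1; exists P, Q; split=> // a Xa Qa.
  by rewrite -PQ // meval1.
- exists (P * S - R * Q), (Q * S); split=> [|a Xa]; first exact: nonvanishingM.
  rewrite mevalM mulf_eq0 negb_or => /andP[Qa Sa].
  rewrite [LHS](congr2 (fun u v => u - v) (fE a Xa Qa) (gE a Xa Sa)).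
  by rewrite mevalB !mevalM; field; rewrite Qa Sa.
- exists (P * R), (Q * S); split=> [|a Xa]; first exact: nonvanishingM.
  rewrite mevalM mulf_eq0 negb_or => /andP[Qa Sa].
  rewrite [LHS](congr2 *%R (fE a Xa Qa) (gE a Xa Sa)) !mevalM.
  by field; rewrite Qa Sa.
Qed.

HB.instance Definition _ := @GRing.isSubringClosed.Build sfun in_rat in_rat_closed.

Record ratfun := RatFun { ratfun_val : sfun; _ : ratfun_val \in in_rat }.
HB.instance Definition _ := [isSub for ratfun_val].
HB.instance Definition _ := [Choice of ratfun by <:].
HB.instance Definition _ := [SubChoice_isSubComNzRing of ratfun by <:].

Definition ratfun0 : {pred ratfun} :=
  fun f => `[< gen (fun a => ratfun_val f a = 0) >].

Lemma ratfun0P f : reflect (gen (fun a => ratfun_val f a = 0)) (f \in ratfun0).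
Proof. exact: asboolP. Qed.

Fact ratfun0_zmod : zmod_closed ratfun0.
Proof.
split=> [|f g /ratfun0P f0 /ratfun0P g0]; apply/ratfun0P; first exact: generically_all.
apply: (generically_and _ f0 g0) => a _ fa ga.
by rewrite /= [LHS](congr2 (fun u v => u - v) fa ga) subr0.
Qed.

HB.instance Definition _ := GRing.isZmodClosed.Build ratfun ratfun0 ratfun0_zmod.

Fact ratfun0_proper :
  1 \notin ratfun0 /\ forall f, {in ratfun0, forall g, f * g \in ratfun0}.
Proof.
split=> [|f g /ratfun0P g0].
  apply/negP => /ratfun0P /generically_ex[a _ /eqP].
  by rewrite /= [X in X == _]/GRing.one /= oner_eq0.
apply/ratfun0P; apply: (generically_impl _ g0) => a _ ga.
by rewrite /= [LHS](congr1 ( *%R (ratfun_val f a)) ga) mulr0.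
Qed.

HB.instance Definition _ := isProperIdeal.Build ratfun ratfun0 ratfun0_proper.

(** Rational functions modulo generic equality. In this model an element has
    values, so that identities in the field are generic pointwise identities.
    *)
Definition funfield := Quotient.quot ratfun0.
HB.instance Definition _ := GRing.ComNzRing.on funfield.
HB.instance Definition _ := EqQuotient.on funfield.

(** A representing function; its values are meaningful only generically. *)
Definition ev (z : funfield) : point k n m -> k := ratfun_val (repr z).

Definition to_K (f : sfun) : funfield := \pi_funfield (insubd (0 : ratfun) f).

Lemma ev_rat z : rat_fun (ev z).
Proof. by rewrite /ev; case: (repr z) => f fr; apply/asboolP. Qed.

Lemma pi_funfieldP (f g : ratfun) : \pi_funfield f = \pi_funfield g <->
  gen (fun a => ratfun_val f a = ratfun_val g a).
Proof.
have fgE : (f - g \in ratfun0) = (\pi_funfield f == \pi_funfield g).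
  exact: Quotient.idealrBE.
split=> [/eqP|fg].
  rewrite -fgE => /ratfun0P fg; apply: (generically_impl _ fg) => a _ /eqP.
  by rewrite /= [X in X == 0]/(ratfun_val f a - ratfun_val g a) subr_eq0 => /eqP.
apply/eqP; rewrite -fgE; apply/ratfun0P.
apply: (generically_impl _ fg) => a _ fga /=.
by rewrite -[LHS]/(ratfun_val f a - ratfun_val g a) fga subrr.
Qed.

Lemma eqK z w : z = w <-> gen (fun a => ev z a = ev w a).
Proof. by rewrite -pi_funfieldP !reprK. Qed.

Lemma ev_to_K f : rat_fun f -> gen (fun a => ev (to_K f) a = f a).
Proof.
move=> rf; have fE : ratfun_val (insubd (0 : ratfun) f) = f.
  by apply: insubdK; apply/asboolP.
have := (pi_funfieldP (repr (to_K f)) (insubd (0 : ratfun) f)).1.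
by rewrite reprK fE; apply.
Qed.

Lemma evD z w : gen (fun a => ev (z + w) a = ev z a + ev w a).
Proof.
apply: (pi_funfieldP (repr (z + w)) (repr z + repr w)).1.
by rewrite reprK -{1}[z]reprK -{1}[w]reprK [LHS]piE.
Qed.

Lemma evN z : gen (fun a => ev (- z) a = - ev z a).
Proof.
by apply: (pi_funfieldP (repr (- z)) (- repr z)).1; rewrite reprK -{1}[z]reprK [LHS]piE.
Qed.

Lemma evM z w : gen (fun a => ev (z * w) a = ev z a * ev w a).
Proof.
apply: (pi_funfieldP (repr (z * w)) (repr z * repr w)).1.
by rewrite reprK -{1}[z]reprK -{1}[w]reprK [LHS]piE.
Qed.

Lemma ev1 : gen (fun a => ev 1 a = 1).
Proof.
apply: (pi_funfieldP (repr 1) 1).1.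
by rewrite reprK -[LHS]/(Quotient.one _) /Quotient.one -lock.
Qed.

Lemma ev0 : gen (fun a => ev 0 a = 0).
Proof.
apply: (pi_funfieldP (repr 0) 0).1.
by rewrite reprK -[LHS]/(Quotient.zero _) /Quotient.zero -lock.
Qed.

Lemma rat_inv f : rat_fun f -> rat_fun (fun a => (f a)^-1).
Proof.
move=> [P [Q [nQ fE]]]; have [nP|vP] := pselect (nonvanishing X P).
  exists (Q * Q), (P * Q); split=> [|a Xa]; first exact: nonvanishingM.
  rewrite !mevalM mulf_eq0 negb_or => /andP[Pa Qa].
  by rewrite fE //; field; rewrite Qa Pa.
exists 0, Q; split=> // a Xa Qa; rewrite fE // meval0 mul0r.
have -> : P.@[coord a] = 0 by apply: contrapT => /eqP Pa; apply: vP; exists a.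
by rewrite mul0r invr0.
Qed.

Lemma rat_conj g f : g \in unitmx -> rat_fun f -> rat_fun (fun a => f (conj_pt g a)).
Proof.
move=> ug [P [Q [nQ fE]]]; exists (conj_poly g P), (conj_poly g Q).
split=> [|a Xa]; first exact: nonvanishing_conj.
by rewrite !conj_polyE; apply: fE; apply: nvar_stable.
Qed.

(** Needed because a rational map to matrices is given by a single
    denominator. *)
Lemma rat_common_den (I : finType) (f : I -> sfun) : (forall i, rat_fun (f i)) ->
  exists (Q : cpoly k n m) (P : I -> cpoly k n m), nonvanishing X Q /\
    forall i a, X a -> Q.@[coord a] != 0 -> f i a = (P i).@[coord a] / Q.@[coord a].
Proof.
move=> rf; have [P0 /choice[Q0 PQ]] := choice rf.
exists (\prod_i Q0 i), (fun i => P0 i * \prod_(j | j != i) Q0 j); split.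
  apply: (big_ind (nonvanishing X)); first exact: nonvanishing1.
    exact: nonvanishingM.
  by move=> i _; case: (PQ i).
move=> i a Xa; have [_ fE] := PQ i.
rewrite (bigD1 i) //= !mevalM mulf_eq0 negb_or => /andP[Qi Qj].
by rewrite fE //; field; rewrite Qi Qj.
Qed.

Definition inv_K z := to_K (fun a => (ev z a)^-1).

Lemma ev_inv_K z : gen (fun a => ev (inv_K z) a = (ev z a)^-1).
Proof. exact/ev_to_K/rat_inv/ev_rat. Qed.

(** By irreducibility, a rational function that does not vanish generically is
    generically nonzero. *)
Lemma ev_neq0 z : z != 0 -> gen (fun a => ev z a != 0).
Proof.
have [P [Q [nQ zE]]] := ev_rat z; have [nP _|vP /eqP[]] := pselect (nonvanishing X P).
  exists (P * Q); first exact: nonvanishingM.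
  move=> a Xa; rewrite mevalM mulf_eq0 negb_or => /andP[Pa Qa].
  by rewrite zE // mulf_neq0 // invr_eq0.
apply/eqK; apply: (generically_and _ ev0 (_ : gen (fun a => ev z a = 0))).
  by move=> a _ -> ->.
exists Q => // a Xa Qa; rewrite zE //.
suff -> : P.@[coord a] = 0 by rewrite mul0r.
by apply: contrapT => /eqP Pa; apply: vP; exists a.
Qed.

Fact mulVK z : z != 0 -> inv_K z * z = 1.
Proof.
move=> z0; apply/eqK; apply: (generically_and4 _ (evM (inv_K z) z) ev1 (ev_inv_K z) (ev_neq0 z0)).
by move=> a _ -> -> -> za; rewrite mulVf.
Qed.

Fact invK0 : inv_K 0 = 0.
Proof.
apply/eqK; apply: (generically_and _ (ev_inv_K 0) ev0) => a _ -> ->.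
by rewrite invr0.
Qed.

HB.instance Definition _ := GRing.ComNzRing_isField.Build funfield mulVK invK0.

Definition cst_K (c : k) : funfield := to_K (fun=> c).

Lemma ev_cst c : gen (fun a => ev (cst_K c) a = c).
Proof.
apply: ev_to_K; have [P [Q [nQ PQ]]] := rat_poly c%:MP.
by exists P, Q; split=> // a Xa Qa; rewrite -PQ // mevalC.
Qed.

Fact cst_K_additive : additive cst_K.
Proof.
move=> c d; apply/eqK.
apply: (generically_and4 _ (ev_cst (c - d)) (ev_cst c) (ev_cst d)
  (gen_and (evD (cst_K c) (- cst_K d)) (evN (cst_K d)))).
by move=> a _ /= -> c' d' [-> ->]; rewrite c' d'.
Qed.

Fact cst_K_monoid : monoid_morphism cst_K.
Proof.
split=> [|c d]; apply/eqK.
  by apply: (generically_and _ (ev_cst 1) ev1) => a _ -> ->.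
apply: (generically_and4 _ (ev_cst (c * d)) (ev_cst c) (ev_cst d) (evM (cst_K c) (cst_K d))).
by move=> a _ -> c' d' ->; rewrite c' d'.
Qed.

HB.instance Definition _ := GRing.isAdditive.Build k funfield cst_K cst_K_additive.
HB.instance Definition _ := GRing.isMonoidMorphism.Build k funfield cst_K cst_K_monoid.

Lemma ev_mmap r (z : 'I_r -> funfield) (P : {mpoly k[r]}) :
  gen (fun a => ev (mmap cst_K z P) a = P.@[fun i => ev (z i) a]).
Proof.
elim/mpoly_ring_ind: P => [c|i|P Q IHP IHQ|P Q IHP IHQ].
- by rewrite mmapC; apply: (generically_impl _ (ev_cst c)) => a _ ->; rewrite mevalC.
- by rewrite mmapX mmap1U; apply: generically_all => a _; rewrite mevalXU.
- rewrite rmorphD.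
  apply: (generically_and3 _ (evD (mmap cst_K z P) (mmap cst_K z Q)) IHP IHQ).
  move=> a _ -> -> ->.
  by rewrite mevalD.
- rewrite rmorphM.
  apply: (generically_and3 _ (evM (mmap cst_K z P) (mmap cst_K z Q)) IHP IHQ).
  move=> a _ -> -> ->.
  by rewrite mevalM.
Qed.

Lemma mmap_eq0 r (z : 'I_r -> funfield) (P : {mpoly k[r]}) :
  mmap cst_K z P = 0 <-> gen (fun a => P.@[fun i => ev (z i) a] = 0).
Proof.
rewrite eqK; split; apply: (generically_and3 _ ev0 (ev_mmap z P)).
  by move=> a _ -> -> ->.
by move=> a _ -> -> ->.
Qed.

Lemma mmap_neq0 r (z : 'I_r -> funfield) (P : {mpoly k[r]}) :
  mmap cst_K z P != 0 -> gen (fun a => P.@[fun i => ev (z i) a] != 0).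
Proof. by move/ev_neq0=> P0; apply: (generically_and _ (ev_mmap z P) P0) => a _ ->. Qed.

(** An infinite set of equations may be imposed on one and the same open set,
    since finitely many of them imply all the others. *)
Lemma gen_all r (z : 'I_r -> funfield) (S : {mpoly k[r]} -> Prop) :
  (forall P, S P -> mmap cst_K z P = 0) ->
  gen (fun a => forall P, S P -> P.@[fun i => ev (z i) a] = 0).
Proof.
move=> S0; have [s sS Ss] := noetherian_mpoly S.
have : gen (fun a => forall P, P \in s -> P.@[fun i => ev (z i) a] = 0).
  elim: s sS {Ss} => [|P s IH] sS; first exact: generically_all.
  have /mmap_eq0 := S0 P (sS P (mem_head _ _)).
  apply: (generically_and _ (IH _)) => [a _ sa Pa Q|Q Qs]; last first.
    by apply: sS; rewrite inE Qs orbT.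
  by rewrite inE => /orP[/eqP->|/sa].
apply: generically_impl => a _ sa P /Ss; elim=> [|Q U V Us _ IH].
  exact: meval0.
by rewrite mevalD mevalM IH (sa _ Us) mulr0 addr0.
Qed.

Definition coord_K (r : 'I_(nvars n m)) : funfield := to_K (fun a => coord a r).

Lemma ev_coord r : gen (fun a => ev (coord_K r) a = coord a r).
Proof.
apply: ev_to_K; have [P [Q [nQ PQ]]] := rat_poly 'X_r.
by exists P, Q; split=> // a Xa Qa; rewrite -PQ // mevalXU.
Qed.

Lemma gen_coord : gen (fun a => forall r, ev (coord_K r) a = coord a r).
Proof. exact/gen_forall/ev_coord. Qed.

(** The polynomials that vanish in the function field are those of the ideal
    of X: a polynomial that vanishes on a nonempty open subset of X vanishes
    on X. *)
Lemma mmap_coord_eq0 P :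
  mmap cst_K coord_K P = 0 <-> forall a, X a -> P.@[coord a] = 0.
Proof.
rewrite mmap_eq0; split=> [|P0]; last first.
  by apply: (generically_impl _ gen_coord) => a Xa /meval_eq->; apply: P0.
move=> P0 a Xa; apply: contrapT => /eqP Pa.
have nP : nonvanishing X P by exists a.
have [] := @generically_ex _ _ _ X (fun=> False); last by [].
apply: (generically_and3 _ P0 gen_coord (ex_intro2 _ _ P nP (fun b _ Pb => Pb))).
by move=> b _ + /meval_eq E; rewrite E => ->; rewrite eqxx.
Qed.

Lemma funfield_gen z : ratio_of cst_K coord_K z.
Proof.
have [P [Q [nQ zE]]] := ev_rat z; exists P, Q.
have Q0 : mmap cst_K coord_K Q != 0.
  apply/eqP => /mmap_coord_eq0 Q0; have [a Xa] := nQ.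
  by rewrite Q0 ?eqxx.
split=> //; apply/eqK.
have gQ : gen (fun a => Q.@[coord a] != 0) by exists Q.
have gz : gen (fun a => ev z a = P.@[coord a] / Q.@[coord a]) by exists Q.
apply: (generically_and4 _ (gen_and (evM z (mmap cst_K coord_K Q)) gz)
  (gen_and (ev_mmap coord_K P) (ev_mmap coord_K Q)) gen_coord gQ).
by move=> a _ /= [-> ->] [-> ->] /meval_eq E Qa; rewrite !E divfK.
Qed.

End FunctionField.

(** * Equivariant rational maps as matrices over the function field *)

Section Matrices.
Variables (k : closedFieldType) (n m : nat) (X : irr_nvariety k n m).

Notation gen := (generically X).
Notation K := (funfield X).

Lemma ev_sum (I : Type) (s : seq I) (F : I -> K) :
  gen (fun a => ev (\sum_(i <- s) F i) a = \sum_(i <- s) ev (F i) a).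
Proof.
elim: s => [|i s IH].
  by apply: (generically_impl _ (ev0 X)) => a _; rewrite !big_nil.
rewrite big_cons; apply: (generically_and _ (evD (F i) (\sum_(j <- s) F j)) IH).
by move=> a _ -> ->; rewrite big_cons.
Qed.

Definition ev_mx p q (M : 'M[K]_(p, q)) (a : point k n m) : 'M[k]_(p, q) :=
  map_mx (fun z => ev z a) M.

Lemma gen_mx p q (M N : point k n m -> 'M[k]_(p, q)) :
  (forall i j, gen (fun a => M a i j = N a i j)) -> gen (fun a => M a = N a).
Proof.
move=> MN; have := gen_forall (fun i => gen_forall (MN i)).
by apply: generically_impl => a _ E; apply/matrixP.
Qed.

Lemma eq_ev_mx p q (M N : 'M[K]_(p, q)) :
  M = N <-> gen (fun a => ev_mx M a = ev_mx N a).
Proof.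
split=> [->|MN]; first exact: generically_all.
apply/matrixP => i j; apply/eqK; apply: (generically_impl _ MN) => a _ /matrixP.
by move=> /(_ i j); rewrite !mxE.
Qed.

Lemma ev_mxM p q r (M : 'M[K]_(p, q)) (N : 'M[K]_(q, r)) :
  gen (fun a => ev_mx (M *m N) a = ev_mx M a *m ev_mx N a).
Proof.
apply: gen_mx => i j.
have := gen_and (ev_sum (index_enum _) (fun l => M i l * N l j))
  (gen_forall (fun l => evM (M i l) (N l j))).
apply: generically_impl => a _ [E F]; rewrite !mxE E.
by apply: eq_bigr => l _; rewrite F !mxE.
Qed.

Lemma ev_mxD p q (M N : 'M[K]_(p, q)) :
  gen (fun a => ev_mx (M + N) a = ev_mx M a + ev_mx N a).
Proof.
apply: gen_mx => i j; apply: (generically_impl _ (evD (M i j) (N i j))) => a _ E.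
by rewrite !mxE E.
Qed.

Lemma ev_mxZ p q z (M : 'M[K]_(p, q)) :
  gen (fun a => ev_mx (z *: M) a = ev z a *: ev_mx M a).
Proof.
apply: gen_mx => i j; apply: (generically_impl _ (evM z (M i j))) => a _ E.
by rewrite !mxE E.
Qed.

Lemma ev_mx_scalar p z : gen (fun a => ev_mx (z%:M : 'M[K]_p) a = (ev z a)%:M).
Proof.
apply: gen_mx => i j; apply: (generically_impl _ (ev0 X)) => a _ E.
by rewrite !mxE; case: (i == j); rewrite ?mulr1n ?mulr0n.
Qed.

Lemma ev_mx1 p : gen (fun a => ev_mx (1%:M : 'M[K]_p) a = 1%:M).
Proof.
apply: (generically_and _ (ev_mx_scalar p 1) (ev1 X)) => a _ ->.
by move=> ->.
Qed.

Lemma ev_mx_unit p (M : 'M[K]_p) : M \in unitmx ->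
  gen (fun a => ev_mx M a \in unitmx /\ ev_mx (invmx M) a = invmx (ev_mx M a)).
Proof.
move=> uM; have := gen_and (ev_mxM M (invmx M)) (ev_mx1 p).
apply: generically_impl => a _ [E F].
have : ev_mx M a *m ev_mx (invmx M) a = 1%:M by rewrite -E mulmxV.
move=> MV; have [uMa _] := mulmx1_unit MV; split=> //.
by rewrite -[RHS]mulmx1 -MV mulKmx.
Qed.

Definition cst_mx p q (g : 'M[k]_(p, q)) : 'M[K]_(p, q) := map_mx (cst_K X) g.

Lemma ev_cst_mx p q (g : 'M[k]_(p, q)) : gen (fun a => ev_mx (cst_mx g) a = g).
Proof.
apply: gen_mx => i j; apply: (generically_impl _ (ev_cst X (g i j))) => a _ E.
by rewrite !mxE.
Qed.

Lemma unitmx_cst p (g : 'M[k]_p) : (cst_mx g \in unitmx) = (g \in unitmx).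
Proof. exact: map_unitmx. Qed.

(** The action of a unit matrix g on the function field, induced by
    conjugation on X. *)
Definition sigma (g : 'M[k]_n.+1) (z : K) : K := to_K X (fun a => ev z (conj_pt g a)).

Section Sigma.
Variables (g : 'M[k]_n.+1) (ug : g \in unitmx).

Lemma ev_sigma z : gen (fun a => ev (sigma g z) a = ev z (conj_pt g a)).
Proof. by apply/ev_to_K/rat_conj/ev_rat. Qed.

Lemma sigmaD z w : sigma g (z + w) = sigma g z + sigma g w.
Proof.
apply/eqK; apply: (generically_and4 _ (gen_and (ev_sigma (z + w)) (gen_translate ug (evD z w)))
  (ev_sigma z) (ev_sigma w) (evD (sigma g z) (sigma g w))).
by move=> a _ /= [-> ->] <- <- ->.
Qed.

Lemma sigmaM z w : sigma g (z * w) = sigma g z * sigma g w.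
Proof.
apply/eqK; apply: (generically_and4 _ (gen_and (ev_sigma (z * w)) (gen_translate ug (evM z w)))
  (ev_sigma z) (ev_sigma w) (evM (sigma g z) (sigma g w))).
by move=> a _ /= [-> ->] <- <- ->.
Qed.

Lemma sigma_cst c : sigma g (cst_K X c) = cst_K X c.
Proof.
apply/eqK; apply: (generically_and3 _ (ev_sigma (cst_K X c)) (ev_cst X c) (gen_translate ug (ev_cst X c))).
by move=> a _ /= -> -> ->.
Qed.

Fact sigma_additive : additive (sigma g).
Proof.
move=> z w; rewrite sigmaD; congr (_ + _).
by apply: (addrI (sigma g w)); rewrite -sigmaD !subrr -(rmorph0 (cst_K X)) sigma_cst.
Qed.

Fact sigma_monoid : monoid_morphism (sigma g).
Proof. by split; [rewrite -(rmorph1 (cst_K X)) sigma_cst|exact: sigmaM]. Qed.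

Definition sigma_rmorph : {rmorphism K -> K} := HB.pack (sigma g)
  (GRing.isAdditive.Build K K (sigma g) sigma_additive)
  (GRing.isMonoidMorphism.Build K K (sigma g) sigma_monoid).

Lemma ev_sigma_mx p q (M : 'M[K]_(p, q)) :
  gen (fun a => ev_mx (map_mx (sigma g) M) a = ev_mx M (conj_pt g a)).
Proof.
apply: gen_mx => i j; apply: (generically_impl _ (ev_sigma (M i j))) => a _ E.
by rewrite !mxE.
Qed.

End Sigma.

Definition conj_K (g : 'M[k]_n.+1) (M : 'M[K]_n.+1) :=
  cst_mx g *m M *m invmx (cst_mx g).

Lemma ev_conj_K g (M : 'M[K]_n.+1) : g \in unitmx ->
  gen (fun a => ev_mx (conj_K g M) a = conj_mx g (ev_mx M a)).
Proof.
move=> ug; rewrite /conj_K -map_invmx.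
apply: (generically_and3 _ (ev_mxM (cst_mx g *m M) (cst_mx (invmx g))) (ev_mxM (cst_mx g) M)
  (gen_and (ev_cst_mx g) (ev_cst_mx (invmx g)))).
by move=> a _ /= -> -> [-> ->].
Qed.

(** Equivariance, as an identity between matrices over the function field. *)
Definition equiv_mx (M : 'M[K]_n.+1) :=
  forall g, g \in unitmx -> map_mx (sigma g) M = conj_K g M.

Definition invariant (z : K) := forall g, g \in unitmx -> sigma g z = z.

Lemma equiv_mxP (M : 'M[K]_n.+1) : equiv_mx M <-> equivariant X (ev_mx M).
Proof.
split=> eM g ug.
  have /eq_ev_mx := eM g ug => E.
  apply: (generically_and3 _ E (ev_sigma_mx ug M) (ev_conj_K M ug)).
  by move=> a _ + <- <-.
apply/eq_ev_mx; apply: (generically_and3 _ (eM g ug) (ev_sigma_mx ug M) (ev_conj_K M ug)).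
by move=> a _ + -> ->.
Qed.

Definition to_mx (f : mxfun k n m) : 'M[K]_n.+1 := \matrix_(i, j) to_K X (fun a => f a i j).

Lemma rational_entry f i j : rational X f -> rat_fun X (fun a => f a i j).
Proof.
move=> [P [Q [nQ fE]]]; exists (P i j), Q; split=> // a Xa Qa.
by rewrite fE // !mxE mulrC.
Qed.

Lemma ev_to_mx f : rational X f -> gen (fun a => ev_mx (to_mx f) a = f a).
Proof.
move=> rf; apply: gen_mx => i j.
by apply: (generically_impl _ (ev_to_K (rational_entry i j rf))) => a _; rewrite !mxE.
Qed.

Lemma rational_ev_mx (M : 'M[K]_n.+1) : rational X (ev_mx M).
Proof.
have [Q [P [nQ PQ]]] := rat_common_den (fun ij => ev_rat (M ij.1 ij.2)).
exists (\matrix_(i, j) P (i, j)), Q; split=> // a Xa Qa.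
by apply/matrixP => i j; rewrite !mxE (PQ (i, j)) // mulrC.
Qed.

Lemma rmap_val_rmaps (u : RMaps X) : rational X (rmap_val u) /\ equivariant X (rmap_val u).
Proof. by rewrite /rmap_val; case: (repr u) => f fr; apply/asboolP. Qed.

(** A rational map to matrices as a matrix of rational functions. *)
Definition rho (u : RMaps X) : 'M[K]_n.+1 := to_mx (rmap_val u).

Lemma ev_rho u : gen (fun a => ev_mx (rho u) a = rmap_val u a).
Proof. by apply: ev_to_mx; case: (rmap_val_rmaps u). Qed.

Notation quo := (to_quot (genzero_biideal X)).

Lemma rmap_val_quo r : gen (fun a => rmap_val (quo r) a = rmap_fun r a).
Proof.
have := repr_to_quot (genzero_biideal X) r; apply: generically_impl => a _ /eqP.
by rewrite /= [X in X == _]/(rmap_val _ a - rmap_fun r a) subr_eq0 => /eqP.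
Qed.

Lemma ev_rho_quo r : gen (fun a => ev_mx (rho (quo r)) a = rmap_fun r a).
Proof. by apply: (generically_and _ (ev_rho (quo r)) (rmap_val_quo r)) => a _ -> ->. Qed.

Lemma rho_inj : injective rho.
Proof.
move=> u v uv; rewrite -[u]repr_quotK -[v]repr_quotK; apply/to_quotP.
apply: (generically_and _ (ev_rho u) (ev_rho v)) => a _; rewrite uv => -> uva.
by rewrite /= -[LHS]/(rmap_val u a - rmap_val v a) uva subrr.
Qed.

Lemma rhoD u v : rho (u + v) = rho u + rho v.
Proof.
rewrite -[u]repr_quotK -[v]repr_quotK -to_quotD; apply/eq_ev_mx.
apply: (generically_and4 _ (ev_rho_quo (repr u + repr v)) (ev_rho_quo (repr u)) (ev_rho_quo (repr v))
  (ev_mxD (rho (quo (repr u))) (rho (quo (repr v))))).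
by move=> a _ -> E F ->; rewrite E F.
Qed.

Lemma rhoM u v : rho (u * v) = rho u * rho v.
Proof.
rewrite -[u]repr_quotK -[v]repr_quotK [_ * _ in LHS]quot_mulE; apply/eq_ev_mx.
apply: (generically_and4 _ (ev_rho_quo (repr u * repr v)) (ev_rho_quo (repr u)) (ev_rho_quo (repr v))
  (ev_mxM (rho (quo (repr u))) (rho (quo (repr v))))).
by move=> a _ -> E F ->; rewrite E F.
Qed.

Lemma rho1 : rho 1 = 1.
Proof.
apply/eq_ev_mx; apply: (generically_and _ (ev_rho_quo 1) (ev_mx1 n.+1)).
by move=> a _ -> ->.
Qed.

Lemma rhoZ c u : rho (c *: u) = cst_K X c *: rho u.
Proof.
rewrite -[u]repr_quotK [_ *: _ in LHS]quot_scaleE; apply/eq_ev_mx.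
apply: (generically_and4 _ (ev_rho_quo (c *: repr u)) (ev_rho_quo (repr u))
  (ev_mxZ (cst_K X c) (rho (quo (repr u)))) (ev_cst X c)).
by move=> a _ -> E -> ->; rewrite E.
Qed.

Fact rho_additive : additive rho.
Proof.
move=> u v; rewrite rhoD; congr (_ + _).
by rewrite -scaleN1r rhoZ rmorphN1 scaleN1r.
Qed.

Fact rho_monoid : monoid_morphism rho.
Proof. by split; [exact: rho1|exact: rhoM]. Qed.

HB.instance Definition _ := GRing.isAdditive.Build (RMaps X) 'M[K]_n.+1 rho rho_additive.
HB.instance Definition _ := GRing.isMonoidMorphism.Build (RMaps X) 'M[K]_n.+1 rho rho_monoid.

Lemma rho_equiv u : equiv_mx (rho u).
Proof.
apply/equiv_mxP => g ug; have [_ /(_ g ug) eu] := rmap_val_rmaps u.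
apply: (generically_and3 _ eu (ev_rho u) (gen_translate ug (ev_rho u))).
by move=> a _ /= E -> ->.
Qed.

Lemma equiv_rho (M : 'M[K]_n.+1) : equiv_mx M -> exists u, rho u = M.
Proof.
move=> /equiv_mxP eM; have rM : ev_mx M \in in_rmaps X.
  by apply/asboolP; split=> //; apply: rational_ev_mx.
exists (quo (RmapRep rM)); apply/eq_ev_mx.
exact: (ev_rho_quo (RmapRep rM)).
Qed.

End Matrices.

(** * The algebra of equivariant maps over the field of invariants *)

Lemma similarM (R : comUnitRingType) p (g M M' : 'M[R]_p) : g \in unitmx ->
  g *m (M *m M') *m invmx g = (g *m M *m invmx g) *m (g *m M' *m invmx g).
Proof. by move=> ug; rewrite !mulmxA mulmxKV. Qed.

Lemma similar_inj (R : comUnitRingType) p (g : 'M[R]_p) : g \in unitmx ->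
  injective (fun M => g *m M *m invmx g).
Proof.
move=> ug M M' /(congr1 (fun B => invmx g *m B *m g)) /=.
by rewrite !mulmxA mulVmx // !mul1mx !mulmxKV.
Qed.

Lemma char_poly_similar (R : comNzRingType) p (G M H : 'M[R]_p) :
  G *m H = 1%:M -> char_poly (G *m M *m H) = char_poly M.
Proof.
move=> GH; rewrite /char_poly /char_poly_mx.
have GHp : map_mx polyC G *m map_mx polyC H = 1%:M by rewrite -map_mxM GH map_mx1.
have -> : 'X%:M - map_mx polyC (G *m M *m H) =
    map_mx polyC G *m ('X%:M - map_mx polyC M) *m map_mx polyC H.
  have XC : map_mx polyC G *m 'X%:M *m map_mx polyC H = 'X%:M.
    by rewrite scalar_mxC -mulmxA GHp mulmx1.
  by rewrite !map_mxM mulmxBr mulmxBl XC.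
by rewrite !det_mulmx mulrAC -det_mulmx GHp det1 mul1r.
Qed.

Section Algebra.
Variables (k : closedFieldType) (n m : nat) (X : irr_nvariety k n m).
Notation gen := (generically X).
Notation K := (funfield X).
Notation A := (RMaps X).
Notation rho := (@rho k n m X).
Notation N := (n.+1 * n.+1)%N.

Section ConjK.
Variables (g : 'M[k]_n.+1) (ug : g \in unitmx).
Let uG : cst_mx X g \in unitmx. Proof. by rewrite unitmx_cst. Qed.

Lemma conj_KM M M' : @conj_K k n m X g (M *m M') = conj_K g M *m conj_K g M'.
Proof. exact: similarM. Qed.

Lemma conj_K_scalar z : @conj_K k n m X g z%:M = z%:M.
Proof. by rewrite /conj_K scalar_mxC -mulmxA mulmxV // mulmx1. Qed.

Lemma conj_K_inj : injective (@conj_K k n m X g).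
Proof.
exact: similar_inj.
Qed.

Lemma conj_K_inv M : M \in unitmx -> conj_K g (invmx M) = invmx (@conj_K k n m X g M).
Proof.
move=> uM; have E : conj_K g M *m conj_K g (invmx M) = 1%:M :> 'M[K]_n.+1.
  by rewrite -conj_KM mulmxV // conj_K_scalar.
have [uC _] := mulmx1_unit E; by rewrite -[RHS]mulmx1 -E mulKmx.
Qed.

Lemma char_poly_conj M : char_poly (@conj_K k n m X g M) = char_poly M.
Proof. by apply: char_poly_similar; rewrite mulmxV. Qed.

End ConjK.

Definition scalar_elt (u : A) (z : K) := rho u = z%:M.

Lemma scalar_elt_comm u z v : scalar_elt u z -> u * v = v * u.
Proof.
move=> uz; apply: rho_inj; rewrite !rmorphM /= uz.
by rewrite -[LHS]/(_ *m _) -[RHS]/(_ *m _) scalar_mxC.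
Qed.

Lemma scalar_elt_inv u z : scalar_elt u z -> invariant z.
Proof.
move=> uz g ug; have := rho_equiv u ug.
rewrite uz conj_K_scalar // (map_scalar_mx (sigma_rmorph X ug)).
by move=> /matrixP /(_ 0 0); rewrite !mxE eqxx !mulr1n.
Qed.

Lemma inv_scalar_elt z : invariant z -> exists u, scalar_elt u z.
Proof.
move=> iz; apply: equiv_rho => g ug.
by rewrite conj_K_scalar // (map_scalar_mx (sigma_rmorph X ug)) /= iz.
Qed.

(** Polynomials over the field of invariants can be evaluated inside RMaps. *)
Lemma rho_horner u (p : {poly K}) : (forall i, invariant p`_i) ->
  exists2 c : nat -> A, (forall i, scalar_elt (c i) p`_i) &
    horner_mx (rho u) p = rho (\sum_(i < size p) c i * u ^+ i).
Proof.
move=> ip; have /choice[c cP] i := inv_scalar_elt (ip i).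
exists c => //; rewrite -[p in LHS]coefK poly_def rmorph_sum rmorph_sum /=.
apply: eq_bigr => i _; rewrite -mul_polyC !rmorphM /= !rmorphXn /= horner_mx_C.
by rewrite horner_mx_X cP.
Qed.

(** The matrices rho u and sigma_g(rho u) are conjugate, so they have the same
    characteristic polynomial. *)
Lemma char_poly_inv u i : invariant (char_poly (rho u))`_i.
Proof.
move=> g ug; rewrite -[RHS](congr1 (fun p : {poly K} => p`_i) (char_poly_conj ug (rho u))).
rewrite -rho_equiv //= (_ : map_mx _ _ = map_mx (sigma_rmorph X ug) (rho u)) //.
by rewrite -map_char_poly coef_map.
Qed.

(** Write the characteristic polynomial of rho u as X^e q with q(0) != 0. By
    Cayley-Hamilton q(u) u^e = 0, where q(u) belongs to RMaps because q has
    invariant coefficients. Cancelling u gives q(u) = 0, and q(0) != 0 makes u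
    invertible. *)
Lemma regular_unit u : (forall v : A, v * u = 0 -> v = 0) -> rho u \in unitmx.
Proof.
move=> ru; set p := char_poly (rho u).
have p0 : p != 0 by rewrite monic_neq0 // char_poly_monic.
have [e [q q0 pE]] := multiplicity_XsubC p 0.
rewrite p0 /= in q0; rewrite subr0 in pE.
have qi i : invariant q`_i.
  have := char_poly_inv u (i + e); rewrite -/p pE coefMXn.
  by rewrite ltnNge leq_addl /= addnK.
have [c cP cE] := rho_horner u qi.
have : (\sum_(i < size q) c i * u ^+ i) * u ^+ e = 0.
  apply: rho_inj; rewrite rmorphM rmorphXn /= -cE rmorph0.
  have := Cayley_Hamilton (rho u); rewrite -/p pE rmorphM rmorphXn /=.
  by rewrite horner_mx_X.
have ru' v i : v * u ^+ i = 0 -> v = 0.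
  elim: i => [|i IH]; first by rewrite expr0 mulr1.
  by rewrite exprSr mulrA => /ru/IH.
move=> /ru' E; move: cE; rewrite E rmorph0.
rewrite -[q](subrK (q`_0)%:P) rmorphD /= horner_mx_C.
have [r ->] : exists r, q - (q`_0)%:P = r * 'X.
  have : root (q - (q`_0)%:P) 0 by rewrite rootE !hornerE horner_coef0 subrr.
  by move/factor_theorem => [r ->]; exists r; rewrite subr0.
rewrite rmorphM /= horner_mx_X => /eqP; rewrite addr_eq0 => /eqP rM.
have q00 : q`_0 != 0 by rewrite -horner_coef0 -rootE.
have : (- (q`_0)^-1 *: horner_mx (rho u) r) *m rho u = 1%:M.
  rewrite -scalemxAl -[_ *m _]/(_ * _) rM scaleNr scalerN opprK.
  by rewrite scale_scalar_mx mulVf.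
by case/mulmx1_unit.
Qed.

(** The inverse of an equivariant matrix is equivariant. *)
Lemma rho_unit u : rho u \in unitmx -> exists v, u * v = 1 /\ v * u = 1.
Proof.
move=> uu; have [v vE] : exists v, rho v = invmx (rho u).
  apply: equiv_rho => g ug; rewrite conj_K_inv // -rho_equiv //.
  exact: (map_invmx (sigma_rmorph X ug)).
by exists v; split; apply: rho_inj; rewrite rmorphM rmorph1 /= vE;
  [apply: mulmxV|apply: mulVmx].
Qed.

Lemma unit_rho u v : u * v = 1 -> rho u \in unitmx /\ rho v = invmx (rho u).
Proof.
move=> /(congr1 rho); rewrite rmorphM rmorph1 => E.
have [uu _] := mulmx1_unit E; split=> //.
by rewrite -[RHS]mulmx1 -[1%:M]E mulKmx.
Qed.

(** By Cayley-Hamilton an inverse is a polynomial in the element, with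
    invariant coefficients. *)
Lemma inverse_poly u v : u * v = 1 ->
  exists l (c : 'I_l -> A) (z : 'I_l -> K), (forall i, scalar_elt (c i) (z i)) /\
    v = \sum_i c i * u ^+ i.
Proof.
move=> uv; have [uu vE] := unit_rho uv; set p := char_poly (rho u).
have p00 : p`_0 != 0.
  by rewrite char_poly_det mulf_neq0 ?signr_eq0 // -unitfE -unitmxE.
have [r pE] : exists r, p = r * 'X + (p`_0)%:P.
  have : root (p - (p`_0)%:P) 0 by rewrite rootE !hornerE horner_coef0 subrr.
  by move/factor_theorem => [r E]; exists r; rewrite -['X]subr0 -E subrK.
have ri i : invariant (- (p`_0)^-1 *: r)`_i.
  move=> g ug; rewrite coefZ -[sigma g _]/(sigma_rmorph X ug _).
  rewrite rmorphM rmorphN fmorphV /= (char_poly_inv u 0 ug); congr (_ * _).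
  by have := char_poly_inv u i.+1 ug; rewrite -/p pE coefD coefMX coefC /= addr0.
have [c cP cE] := rho_horner u ri.
exists (size (- (p`_0)^-1 *: r)), (fun i => c i), (fun i => (- (p`_0)^-1 *: r)`_i).
split=> [i|]; first exact: cP.
apply: rho_inj; rewrite -cE vE.
have := Cayley_Hamilton (rho u); rewrite -/p [in X in horner_mx _ X]pE rmorphD rmorphM /=.
rewrite horner_mx_X horner_mx_C => /eqP; rewrite addr_eq0 => /eqP rM.
rewrite linearZ /= -[LHS](mul1mx); apply: (canLR (mulmxK uu)).
by rewrite -scalemxAl -[_ *m _]/(_ * _) rM scaleNr scalerN opprK
  scale_scalar_mx mulVf.
Qed.

(** Its rows are the matrices w_i written as vectors, so it is invertible
    exactly when the w_i form a basis of the matrix algebra. *)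
Definition coords (R : comNzRingType) (w : 'I_N -> 'M[R]_n.+1) : 'M[R]_N :=
  \matrix_i mxvec (w i).

Lemma coords_span (F : fieldType) (w : 'I_N -> 'M[F]_n.+1) : coords w \in unitmx ->
  forall B, B = \sum_i (mxvec B *m invmx (coords w)) 0 i *: w i.
Proof.
move=> uW B; apply: (can_inj mxvecK); rewrite linear_sum /=.
transitivity (mxvec B *m invmx (coords w) *m coords w); first by rewrite mulmxKV.
rewrite mulmx_sum_row; apply: eq_bigr => i _; rewrite linearZ /=.
by rewrite rowK.
Qed.

Lemma coords_free (F : fieldType) (w : 'I_N -> 'M[F]_n.+1) (c d : 'I_N -> F) :
  coords w \in unitmx ->
  \sum_i c i *: w i = \sum_i d i *: w i -> forall i, c i = d i.
Proof.
move=> uW E i; have E' : (\row_i c i) *m coords w = (\row_i d i) *m coords w.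
  rewrite !mulmx_sum_row; move/(congr1 mxvec): E; rewrite !linear_sum /=.
  move=> E; rewrite (eq_bigr (fun i => mxvec (c i *: w i))).
    rewrite E; apply: eq_bigr => j _; rewrite linearZ /= rowK mxE //.
  by move=> j _; rewrite linearZ /= rowK mxE.
have /rowP/(_ i) : \row_i c i = \row_i d i by apply: (can_inj (mulmxK uW)).
by rewrite !mxE.
Qed.

(** The coefficients are invariant: applying sigma_g to an expansion of rho u
    and conjugating back by g gives another expansion of rho u in the same
    basis. *)
Lemma rho_basis (w : 'I_N -> A) : coords (fun i => rho (w i)) \in unitmx ->
  forall u, exists (c : 'I_N -> A) (z : 'I_N -> K),
    [/\ forall i, scalar_elt (c i) (z i), u = \sum_i c i * w i
      & rho u = \sum_i z i *: rho (w i)].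
Proof.
move=> uW u; pose W := coords (fun i => rho (w i)).
pose z i := (mxvec (rho u) *m invmx W) 0 i.
have uE : rho u = \sum_i z i *: rho (w i) by exact: (coords_span uW (rho u)).
have zi i : invariant (z i).
  move=> g ug; apply: (coords_free (c := fun i => sigma g (z i)) uW) => {i}.
  apply: (conj_K_inj ug); rewrite -uE -rho_equiv // uE.
  transitivity (\sum_i sigma g (z i) *: conj_K g (rho (w i))).
    rewrite /conj_K mulmx_sumr mulmx_suml; apply: eq_bigr => i _.
    by rewrite -scalemxAr -scalemxAl.
  rewrite (raddf_sum (map_mx (sigma_rmorph X ug))); apply: eq_bigr => i _.
  by rewrite [RHS](map_mxZ (sigma_rmorph X ug)) /= rho_equiv.
have /choice[c cP] i := inv_scalar_elt (zi i).
exists c, z; split=> //; apply: rho_inj; rewrite rmorph_sum uE.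
by apply: eq_bigr => i _; rewrite rmorphM /= cP -mul_scalar_mx.
Qed.

End Algebra.

(** * Generic matrices and their evaluation at tuples of rational maps *)

Section Genring.
Variables (k : closedFieldType) (n l : nat).

Fact gen_var_in (h : 'I_l) : (generic_mx k n h : polymx k n l) \in @in_genring k n l.
Proof. by apply/asboolP; apply: Gen_var. Qed.

Definition gen_var h : genring k n l := GenRing (gen_var_in h).

(** Induction on the construction of an element from scalars and generic
    matrices. *)
Lemma genring_ind (T : genring k n l -> Prop) :
  (forall c, T (c%:A)) -> (forall h, T (gen_var h)) ->
  (forall p q, T p -> T q -> T (p + q)) -> (forall p q, T p -> T q -> T (p * q)) ->
  forall p, T p.
Proof.
move=> TC TV TD TM [q Hq]; have := Hq => /asboolP Gq.
elim: Gq Hq => [c|h|p1 q1 G1 IH1 G2 IH2|p1 q1 G1 IH1 G2 IH2] Hq.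
- suff -> : GenRing Hq = c%:A by apply: TC.
  apply: val_inj => /=; rewrite -[RHS]/(polymx_scale c 1) /polymx_scale.
  by rewrite scalemx1.
- have -> : GenRing Hq = gen_var h by apply: val_inj.
  exact: TV.
- have H1 : (p1 : polymx k n l) \in @in_genring k n l by apply/asboolP.
  have H2 : (q1 : polymx k n l) \in @in_genring k n l by apply/asboolP.
  have -> : GenRing Hq = GenRing H1 + GenRing H2 by apply: val_inj.
  by apply: TD; [apply: IH1|apply: IH2].
- have H1 : (p1 : polymx k n l) \in @in_genring k n l by apply/asboolP.
  have H2 : (q1 : polymx k n l) \in @in_genring k n l by apply/asboolP.
  have -> : GenRing Hq = GenRing H1 * GenRing H2 by apply: val_inj.
  by apply: TM; [apply: IH1|apply: IH2].
Qed.

Lemma generatedP (a : point k n l) B :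
  generated id a B -> exists p : genring k n l, eval_mx (genring_val p) a = B.
Proof.
elim=> [c|h|p q _ [p' <-] _ [q' <-]|p q _ [p' <-] _ [q' <-]].
- exists c%:A; rewrite -[genring_val _]/(polymx_scale c 1) /polymx_scale.
  by rewrite eval_mxZ mevalC eval_mx1 -[RHS]scalemx1.
- by exists (gen_var h); apply: eval_generic.
- by exists (p' + q'); apply: eval_mxD.
- by exists (p' * q'); apply: eval_mxM.
Qed.

Lemma eval_genring_generated (p : genring k n l) (a : point k n l) :
  generated id a (eval_mx (genring_val p) a).
Proof.
elim/genring_ind: p => [c|h|p q IHp IHq|p q IHp IHq].
- rewrite -[genring_val _]/(polymx_scale c 1) /polymx_scale.
  by rewrite eval_mxZ mevalC eval_mx1 [_ *: _]scalemx1; apply: Gen_scalar.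
- by rewrite eval_generic; apply: Gen_var.
- by rewrite eval_mxD; apply: Gen_add.
- by rewrite eval_mxM; apply: Gen_mul.
Qed.

Lemma generating_conj g (a : point k n l) : g \in unitmx ->
  generating a -> generating (conj_pt g a).
Proof.
move=> ug ga B; have [p pE] := generatedP (ga (conj_mx (invmx g) B)).
have := eval_genring_generated p (conj_pt g a).
rewrite eval_genring // pE /conj_mx invmxK !mulmxA mulmxV // mul1mx.
by rewrite -mulmxA mulmxV // mulmx1.
Qed.

Lemma generating_span (a : point k n l) (w : 'I_(n.+1 * n.+1) -> genring k n l) :
  coords (fun i => eval_mx (genring_val (w i)) a) \in unitmx -> generating a.
Proof.
move=> uW B; rewrite (coords_span uW B); elim/big_ind: _ => [||i _].
- by have := Gen_scalar (id : k -> k) a 0; rewrite raddf0.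
- exact: Gen_add.
- by rewrite -mul_scalar_mx; apply/Gen_mul/eval_genring_generated; apply: Gen_scalar.
Qed.

End Genring.

Section Tuples.
Variables (k : closedFieldType) (n m l : nat) (X : irr_nvariety k n m).
Notation gen := (generically X).
Notation K := (funfield X).
Notation A := (RMaps X).
Variable F : 'I_l -> A.

Definition tuple_coord (r : 'I_(nvars n l)) : K :=
  let: (h, i, j) := enum_val r in rho (F h) i j.

Lemma gen_tuple_coord :
  gen (fun a => forall r, ev (tuple_coord r) a = coord (tuple_val F a) r).
Proof.
have := gen_forall (fun h => ev_rho (F h)).
apply: generically_impl => a _ FE r; rewrite /tuple_coord /coord.
by case: (enum_val r) => [[h i] j]; rewrite ffunE -(FE h) /ev_mx [RHS]mxE.
Qed.

(** The value at the tuple F of a polynomial in the matrix entries. Its kernel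
    is the ideal of the closure of the image of F. *)
Definition eval_at : {rmorphism cpoly k n l -> K} := mmap (cst_K X) tuple_coord.

Lemma eval_atX r : eval_at 'X_r = tuple_coord r.
Proof. by rewrite /= mmapX mmap1U. Qed.

Lemma eval_atC c : eval_at c%:MP = cst_K X c.
Proof. exact: mmapC. Qed.

Lemma ev_eval_at P : gen (fun a => ev (eval_at P) a = P.@[coord (tuple_val F a)]).
Proof.
apply: (generically_and _ (ev_mmap tuple_coord P) gen_tuple_coord) => a _ -> E.
exact: meval_eq.
Qed.

Lemma eval_at_eq0 P : eval_at P = 0 <-> gen (fun a => P.@[coord (tuple_val F a)] = 0).
Proof.
rewrite eqK; split=> P0; apply: (generically_and3 _ P0 (ev0 X) (ev_eval_at P)).
  by move=> a _ <- -> ->.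
by move=> a _ -> -> ->.
Qed.

Lemma gen_all_at (S : cpoly k n l -> Prop) : (forall P, S P -> eval_at P = 0) ->
  gen (fun a => forall P, S P -> P.@[coord (tuple_val F a)] = 0).
Proof.
move=> S0; apply: (generically_and _ (gen_all S0) gen_tuple_coord) => a _ Sa E P SP.
by rewrite -(meval_eq _ E) Sa.
Qed.

Lemma eval_at_neq0 P : eval_at P != 0 ->
  gen (fun a => P.@[coord (tuple_val F a)] != 0).
Proof.
move=> P0; apply: (generically_and _ (ev_neq0 P0) (ev_eval_at P)) => a _ + E.
by rewrite E.
Qed.

Definition eval_at_mx (p : polymx k n l) : 'M[K]_n.+1 := map_mx eval_at p.

Lemma eval_at_mxD p q : eval_at_mx (p + q) = eval_at_mx p + eval_at_mx q.
Proof. exact: map_mxD. Qed.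

Lemma eval_at_mxM p q : eval_at_mx (p * q) = eval_at_mx p * eval_at_mx q.
Proof. exact: map_mxM. Qed.

Lemma eval_at_var h : eval_at_mx (generic_mx k n h) = rho (F h).
Proof.
apply/matrixP => i j; rewrite [LHS]mxE [generic_mx _ _ _ _ _]mxE eval_atX.
by rewrite /tuple_coord enum_rankK.
Qed.

Lemma eval_at_mxA c : eval_at_mx (genring_val (c%:A : genring k n l)) = (cst_K X c)%:M.
Proof.
rewrite -[genring_val _]/(polymx_scale c 1) /polymx_scale /eval_at_mx map_mxZ.
by rewrite eval_atC map_mx1 -[RHS]scalemx1.
Qed.

Lemma rhoA c : rho (c%:A : A) = (cst_K X c)%:M.
Proof. by rewrite rhoZ rmorph1 -scalemx1. Qed.

Lemma eval_tuple_ex (p : genring k n l) : exists u, rho u = eval_at_mx (genring_val p).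
Proof.
elim/genring_ind: p => [c|h|p q [u uE] [v vE]|p q [u uE] [v vE]].
- by exists c%:A; rewrite rhoA eval_at_mxA.
- by exists (F h); rewrite eval_at_var.
- by exists (u + v); rewrite rmorphD /= uE vE -eval_at_mxD.
- by exists (u * v); rewrite rmorphM /= uE vE -eval_at_mxM.
Qed.

(** The element p(F) of RMaps. *)
Definition eval_tuple (p : genring k n l) : A := projT1 (cid (eval_tuple_ex p)).

Lemma rho_eval_tuple p : rho (eval_tuple p) = eval_at_mx (genring_val p).
Proof. by rewrite /eval_tuple; case: cid. Qed.

(** Algebra homomorphisms out of the generic matrix ring are evaluations. *)
Lemma rho_genring_hom (phi : genring k n l -> A) :
  (forall c, phi c%:A = c%:A) -> (forall h, phi (gen_var k n h) = F h) ->
  {morph phi : p q / p + q} -> {morph phi : p q / p * q} ->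
  forall p, rho (phi p) = eval_at_mx (genring_val p).
Proof.
move=> phiC phiV phiD phiM; elim/genring_ind => [c|h|p q IHp IHq|p q IHp IHq].
- by rewrite phiC rhoA eval_at_mxA.
- by rewrite phiV eval_at_var.
- by rewrite phiD rmorphD /= IHp IHq -eval_at_mxD.
- by rewrite phiM rmorphM /= IHp IHq -eval_at_mxM.
Qed.

Lemma ev_eval_at_mx (p : polymx k n l) :
  gen (fun a => ev_mx (eval_at_mx p) a = eval_mx p (tuple_val F a)).
Proof.
apply: gen_mx => i j; apply: (generically_impl _ (ev_eval_at (p i j))) => a _ E.
by rewrite !mxE.
Qed.

Lemma eval_at_mx_eq0 p : eval_at_mx p = 0 <-> forall i j, eval_at (p i j) = 0.
Proof.
split=> [/matrixP p0 i j|p0]; first by have := p0 i j; rewrite !mxE.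
by apply/matrixP => i j; rewrite !mxE p0.
Qed.

End Tuples.

Section Tautological.
Variables (k : closedFieldType) (n m : nat) (X : irr_nvariety k n m).
Notation gen := (generically X).
Notation K := (funfield X).

(** The coordinate map X_h. *)
Definition taut h : RMaps X := rmap_of_genring X (gen_var k n h).

Lemma gen_taut_val : gen (fun a => tuple_val taut a = a).
Proof.
have := gen_forall (fun h => rmap_val_quo (RmapRep (in_rmaps_eval X (gen_var k n h)))).
apply: generically_impl => a _ tE; apply/ffunP => h; rewrite ffunE tE /=.
exact: eval_generic.
Qed.

Lemma eval_at_taut P : eval_at taut P = mmap (cst_K X) (coord_K X) P.
Proof.
apply/eqK; apply: (generically_and4 _ (ev_mmap (coord_K X) P) (gen_coord X)
  (ev_eval_at taut P) gen_taut_val).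
by move=> a _ -> E -> ->; rewrite (meval_eq _ E).
Qed.

Lemma eval_taut_eq0 P : eval_at taut P = 0 <-> forall a, X a -> P.@[coord a] = 0.
Proof. by rewrite eval_at_taut mmap_coord_eq0. Qed.

Lemma rho_rmap_of_genring p : rho (rmap_of_genring X p) = eval_at_mx taut (genring_val p).
Proof.
apply/eq_ev_mx; apply: (generically_and3 _ (ev_rho_quo (RmapRep (in_rmaps_eval X p)))
  (ev_eval_at_mx taut (genring_val p)) gen_taut_val).
by move=> a _ -> -> ->.
Qed.

(** At a point a of X the generic matrices generate the whole matrix algebra,
    so some elements of the generic matrix ring take the matrix units as
    values at a. The determinant of their coordinates does not vanish at a,
    hence is nonzero at the generic point. *)
Lemma taut_basis : exists w : 'I_(n.+1 * n.+1) -> genring k n m,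
  coords (fun i => rho (rmap_of_genring X (w i))) \in unitmx.
Proof.
have [[a Xa] _] := nvar_irr X.
have /choice[w wE] i : exists p : genring k n m,
    eval_mx (genring_val p) a = vec_mx (delta_mx 0 i).
  by apply: generatedP; apply: (nvar_gen Xa).
exists w; pose W := coords (fun i => (genring_val (w i) : 'M_n.+1)).
have -> : coords (fun i => rho (rmap_of_genring X (w i))) = map_mx (eval_at taut) W.
  by apply/row_matrixP => i; rewrite -map_row !rowK rho_rmap_of_genring map_mxvec.
rewrite unitmxE unitfE det_map_mx; apply/eqP => /eval_taut_eq0 /(_ a Xa) /eqP.
rewrite -det_map_mx (_ : map_mx _ W = 1%:M) ?det1 ?oner_eq0 //.
apply/row_matrixP => i; rewrite -map_row rowK map_mxvec -[map_mx _ _]/(eval_mx _ _) wE.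
by rewrite vec_mxK row1.
Qed.

End Tautological.

(** * Dominant rational maps and the induced homomorphisms *)

Section Dominant.
Variables (k : closedFieldType) (n m l : nat).
Variables (X : irr_nvariety k n m) (Y : irr_nvariety k n l) (F : 'I_l -> RMaps X).
Notation gen := (generically X).

(** The closure of the image of F contains Y and the values of F satisfy the
    equations of Y. *)
Definition same_vanishing :=
  forall P, eval_at F P = 0 <-> (forall b, Y b -> P.@[coord b] = 0).

Hypothesis FY : same_vanishing.

Lemma same_vanishing_dominant : dominant Y F.
Proof.
move=> Z [S ZS] gZ b Yb; apply/ZS => P SP; have /FY : eval_at F P = 0; last exact.
by apply/eval_at_eq0; apply: generically_impl gZ => a _ /ZS; apply.
Qed.

Lemma same_vanishing_into :
  gen (fun a => generating (tuple_val F a)) -> maps_into Y F.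
Proof.
move=> gF; have [Z [S ZS] YZ] := nvar_closed Y.
have gS : gen (fun a => forall P, S P -> P.@[coord (tuple_val F a)] = 0).
  apply: gen_all_at => P SP; apply/FY => b /YZ [Zb _].
  by apply: (ZS b).1.
apply: (generically_and _ gF gS) => a _ ga Sa.
by apply/YZ; split=> //; apply/ZS.
Qed.

(** A nonempty open subset of Y is given by some D != 0, and D(F) is nonzero
    because F is dominant. *)
Lemma gen_pullback (Q : point k n l -> Prop) : maps_into Y F ->
  generically Y Q -> gen (fun a => Q (tuple_val F a)).
Proof.
move=> YF [D [b Yb Db] DQ].
have D0 : eval_at F D != 0.
  by apply/eqP => /FY /(_ b Yb) D0; rewrite D0 eqxx in Db.
by apply: (generically_and _ YF (eval_at_neq0 D0)) => a _; apply: DQ.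
Qed.

End Dominant.

Section EvalTuple.
Variables (k : closedFieldType) (n m l : nat) (X : irr_nvariety k n m).
Notation A := (RMaps X).
Variable F : 'I_l -> A.
Notation J := (eval_tuple F).

Lemma eval_tupleD p q : J (p + q) = J p + J q.
Proof. by apply: rho_inj; rewrite rmorphD /= !rho_eval_tuple -eval_at_mxD. Qed.

Lemma eval_tupleM p q : J (p * q) = J p * J q.
Proof. by apply: rho_inj; rewrite rmorphM /= !rho_eval_tuple -eval_at_mxM. Qed.

Lemma eval_tupleA c : J c%:A = c%:A.
Proof. by apply: rho_inj; rewrite rho_eval_tuple eval_at_mxA rhoA. Qed.

Lemma eval_tuple1 : J 1 = 1.
Proof. by have := eval_tupleA 1; rewrite !scale1r. Qed.

Lemma eval_tuple_var h : J (gen_var k n h) = F h.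
Proof. by apply: rho_inj; rewrite rho_eval_tuple eval_at_var. Qed.

Lemma eval_tupleB p q : J (p - q) = J p - J q.
Proof.
rewrite eval_tupleD; congr (_ + _); apply: (addrI (J q)).
rewrite -eval_tupleD !subrr -(scale0r (1 : genring k n l)) eval_tupleA.
by rewrite scale0r.
Qed.

Section KnEval.
Variables (Y : irr_nvariety k n l) (FY : same_vanishing Y F).

(** The entries of p are polynomials, and they vanish on Y if and only if they
    vanish at F. *)
Lemma eval_tuple0 p : J p = 0 <-> vanishing Y p.
Proof.
transitivity (eval_at_mx F (genring_val p) = 0).
  rewrite -rho_eval_tuple; split=> [->|]; first by rewrite rmorph0.
  by rewrite -(rmorph0 (@rho k n m X)) => /rho_inj.
rewrite eval_at_mx_eq0; split=> p0.
  by move=> b Yb; apply/matrixP => i j; rewrite !mxE; apply: ((FY _).1 (p0 i j)).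
move=> i j; apply/FY => b /p0 /matrixP /(_ i j).
by rewrite !mxE.
Qed.

Lemma eval_tuple_eq p q : J p = J q <-> vanishing Y (p - q).
Proof.
rewrite -eval_tuple0 eval_tupleB; split=> [->|/eqP]; first by rewrite subrr.
by rewrite subr_eq0 => /eqP.
Qed.

Notation R := (kn_poly Y).
Notation quo := (to_quot (vanishing_biideal Y)).

(** The homomorphism p |-> p(F) out of k_n[Y]. *)
Definition kn_eval (u : R) : A := J (repr u).

Lemma kn_evalE p : kn_eval (quo p) = J p.
Proof. by apply/eval_tuple_eq; apply: (repr_to_quot (vanishing_biideal Y) p). Qed.

Fact kn_eval_additive : additive kn_eval.
Proof.
move=> u v; rewrite -[u]repr_quotK -[v]repr_quotK !kn_evalE -eval_tupleB.
rewrite -kn_evalE; congr kn_eval; apply: (addIr (quo (repr v))).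
by rewrite subrK -to_quotD subrK.
Qed.

Fact kn_eval_monoid : monoid_morphism kn_eval.
Proof.
split=> [|u v]; first by rewrite -[1 in LHS]/(quo 1) kn_evalE eval_tuple1.
rewrite -[u]repr_quotK -[v]repr_quotK [_ * _ in LHS]quot_mulE !kn_evalE.
exact: eval_tupleM.
Qed.

Fact kn_eval_scalable : scalable kn_eval.
Proof.
move=> c u; rewrite -[u]repr_quotK [_ *: _ in LHS]quot_scaleE !kn_evalE.
by rewrite -[_ *: _ in LHS]mulr_algl eval_tupleM eval_tupleA mulr_algl.
Qed.

Definition kn_eval_hom : {lrmorphism R -> A} := HB.pack kn_eval
  (GRing.isAdditive.Build R A kn_eval kn_eval_additive)
  (GRing.isMonoidMorphism.Build R A kn_eval kn_eval_monoid)
  (GRing.isScalable.Build k R A *:%R kn_eval kn_eval_scalable).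

Lemma kn_eval0 : kn_eval 0 = 0.
Proof. exact: (rmorph0 kn_eval_hom). Qed.

Lemma kn_evalM u v : kn_eval (u * v) = kn_eval u * kn_eval v.
Proof. exact: (rmorphM kn_eval_hom). Qed.

Lemma kn_eval_inj : injective kn_eval.
Proof.
move=> u v; rewrite -[u]repr_quotK -[v]repr_quotK !kn_evalE => /eval_tuple_eq.
by move=> uv; apply/to_quotP.
Qed.

End KnEval.
End EvalTuple.

Section TupleConj.
Variables (k : closedFieldType) (n m l : nat) (X : irr_nvariety k n m).
Variable F : 'I_l -> RMaps X.
Notation gen := (generically X).

Lemma gen_tuple_conj g : g \in unitmx ->
  gen (fun a => tuple_val F (conj_pt g a) = conj_pt g (tuple_val F a)).
Proof.
move=> ug; have := gen_forall (fun h => (rmap_val_rmaps (F h)).2 g ug).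
by apply: generically_impl => a _ E; apply/ffunP => h; rewrite !ffunE E.
Qed.

(** As F is equivariant, the ideal of its image is stable under conjugation.
    *)
Lemma eval_at_conj g P : g \in unitmx -> eval_at F P = 0 ->
  eval_at F (conj_poly g P) = 0.
Proof.
move=> ug /eval_at_eq0 /(gen_translate ug) P0; apply/eval_at_eq0.
apply: (generically_and _ P0 (gen_tuple_conj ug)) => a _ + E.
by rewrite E conj_polyE.
Qed.

End TupleConj.

(** * The n-variety swept out by a tuple of equivariant maps *)

Section Image.
Variables (k : closedFieldType) (n m l : nat) (X : irr_nvariety k n m).
Notation gen := (generically X).
Notation A := (RMaps X).
Variable F : 'I_l -> A.
Hypothesis gF : gen (fun a => generating (tuple_val F a)).

Definition image_closure (b : point k n l) :=
  (forall P, eval_at F P = 0 -> P.@[coord b] = 0) /\ generating b.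

Definition image_nvariety : nvariety k n l.
Proof.
exists image_closure => [b []//|g b ug [b0 gb]|].
  split=> [P P0|]; last exact: generating_conj.
  by rewrite -conj_polyE; apply/b0/eval_at_conj.
exists (fun b => forall P, eval_at F P = 0 -> P.@[coord b] = 0) => //.
by exists (fun P => eval_at F P = 0).
Defined.

(** The ideal of F has infinitely many elements; [gen_all_at] imposes them on
    one open set. *)
Lemma gen_image : gen (fun a => image_nvariety (tuple_val F a)).
Proof.
have gS := @gen_all_at _ _ _ _ _ F (fun P => eval_at F P = 0) (fun P P0 => P0).
by apply: (generically_and _ gS gF) => a _ Sa ga; split.
Qed.

Lemma image_vanishing P :
  eval_at F P = 0 <-> (forall b, image_nvariety b -> P.@[coord b] = 0).
Proof.
split=> [P0 b [b0 _]|P0]; first exact: b0.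
by apply/eval_at_eq0; apply: (generically_impl _ gen_image) => a _; apply: P0.
Qed.

(** If neither of two closed sets contains the image of F, take P_1 and P_2
    nonzero at F among their equations; then P_1 P_2 is nonzero at F although
    it vanishes on the union. *)
Lemma image_irreducible : irreducible image_nvariety.
Proof.
split; first by have [a _ Ia] := generically_ex gen_image; exists (tuple_val F a).
move=> Z1 Z2 [S1 Z1S] [S2 Z2S] Z12.
have [S10|/existsNP[P1 /not_implyP[S1P1 /eqP P10]]] :=
    pselect (forall P, S1 P -> eval_at F P = 0).
  by left=> b Ib; apply/Z1S => P /S10 /image_vanishing; apply.
have [S20|/existsNP[P2 /not_implyP[S2P2 /eqP P20]]] :=
    pselect (forall P, S2 P -> eval_at F P = 0).
  by right=> b Ib; apply/Z2S => P /S20 /image_vanishing; apply.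
have : eval_at F (P1 * P2) = 0.
  apply/image_vanishing => b /Z12[/Z1S/(_ _ S1P1)|/Z2S/(_ _ S2P2)] E;
    by rewrite mevalM E ?mul0r ?mulr0.
by rewrite rmorphM => /eqP; rewrite mulf_eq0 (negPf P10) (negPf P20).
Qed.

Definition image_variety : irr_nvariety k n l := IrrNVariety image_irreducible.

Lemma image_same_vanishing : same_vanishing image_variety F.
Proof. exact: image_vanishing. Qed.

Notation J := (eval_tuple F).

(** Fractions with a scalar denominator in the subalgebra generated by F. Such
    a denominator is central and invertible, which makes these fractions easy
    to add and multiply. *)
Definition scalar_fraction (u : A) := exists p s z,
  [/\ scalar_elt (J s) z, z != 0 & u * J s = J p].

Lemma scalar_eltD (u v : A) z y :
  scalar_elt u z -> scalar_elt v y -> scalar_elt (u + v) (z + y).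
Proof. by rewrite /scalar_elt rmorphD /= => -> ->; rewrite -raddfD. Qed.

Lemma scalar_eltM (u v : A) z y :
  scalar_elt u z -> scalar_elt v y -> scalar_elt (u * v) (z * y).
Proof.
by rewrite /scalar_elt rmorphM /= => -> ->; rewrite -[LHS]/(_ *m _) -scalar_mxM.
Qed.

Lemma scalar_fractionD u v :
  scalar_fraction u -> scalar_fraction v -> scalar_fraction (u + v).
Proof.
move=> [p [s [z [sz z0 us]]]] [q [t [y [ty y0 vt]]]].
exists (p * t + q * s), (s * t), (z * y); split.
- by rewrite eval_tupleM; apply: scalar_eltM.
- exact: mulf_neq0.
- rewrite eval_tupleD !eval_tupleM mulrDl mulrA us; congr (_ + _).
  by rewrite (scalar_elt_comm _ sz) mulrA vt.
Qed.

Lemma scalar_fractionM u v :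
  scalar_fraction u -> scalar_fraction v -> scalar_fraction (u * v).
Proof.
move=> [p [s [z [sz z0 us]]]] [q [t [y [ty y0 vt]]]].
exists (p * q), (t * s), (y * z); split.
- by rewrite eval_tupleM; apply: scalar_eltM.
- exact: mulf_neq0.
- rewrite !eval_tupleM -mulrA (mulrA v) vt -us -mulrA; congr (_ * _).
  exact: (esym (scalar_elt_comm _ sz)).
Qed.

Lemma scalar_fraction_eval p : scalar_fraction (J p).
Proof.
by exists p, 1, 1; rewrite oner_eq0 /scalar_elt eval_tuple1 rmorph1 mulr1.
Qed.

Hypothesis frac : forall u, scalar_fraction u.

Notation R := (kn_poly image_variety).
Notation quo := (to_quot (vanishing_biideal image_variety)).
Notation kn_eval := (kn_eval (Y := image_variety) F).
Let kE := kn_evalE image_same_vanishing.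
Let kI := kn_eval_inj image_same_vanishing.
Let kM := kn_evalM image_same_vanishing.
Let k0 := kn_eval0 image_same_vanishing.

(** If v s = 0 and v t is in k_n[Y] with t scalar, then v t s = 0 in k_n[Y],
    so that v t = 0 and v = 0; now [regular_unit] applies. *)
Lemma kn_eval_regular s : regular_elt s -> exists t, is_inverse (kn_eval s) t.
Proof.
move=> [_ rs]; suff us : rho (kn_eval s) \in unitmx.
  by have [t [st ts]] := rho_unit us; exists t.
apply: regular_unit => v vs0; have [p [t [z [tz z0 vt]]]] := frac v.
have p0 : quo p = 0.
  apply: rs; rewrite mul0r; apply: kI.
  rewrite k0 kM kE -vt.
  by rewrite -mulrA (scalar_elt_comm _ tz) mulrA vs0 mul0r.
have : v * J t = 0 by rewrite vt -kE p0 k0.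
have [t' [tt' _]] : exists t', J t * t' = 1 /\ t' * J t = 1.
  by apply: rho_unit; rewrite tz unitmxE det_scalar unitfE expf_neq0.
by move=> /(congr1 ( *%R^~ t')); rewrite -mulrA tt' mulr1 mul0r.
Qed.

Lemma kn_eval_fraction u : is_fraction kn_eval u.
Proof.
have [p [s [z [sz z0 us]]]] := frac u.
have [t [st ts]] : exists t, J s * t = 1 /\ t * J s = 1.
  by apply: rho_unit; rewrite sz unitmxE det_scalar unitfE expf_neq0.
exists (quo p), (quo s), t; rewrite /is_inverse !kE; split=> //; last first.
  by rewrite -us -mulrA st mulr1.
split=> x y.
  move/(congr1 kn_eval); rewrite !kM !kE.
  by move/(congr1 ( *%R t)); rewrite !mulrA ts !mul1r => /kI.
move/(congr1 kn_eval); rewrite !kM !kE.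
by move/(congr1 ( *%R^~ t)); rewrite -!mulrA st !mulr1 => /kI.
Qed.

Lemma image_kn_frac : isomorphic_to_kn_frac image_variety A.
Proof.
exists A, (kn_eval_hom image_same_vanishing); split.
  split; [exact: kI|exact: kn_eval_regular|exact: kn_eval_fraction].
by exists idfun; exists idfun.
Qed.

End Image.

(** * Generators of the algebra of equivariant maps *)

Section Existence.
Variables (k : closedFieldType) (n m : nat) (X : irr_nvariety k n m).
Notation gen := (generically X).
Notation A := (RMaps X).
Notation K := (funfield X).

(** The field of invariants is a subfield of the function field, which is
    finitely generated. *)
Lemma invariants_fg : exists r (c : 'I_r -> K),
  (forall i, invariant (c i)) /\ forall z, invariant z -> ratio_of (cst_K X) c z.
Proof.
apply: (subfield_fg (x := coord_K X)); first exact: funfield_gen.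
- by move=> c g ug; apply: sigma_cst.
- move=> z w iz iw g ug; rewrite -[sigma g _]/(sigma_rmorph X ug _) rmorphB /=.
  by rewrite iz ?iw.
- by move=> z w iz iw g ug; rewrite sigmaM ?iz ?iw.
Qed.

Section Extend.
Variables (r : nat) (c : 'I_r -> K) (e : 'I_r -> A).
Hypothesis ec : forall i, scalar_elt (e i) (c i).
Hypothesis cgen : forall z, invariant z -> ratio_of (cst_K X) c z.

(** In the application the e_i are scalars that generate the field of
    invariants. *)
Definition extended (h : 'I_(m + r)) : A :=
  match fintype.split h with inl h => taut X h | inr i => e i end.

Lemma extendedl h : extended (lshift r h) = taut X h.
Proof.
rewrite /extended; case: split_ordP => j; first by move/lshift_inj ->.
by move/eqP; rewrite eq_lrshift.
Qed.

Lemma extendedr i : extended (rshift m i) = e i.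
Proof.
rewrite /extended; case: split_ordP => j; last by move/rshift_inj ->.
by move/eqP; rewrite eq_rlshift.
Qed.

Notation J := (eval_tuple extended).

Definition restrict_pt (b : point k n (m + r)) : point k n m := [ffun h => b (lshift r h)].

Lemma gen_restrict : gen (fun a => restrict_pt (tuple_val extended a) = a).
Proof.
apply: (generically_impl _ (gen_taut_val X)) => a _ {2}<-.
by apply/ffunP => h; rewrite !ffunE extendedl.
Qed.

(** The first m components already generate the matrix algebra. *)
Lemma gen_extended : gen (fun a => generating (tuple_val extended a)).
Proof.
apply: (generically_impl _ gen_restrict) => a Xa E B.
have := nvar_gen Xa B; rewrite -{1}E.
elim=> [d|h|p q _ IHp _ IHq|p q _ IHp _ IHq].
- exact: Gen_scalar.
- by rewrite ffunE; apply: Gen_var.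
- exact: Gen_add.
- exact: Gen_mul.
Qed.

Notation Y := (image_variety gen_extended).

Lemma extended_taut p : exists q, J q = rmap_of_genring X p.
Proof.
elim/genring_ind: p => [d|h|p q [p' pE] [q' qE]|p q [p' pE] [q' qE]].
- by exists d%:A; apply: rho_inj; rewrite rho_rmap_of_genring rho_eval_tuple !eval_at_mxA.
- exists (gen_var k n (lshift r h)); rewrite eval_tuple_var extendedl.
  by [].
- exists (p' + q'); apply: rho_inj; rewrite eval_tupleD pE qE rmorphD /=.
  by rewrite !rho_rmap_of_genring -eval_at_mxD.
- exists (p' * q'); apply: rho_inj; rewrite eval_tupleM pE qE rmorphM /=.
  by rewrite !rho_rmap_of_genring -eval_at_mxM.
Qed.

(** Polynomials in the c_i are the scalar values of elements of the generic
    matrix ring at the extended tuple. *)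
Lemma extended_poly P : exists p, scalar_elt (J p) (mmap (cst_K X) c P).
Proof.
elim/mpoly_ring_ind: P => [d|i|P Q [p pE] [q qE]|P Q [p pE] [q qE]].
- by exists d%:A; rewrite /scalar_elt rho_eval_tuple eval_at_mxA mmapC.
- exists (gen_var k n (rshift m i)); rewrite eval_tuple_var extendedr mmapX mmap1U.
  exact: ec.
- by exists (p + q); rewrite eval_tupleD rmorphD; apply: scalar_eltD.
- by exists (p * q); rewrite eval_tupleM rmorphM; apply: scalar_eltM.
Qed.

(** An element of RMaps is a combination of elements of the generic matrix
    ring with invariant coefficients, and invariants are ratios of polynomials
    in the c_i. *)
Lemma extended_fraction u : scalar_fraction extended u.
Proof.
have [w uW] := taut_basis X; have [d [z [dz -> _]]] := rho_basis uW u.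
apply: big_ind => [||i _].
- by rewrite -(scale0r 1) -(eval_tupleA extended); apply: scalar_fraction_eval.
- exact: scalar_fractionD.
apply: scalar_fractionM; last first.
  by have [q <-] := extended_taut (w i); apply: scalar_fraction_eval.
have [P [Q [Q0 zQ]]] := cgen (scalar_elt_inv (dz i)).
have [p pE] := extended_poly P; have [q qE] := extended_poly Q.
exists p, q, (mmap (cst_K X) c Q); split=> //; apply: rho_inj.
by rewrite pE -zQ; apply: scalar_eltM.
Qed.

Lemma extended_kn_frac : isomorphic_to_kn_frac Y A.
Proof. exact/image_kn_frac/extended_fraction. Qed.

End Extend.
End Existence.

(** * The projection is a birational inverse *)

Section Birational.
Variables (k : closedFieldType) (n m : nat) (X : irr_nvariety k n m).
Notation gen := (generically X).
Notation A := (RMaps X).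
Notation K := (funfield X).
Variables (r : nat) (c : 'I_r -> K) (e : 'I_r -> A).
Hypothesis ec : forall i, scalar_elt (e i) (c i).
Notation F := (extended e).
Notation Y := (image_variety (gen_extended e)).

Let YF : same_vanishing Y F := image_same_vanishing (gen_extended e).
Let FY : maps_into Y F := gen_image (gen_extended e).

(** The composite of P with the projection to the first m matrices. *)
Definition restrict_poly (P : cpoly k n m) : cpoly k n (m + r) :=
  P \mPo [tuple (let: (h, i, j) := enum_val s in
    'X_(enum_rank (lshift r h, i, j))) | s < nvars n m].

Lemma restrict_polyE P b : (restrict_poly P).@[coord b] = P.@[coord (restrict_pt b)].
Proof.
rewrite comp_mpoly_meval; apply: meval_eq => s; rewrite tnth_mktuple /coord.
by case: (enum_val s) => [[h i] j]; rewrite mevalXU ffunE /coord enum_rankK.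
Qed.

Lemma eval_restrict P : eval_at F (restrict_poly P) = eval_at (taut X) P.
Proof.
apply/eqK; apply: (generically_and4 _ (ev_eval_at F (restrict_poly P)) (gen_restrict e)
  (ev_eval_at (taut X) P) (gen_taut_val X)).
by move=> a _ -> E -> ->; rewrite restrict_polyE E.
Qed.

Lemma eval_extra i s t :
  eval_at F 'X_(enum_rank (rshift m i, s, t)) = c i *+ (s == t).
Proof.
by rewrite eval_atX /tuple_coord enum_rankK extendedr ec mxE.
Qed.

(** That the components e_i are scalar is a system of polynomial equations, so
    it holds on the whole of Y. *)
Lemma extra_scalar b i : Y b -> b (rshift m i) = (b (rshift m i) 0 0)%:M.
Proof.
move=> Yb; apply/matrixP => s t; rewrite [RHS]mxE.
pose P : cpoly k n (m + r) := 'X_(enum_rank (rshift m i, s, t)) -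
  'X_(enum_rank (rshift m i, 0, 0)) *+ (s == t).
have : P.@[coord b] = 0.
  apply: (YF P).1 => //; rewrite rmorphB rmorphMn /= -/(eval_at F) !eval_extra.
  by rewrite eqxx mulr1n subrr.
rewrite mevalB mevalMn !mevalXU /coord !enum_rankK => /eqP.
by rewrite subr_eq0 => /eqP.
Qed.

(** The remaining components of b are scalar, so the first m generate the
    matrix algebra whenever b does. *)
Lemma restrict_in b : Y b -> X (restrict_pt b).
Proof.
move=> Yb; have [Z [S ZS] XZ] := nvar_closed X; apply/XZ; split.
  apply/ZS => P SP; rewrite -restrict_polyE; apply: (YF _).1 => //.
  rewrite eval_restrict; apply/eval_taut_eq0 => a /XZ[Za _].
  by apply: (ZS a).1.
have := nvar_gen Yb; move=> gb B.
elim: (gb B) => [d|h|p q _ IHp _ IHq|p q _ IHp _ IHq].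
- exact: Gen_scalar.
- case: (split_ordP h) => j ->.
    by have := Gen_var id (restrict_pt b) j; rewrite ffunE.
  by rewrite extra_scalar //; apply: (Gen_scalar id).
- exact: Gen_add.
- exact: Gen_mul.
Qed.

Definition projection (h : 'I_m) : RMaps Y := taut Y (lshift r h).

Lemma gen_projection : generically Y (fun b => tuple_val projection b = restrict_pt b).
Proof.
apply: (generically_impl _ (gen_taut_val Y)) => b _ E.
by apply/ffunP => h; rewrite !ffunE -[in RHS]E ffunE.
Qed.

Lemma projection_same_vanishing : same_vanishing X projection.
Proof.
move=> P; rewrite -eval_taut_eq0 -eval_restrict.
apply: (iff_trans (B := eval_at (taut Y) (restrict_poly P) = 0)); last first.
  by rewrite eval_taut_eq0 YF.
rewrite !eval_at_eq0; split=> P0.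
  apply: (generically_and3 _ P0 gen_projection (gen_taut_val Y)) => b _ + E1 E2.
  by rewrite E1 E2 restrict_polyE.
apply: (generically_and3 _ P0 gen_projection (gen_taut_val Y)) => b _ + E1 E2.
by rewrite E1 E2 restrict_polyE.
Qed.

Lemma projection_into : maps_into X projection.
Proof.
apply: (generically_impl _ gen_projection) => b Yb ->.
exact: restrict_in.
Qed.

Lemma projectionK : gen (fun a => tuple_val projection (tuple_val F a) = a).
Proof.
apply: (generically_and _ (gen_pullback YF FY gen_projection) (gen_restrict e)).
by move=> a _ -> ->.
Qed.

(** If c_i = P/Q, then Q e_i = P holds on X generically, and the corresponding
    polynomial equation holds at every point of Y. *)
Lemma extra_value i : exists P Q : cpoly k n m,
  gen (fun a => Q.@[coord a] != 0 /\ Q.@[coord a] *: rmap_val (e i) a = P.@[coord a]%:M) /\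
  forall b, Y b -> Q.@[coord (restrict_pt b)] *: b (rshift m i) = P.@[coord (restrict_pt b)]%:M.
Proof.
have [P [Q [Q0 cQ]]] := funfield_gen (c i); exists P, Q.
rewrite -!eval_at_taut in Q0 cQ; split.
  apply: (generically_and4 _ (gen_and (eval_at_neq0 Q0) (gen_taut_val X)) (ev_rho (e i))
    (gen_and (ev_eval_at (taut X) P) (ev_eval_at (taut X) Q))
    (gen_and (evM (c i) (eval_at (taut X) Q)) (ev_mx_scalar n.+1 (c i)))).
  move=> a _ /= [+ E] <- [PE QE] [cE sE]; rewrite E => Qa; split=> //.
  rewrite ec sE scale_scalar_mx; congr _%:M.
  by move: cE; rewrite cQ PE QE E mulrC.
move=> b Yb; apply/matrixP => s t; rewrite !mxE.
pose D : cpoly k n (m + r) := restrict_poly Q * 'X_(enum_rank (rshift m i, s, t)) -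
  restrict_poly P *+ (s == t).
have : D.@[coord b] = 0.
  apply: (YF D).1 => //; rewrite rmorphB rmorphM rmorphMn /= -/(eval_at F).
  rewrite eval_extra !eval_restrict -cQ.
  by case: (s == t); rewrite ?mulr1n ?mulr0n ?mulr0 ?subr0 // mulrC subrr.
rewrite mevalB mevalMn mevalM !restrict_polyE mevalXU /coord enum_rankK => /eqP.
by rewrite subr_eq0 => /eqP.
Qed.

Lemma extendedK : generically Y (fun b => tuple_val F (tuple_val projection b) = b).
Proof.
have pull := gen_pullback projection_same_vanishing projection_into.
have gfst := pull _ (gen_restrict e).
have /choice[P /choice[Q PQ]] := extra_value.
have gsnd := pull _ (gen_forall (fun i => (PQ i).1)).
apply: (generically_and3 _ gfst gsnd gen_projection) => b Yb.
set x := tuple_val projection b => E1 E2 xE.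
apply/ffunP => h; case: (split_ordP h) => j ->.
  by move/ffunP/(_ j): E1; rewrite ffunE => ->; rewrite xE ffunE.
have [Qx Qe] := E2 j; rewrite ffunE extendedr.
apply: (scalerI Qx); rewrite Qe xE; symmetry; exact: (PQ j).2.
Qed.

Lemma extended_birational : PGL_birational X Y.
Proof.
exists F, projection; split; first by split=> //; exact: projection_into.
  by split; apply: same_vanishing_dominant => //; exact: projection_same_vanishing.
by split; [exact: projectionK|exact: extendedK].
Qed.

End Birational.

(** * Extension of homomorphisms to rings of fractions *)

Section PrimeMatrix.
Variables (F : fieldType) (p : nat).
Implicit Types M N : 'M[F]_p.

Lemma mul_delta_mulE M N a b i j : (M *m delta_mx a b *m N) i j = M i a * N b j.
Proof.
rewrite -(mul_delta_mx (0 : 'I_1)) mulmxA -mulmxA -colE -rowE !mxE.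
by rewrite big_ord1 !mxE.
Qed.

Lemma prime_mx M N : (forall B, M *m B *m N = 0) -> M = 0 \/ N = 0.
Proof.
move=> MN; have [->|N0] := eqVneq N 0; first by right.
have /matrix0Pn[b [j Nbj]] := N0; left; apply/matrixP => i a; apply/eqP.
have := MN (delta_mx a b) => /matrixP/(_ i j)/eqP; rewrite mul_delta_mulE !mxE.
by rewrite mulf_eq0 (negPf Nbj) orbF.
Qed.

(** Comparing the entries for B = E_(a,b) gives M_(i,a) N_(b,j) = N_(i,a)
    M_(b,j). *)
Lemma proportional_mx M N : N != 0 ->
  (forall B, M *m B *m N = N *m B *m M) -> exists c, M = c *: N.
Proof.
move=> /matrix0Pn[b [j Nbj]] MN; exists (M b j / N b j); apply/matrixP => i a.
rewrite mxE; have /matrixP/(_ i j) := MN (delta_mx a b); rewrite !mul_delta_mulE => E.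
by apply: (mulIf Nbj); rewrite E; field.
Qed.

End PrimeMatrix.

Section Extension.
Variables (R A : nzRingType) (K : fieldType) (n : nat).
Notation M := 'M[K]_n.+1.
Variables (h : {rmorphism R -> A}) (i : {rmorphism R -> M}).
Hypotheses (h_inj : injective h) (i_inj : injective i).
Variable w : 'I_(n.+1 * n.+1) -> R.
Hypothesis iw : coords (fun j => i (w j)) \in unitmx.

Lemma spanning_prime (M1 M2 : M) :
  (forall r, M1 * i r * M2 = 0) -> M1 = 0 \/ M2 = 0.
Proof.
move=> H; apply: prime_mx => B; rewrite (coords_span iw B) mulmx_sumr mulmx_suml.
apply: big1 => j _; have Hj : M1 *m i (w j) *m M2 = 0 := H (w j).
by rewrite -scalemxAr -scalemxAl Hj scaler0.
Qed.

Lemma spanning_proportional (M1 M2 : M) : M2 != 0 ->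
  (forall r, M1 * i r * M2 = M2 * i r * M1) -> exists c, M1 = c *: M2.
Proof.
move=> M20 H; apply: proportional_mx => // B.
rewrite (coords_span iw B) !mulmx_sumr !mulmx_suml.
apply: eq_bigr => j _.
have Hj : M1 *m i (w j) *m M2 = M2 *m i (w j) *m M1 := H (w j).
by rewrite -!scalemxAr -!scalemxAl Hj.
Qed.

Definition central_elt (c : A) := forall a, c * a = a * c.

Hypothesis central_span : forall a, exists d (c : 'I_d -> A) (r : 'I_d -> R),
  (forall j, central_elt (c j)) /\ a = \sum_j c j * h (r j).
Hypothesis central_fraction : forall c, central_elt c ->
  exists p s : R, s != 0 /\ c * h s = h p.

(** The relation that f corresponds to N: both multiply some nonzero left
    ideal R t into R, with the same effect. Thus the extension of i to A is
    defined without denominators, and nothing has to be known about regular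
    elements of R. *)
Definition transported (f : A) (N : M) := exists t : R, t != 0 /\
  forall r : R, exists p : R, f * h (r * t) = h p /\ N * i (r * t) = i p.

(** R is prime, as it spans a full matrix algebra. *)
Lemma nonzero_product (t1 t2 : R) : t1 != 0 -> t2 != 0 -> exists r, t1 * r * t2 != 0.
Proof.
move=> t10 t20; apply: contrapT => nr.
have [||] := @spanning_prime (i t1) (i t2).
- move=> r; rewrite -!rmorphM -(rmorph0 i); congr (i _); apply: contrapT => E.
  by apply: nr; exists r; apply/eqP.
- by rewrite -(rmorph0 i) => /i_inj E; rewrite E eqxx in t10.
- by rewrite -(rmorph0 i) => /i_inj E; rewrite E eqxx in t20.
Qed.

(** On the product of the two left ideals N1 and N2 agree, and the matrix
    algebra is prime. *)
Lemma transported_fun f N1 N2 : transported f N1 -> transported f N2 -> N1 = N2.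
Proof.
move=> [t1 [t10 T1]] [t2 [t20 T2]]; have [r0 t0] := nonzero_product t10 t20.
have [||E] := @spanning_prime (N1 - N2) (i (t1 * r0 * t2)).
- move=> r; have [p1 [fp1 Np1]] := T1 r; have [p2 [fp2 Np2]] := T2 (r * t1 * r0).
  have E : p2 = p1 * (r0 * t2).
    by apply: h_inj; rewrite -fp2 [RHS]rmorphM -fp1 -[RHS]mulrA -[h _ * h _]rmorphM !mulrA.
  rewrite -mulrA -rmorphM mulrBl; apply/eqP; rewrite subr_eq0; apply/eqP.
  have -> : r * (t1 * r0 * t2) = r * t1 * r0 * t2 by rewrite !mulrA.
  by rewrite Np2 E -(mulrA (r * t1)) (rmorphM i (r * t1)) [LHS]mulrA Np1 -rmorphM.
- by move/eqP; rewrite subr_eq0 => /eqP.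
- by move: E; rewrite -(rmorph0 i) => /i_inj E; rewrite E eqxx in t0.
Qed.

Lemma transportedD f1 f2 N1 N2 :
  transported f1 N1 -> transported f2 N2 -> transported (f1 + f2) (N1 + N2).
Proof.
move=> [t1 [t10 T1]] [t2 [t20 T2]]; have [r0 t0] := nonzero_product t10 t20.
exists (t1 * r0 * t2); split=> // r.
have [p1 [fp1 Np1]] := T1 r; have [p2 [fp2 Np2]] := T2 (r * t1 * r0).
exists (p1 * (r0 * t2) + p2).
have E : r * (t1 * r0 * t2) = r * t1 * (r0 * t2) by rewrite !mulrA.
have E2 : r * (t1 * r0 * t2) = r * t1 * r0 * t2 by rewrite !mulrA.
split; rewrite rmorphD mulrDl; congr (_ + _).
- by rewrite E (rmorphM h (r * t1)) [LHS]mulrA fp1 -rmorphM.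
- by rewrite E2.
- by rewrite E (rmorphM i (r * t1)) [LHS]mulrA Np1 -rmorphM.
- by rewrite E2.
Qed.

Lemma transportedM f1 f2 N1 N2 :
  transported f1 N1 -> transported f2 N2 -> transported (f1 * f2) (N1 * N2).
Proof.
move=> [t1 [t10 T1]] [t2 [t20 T2]]; have [r0 t0] := nonzero_product t20 t10.
exists (t2 * r0 * t1); split=> // r.
have [p2 [fp2 Np2]] := T2 r; have [p1 [fp1 Np1]] := T1 (p2 * r0).
exists p1; have -> : r * (t2 * r0 * t1) = r * t2 * (r0 * t1) by rewrite !mulrA.
split.
  by rewrite (rmorphM h (r * t2)) -[LHS]mulrA (mulrA f2) fp2 -rmorphM mulrA fp1.
by rewrite (rmorphM i (r * t2)) -[LHS]mulrA (mulrA N2) Np2 -rmorphM mulrA Np1.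
Qed.

Lemma transported_h r : transported (h r) (i r).
Proof.
exists 1; split=> [|x]; first exact: oner_neq0.
by exists (r * x); rewrite mulr1 !rmorphM.
Qed.

(** If c = p/s is central, then p r s = s r p for all r. In the matrix algebra
    this forces i(p) to be a scalar multiple of i(s), and the scalar is the
    value of c. *)
Lemma transported_central c : central_elt c -> exists z, transported c z%:M.
Proof.
move=> cc; have [p [s [s0 cs]]] := central_fraction cc.
have is0 : i s != 0 by apply: contra s0; rewrite -(rmorph0 i) => /eqP/i_inj ->.
have ps r : p * r * s = s * r * p.
  by apply: h_inj; rewrite !rmorphM -cs -(mulrA c) cc -(mulrA _ c) mulrA.
have [r|z zE] := spanning_proportional (M1 := i p) is0.
  by rewrite -!rmorphM ps.
exists z, s; split=> // r; exists (r * p); split.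
  by rewrite !rmorphM mulrA cc -mulrA cs.
by rewrite !rmorphM zE -[LHS]/(_ *m _) mul_scalar_mx scalerAr.
Qed.

Lemma transported_total f : exists N, transported f N.
Proof.
have [d [c [r [cc ->]]]] := central_span f.
apply: (big_ind (fun f => exists N, transported f N)).
- by exists (i 0); rewrite -(rmorph0 h); apply: transported_h.
- by move=> f1 f2 [N1 T1] [N2 T2]; exists (N1 + N2); apply: transportedD.
- move=> j _; have [z Tz] := transported_central (cc j).
  by exists (z%:M * i (r j)); apply: transportedM => //; apply: transported_h.
Qed.

(** The transport relation is functional, additive and multiplicative. It is
    defined at the elements of R and at central elements, and these generate
    A. *)
Lemma extend_to_fractions :
  exists psi : {rmorphism A -> M}, forall r, psi (h r) = i r.
Proof.
have [psi psiP] := choice transported_total.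
have psi_h r : psi (h r) = i r by apply: transported_fun (psiP _) (transported_h r).
have psiD f g : psi (f + g) = psi f + psi g.
  exact: transported_fun (psiP _) (transportedD (psiP f) (psiP g)).
have psiM f g : psi (f * g) = psi f * psi g.
  exact: transported_fun (psiP _) (transportedM (psiP f) (psiP g)).
have psi1 : psi 1 = 1 by rewrite -(rmorph1 h) psi_h rmorph1.
have psi0 : psi 0 = 0 by rewrite -(rmorph0 h) psi_h rmorph0.
have psi_add : additive psi.
  move=> f g; rewrite psiD; congr (_ + _).
  by apply: (addrI (psi g)); rewrite -psiD !subrr.
pose Psi : {rmorphism A -> M} := HB.pack psi
  (GRing.isAdditive.Build A M psi psi_add)
  (GRing.isMonoidMorphism.Build A M psi (conj psi1 psiM)).
by exists Psi.
Qed.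

End Extension.

(** * Realization on an n-variety with the same ring of fractions *)

Section Transport.
Variables (k : comNzRingType) (R A Q : algType k) (j : {lrmorphism R -> Q}).

Lemma fractions_iso : total_ring_of_fractions j -> alg_isomorphic A Q ->
  exists h : {lrmorphism R -> A}, total_ring_of_fractions h.
Proof.
move=> [j_inj j_inv j_frac] [phi [g phiK gK]].
pose g0 : Q -> A := g.
have gD : additive g0.
  exact: can2_zmod_morphism phiK gK.
have gM : monoid_morphism g0.
  exact: can2_monoid_morphism phiK gK.
have gZ : scalable g0.
  exact: can2_scalable phiK gK.
pose G : {lrmorphism Q -> A} := HB.pack g0 (GRing.isAdditive.Build Q A g0 gD)
  (GRing.isMonoidMorphism.Build Q A g0 gM) (GRing.isScalable.Build k Q A *:%R g0 gZ).
exists (G \o j); split.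
- exact: inj_comp (can_inj gK) j_inj.
- move=> s /j_inv[t [st ts]]; exists (G t); split.
    by rewrite /= -[LHS](rmorphM G) st rmorph1.
  by rewrite /= -[LHS](rmorphM G) ts rmorph1.
- move=> a; have [p [s [t [rs [st ts] aE]]]] := j_frac (phi a).
  exists p, s, (G t); split=> //.
    split; first by rewrite /= -[LHS](rmorphM G) st rmorph1.
    by rewrite /= -[LHS](rmorphM G) ts rmorph1.
  by rewrite /= -[RHS](rmorphM G) -aE /= /g0 phiK.
Qed.

End Transport.

Section Model.
Variables (k : closedFieldType) (n m l : nat).
Variables (X : irr_nvariety k n m) (Y : irr_nvariety k n l).
Notation A := (RMaps X).
Notation R := (kn_poly Y).
Notation quo := (to_quot (vanishing_biideal Y)).

Lemma taut_same_vanishing : same_vanishing Y (taut Y).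
Proof. by move=> P; apply: eval_taut_eq0. Qed.

Let j := kn_eval_hom taut_same_vanishing.

Lemma rmap_of_kn_polyP r : rmap_of_kn_poly r = kn_eval (Y := Y) (taut Y) r.
Proof. by apply: rho_inj; rewrite rho_rmap_of_genring rho_eval_tuple. Qed.

Variable h : {lrmorphism R -> A}.
Hypothesis hfrac : total_ring_of_fractions h.

(** In a fraction p s^-1 the inverse of s is a polynomial in s with invariant
    coefficients. *)
Lemma fraction_span (a : A) : exists d (c : 'I_d -> A) (z : 'I_d -> funfield X) (r : 'I_d -> R),
  (forall i, scalar_elt (c i) (z i)) /\ a = \sum_i c i * h (r i).
Proof.
have [_ _ /(_ a)[p [s [t [_ [st ts] ->]]]]] := hfrac.
have [d [c [z [cz ->]]]] := inverse_poly st.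
exists d, c, z, (fun i : 'I_d => p * s ^+ i); split=> //.
rewrite mulr_sumr; apply: eq_bigr => i _.
by rewrite mulrA -(scalar_elt_comm _ (cz i)) -mulrA rmorphM rmorphXn.
Qed.

(** The evaluation of k_n[Y] at the generic point of Y extends to RMaps X by
    [extend_to_fractions]. Its values are equivariant, being fractions p s^-1
    of values of elements of k_n[Y]. *)
Lemma fraction_model : exists psi : {rmorphism A -> RMaps Y},
  (forall r, psi (h r) = rmap_of_kn_poly r) /\ forall a, in_kn_frac (psi a).
Proof.
have [h_inj h_inv h_frac] := hfrac.
pose i : {rmorphism R -> 'M[funfield Y]_n.+1} := @rho k n l Y \o j.
have i_inj : injective i := inj_comp (@rho_inj k n l Y) (kn_eval_inj taut_same_vanishing).
have [w wU] := taut_basis Y.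
have iw : coords (fun s => i (quo (w s))) \in unitmx.
  have <- : (fun s => rho (rmap_of_genring Y (w s))) = (fun s => i (quo (w s))).
    by apply/funext => s; rewrite -rmap_of_kn_polyE rmap_of_kn_polyP.
  exact: wU.
have cspan a : exists d (c : 'I_d -> A) (r : 'I_d -> R),
    (forall s, central_elt (c s)) /\ a = \sum_s c s * h (r s).
  have [d [c [z [r [cz aE]]]]] := fraction_span a; exists d, c, r; split=> // s b.
  exact: scalar_elt_comm (cz s).
have cfrac c : central_elt c -> exists p s : R, s != 0 /\ c * h s = h p.
  have [p [s [t [[ls _] [st ts] ->]]]] := h_frac c; exists p, s.
  split; last by rewrite -mulrA ts mulr1.
  apply/eqP => s0; have := ls 0 1; rewrite s0 !mul0r => /(_ erefl)/eqP.
  by rewrite eq_sym oner_eq0.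
have [Psi PsiE] := extend_to_fractions h_inj i_inj iw cspan cfrac.
have Psi_val a : exists u : RMaps Y, rho u = Psi a /\ in_kn_frac u.
  have [p [s [t [rs [st ts] ->]]]] := h_frac a.
  have [|t' [st' ts']] := @rho_unit k n l Y (j s).
    have iPsi : i s *m Psi t = 1%:M.
      by rewrite -PsiE; rewrite -[LHS](rmorphM Psi) st rmorph1.
    exact: (mulmx1_unit iPsi).1.
  exists (j p * t'); split; last first.
    by exists p, s, t'; rewrite /is_inverse !rmap_of_kn_polyP.
  rewrite !rmorphM /= PsiE; congr (_ * _).
  have /(congr1 (@rho k n l Y)) := ts'; rewrite rmorphM rmorph1 => E.
  transitivity (rho t' * (i s * Psi t)); last by rewrite mulrA E mul1r.
  by rewrite -PsiE -rmorphM st rmorph1 mulr1.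
have [psi psiP] := choice Psi_val.
have psiE a : rho (psi a) = Psi a by case: (psiP a).
have psiD : additive psi.
  by move=> a b; apply: rho_inj; rewrite psiE (rmorphB Psi) -!psiE -rmorphB.
have psiM : monoid_morphism psi.
  split=> [|a b]; apply: rho_inj; first by rewrite psiE !rmorph1.
  by rewrite rmorphM /= !psiE rmorphM.
pose psi' : {rmorphism A -> RMaps Y} := HB.pack psi
  (GRing.isAdditive.Build A (RMaps Y) psi psiD)
  (GRing.isMonoidMorphism.Build A (RMaps Y) psi psiM).
exists psi'; split=> [r|a]; last by case: (psiP a).
by apply: rho_inj; rewrite psiE PsiE rmap_of_kn_polyP.
Qed.

End Model.

(** * Points with the same structure constants are conjugate *)

Lemma linear_extension (F : fieldType) n (w w' : 'I_(n.+1 * n.+1) -> 'M[F]_n.+1) :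
  coords w \in unitmx ->
  exists T : {linear 'M[F]_n.+1 -> 'M[F]_n.+1}, forall i, T (w i) = w' i.
Proof.
move=> uW; pose T B := \sum_i (mxvec B *m invmx (coords w)) 0 i *: w' i.
have T_linear : linear T.
  move=> c B C; rewrite /T linearP mulmxDl -scalemxAl scaler_sumr -big_split.
  by apply: eq_bigr => i _; rewrite !mxE scalerDl scalerA.
pose T' : {linear 'M[F]_n.+1 -> 'M[F]_n.+1} := HB.pack T
  (GRing.isLinear.Build F 'M[F]_n.+1 'M[F]_n.+1 *:%R T T_linear).
exists T' => i; rewrite /= /T.
have -> : mxvec (w i) = row i (coords w) by rewrite rowK.
rewrite -row_mul mulmxV // (bigD1 i) //= big1 ?addr0 => [|j ji].
  by rewrite !mxE eqxx scale1r.
by rewrite !mxE eq_sym (negPf ji) scale0r.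
Qed.

Section Conjugate.
Variables (k : closedFieldType) (n l : nat).
Notation N := (n.+1 * n.+1)%N.
Variable w : 'I_N -> genring k n l.

Notation at_pt p a := (eval_mx (genring_val p) a).

(** The products X_h w_i in terms of the w_j, at the point a. *)
Definition structure_constants (y : 'I_l * 'I_N * 'I_N -> k) (a : point k n l) :=
  forall h i, a h *m at_pt (w i) a = \sum_j y (h, i, j) *: at_pt (w j) a.

Variables (a b : point k n l) (y : 'I_l * 'I_N * 'I_N -> k).
Hypotheses (wa : coords (fun i => at_pt (w i) a) \in unitmx)
  (wb : coords (fun i => at_pt (w i) b) \in unitmx)
  (ya : structure_constants y a) (yb : structure_constants y b).

(** The linear map T that takes w_i(a) to w_i(b) satisfies T(p(a) B) = p(b)
    T(B), that is, it is an isomorphism of left modules. Restricting T to the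
    t-th column of its argument and the s-th column of its value gives
    matrices G with G p(a) = p(b) G, some of them nonzero; by Schur's lemma a
    nonzero one is invertible. *)
Lemma same_constants_conjugate : exists2 g, g \in unitmx & b = conj_pt g a.
Proof.
(* the linear map taking w_i(a) to w_i(b) intertwines the left
   multiplications by p(a) and p(b) *)
have [T T_basis] := linear_extension (fun i => at_pt (w i) b) wa.
have T_mul (p : genring k n l) B : T (at_pt p a *m B) = at_pt p b *m T B.
  elim/genring_ind: p B => [c|h|p q IHp IHq|p q IHp IHq] B.
  - rewrite -[genring_val _]/(polymx_scale c 1) /polymx_scale !eval_mxZ !mevalC.
    by rewrite !eval_mx1 -!scalemxAl !mul1mx linearZ.
  - rewrite !eval_generic (coords_span wa B) mulmx_sumr !linear_sum /=.
    apply: eq_bigr => i _; rewrite -scalemxAr !linearZ /= T_basis.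
    congr (_ *: _); rewrite ya yb linear_sum; apply: eq_bigr => j _.
    by rewrite linearZ /= T_basis.
  - by rewrite !eval_mxD !mulmxDl linearD /= IHp IHq.
  - by rewrite !eval_mxM -!mulmxA IHp IHq.
pose G s t := \matrix_(i, j) T (delta_mx j t) i s.
have Gmul s t p : G s t *m at_pt p a = at_pt p b *m G s t.
  move: (at_pt p a) (at_pt p b) (T_mul p) => A B TAB.
  apply/matrixP => i j; rewrite !mxE.
  transitivity ((B *m T (delta_mx j t)) i s); last first.
    by rewrite mxE; apply: eq_bigr => u _; rewrite [in RHS]mxE.
  have -> : B *m T (delta_mx j t) = \sum_u A u j *: T (delta_mx u t).
    rewrite -TAB; have -> : A *m delta_mx j t = \sum_u A u j *: delta_mx u t.
      apply/matrixP => u v; rewrite -(mulmx1 (A *m _)) mul_delta_mulE summxE.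
      rewrite (bigD1 u) //= big1 => [|u' uu']; rewrite !mxE.
        by rewrite eqxx addr0 eq_sym.
      by rewrite eq_sym (negPf uu') mulr0.
    by rewrite linear_sum; apply: eq_bigr => u _; rewrite linearZ.
  by rewrite summxE; apply: eq_bigr => u _; rewrite !mxE mulrC.
have [s [t G0]] : exists s t, G s t != 0.
  apply: contrapT => nG; have T0 B : T B = 0.
    rewrite [B]matrix_sum_delta !linear_sum /= big1 // => u _.
    rewrite linear_sum big1 // => v _; rewrite linearZ /= (_ : T _ = 0) ?scaler0 //.
    apply/matrixP => i s; rewrite [RHS]mxE.
    have : G s v == 0 by apply: contrapT => /negP Gsv; apply: nG; exists s, v.
    by move/eqP/matrixP/(_ i u); rewrite !mxE.
  have := wb; rewrite (_ : coords _ = 0) ?unitmxE ?det0 ?unitr0 //.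
  by apply/row_matrixP => i; rewrite rowK -T_basis T0 linear0 row0.
have ug : G s t \in unitmx.
  (* the kernel of an intertwiner is stable under all matrices *)
  rewrite -row_full_unit -cokermx_eq0; apply: contraT => /matrix0Pn[u [v C0]].
  case/negP: G0; apply/eqP/matrixP => i j; rewrite [RHS]mxE.
  have [p pE] := generatedP (generating_span wa (delta_mx j u)).
  have : G s t *m at_pt p a *m cokermx (G s t) = 0 by rewrite Gmul -mulmxA mulmx_coker mulmx0.
  rewrite pE => /matrixP/(_ i v)/eqP; rewrite mul_delta_mulE [X in _ == X]mxE.
  rewrite mulf_eq0 (negPf C0) orbF.
  by move/eqP.
exists (G s t) => //; apply/ffunP => h; rewrite ffunE /conj_mx.
have := Gmul s t (gen_var k n h); rewrite !eval_generic => ->.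
by rewrite mulmxK.
Qed.

End Conjugate.

(** * Transfer of generic properties *)

Section Transfer.
Variables (k : closedFieldType) (n m1 m2 : nat).
Variables (X1 : irr_nvariety k n m1) (X2 : irr_nvariety k n m2) (r : nat).
Variables (z1 : 'I_r -> funfield X1) (z2 : 'I_r -> funfield X2).
Hypothesis z12 : forall q : {mpoly k[r]},
  mmap (cst_K X1) z1 q = 0 <-> mmap (cst_K X2) z2 q = 0.

Notation at1 A := (fun a => A (fun i => ev (z1 i) a)).
Notation at2 A := (fun a => A (fun i => ev (z2 i) a)).

(** Induction on the set. For the zero set of q, the value of q is zero in one
    function field if and only if it is zero in the other, and a nonzero value
    is generically nonzero. *)
Lemma constructible_transfer (A : ('I_r -> k) -> Prop) : constructible A ->
  (generically X1 (at1 A) /\ generically X2 (at2 A)) \/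
  (generically X1 (at1 (fun z => ~ A z)) /\ generically X2 (at2 (fun z => ~ A z))).
Proof.
elim=> [q|B _ [[B1 B2]|[B1 B2]]|B C _ [[B1 B2]|[B1 B2]] _ [[C1 C2]|[C1 C2]]].
- have [q0|q0] := eqVneq (mmap (cst_K X1) z1 q) 0.
    by left; split; apply/mmap_eq0 => //; apply/z12.
  right; split.
    by apply: generically_impl (mmap_neq0 q0) => a _ /eqP.
  have : mmap (cst_K X2) z2 q != 0 by apply: contra q0 => /eqP/z12 ->.
  by move/mmap_neq0; apply: generically_impl => a _ /eqP.
- by right; split; [apply: generically_impl B1|apply: generically_impl B2] => a _ Ba; apply.
- by left.
- by left; split; [exact: gen_and B1 C1|exact: gen_and B2 C2].
- by right; split; [apply: generically_impl C1|apply: generically_impl C2] => a _ nC [].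
- by right; split; [apply: generically_impl B1|apply: generically_impl B2] => a _ nB [].
- by right; split; [apply: generically_impl B1|apply: generically_impl B2] => a _ nB [].
Qed.

Lemma generic_transfer (A : ('I_r -> k) -> Prop) : constructible A ->
  generically X1 (at1 A) -> generically X2 (at2 A).
Proof.
move=> /constructible_transfer[[]//|[nA _]] gA.
by have [a _ []] := generically_ex (gen_and nA gA).
Qed.

End Transfer.

Section GenericConstants.
Variables (k : closedFieldType) (n m l : nat) (X : irr_nvariety k n m).
Notation gen := (generically X).
Notation N := (n.+1 * n.+1)%N.
Variables (F : 'I_l -> RMaps X) (w : 'I_N -> genring k n l).
Variable z : 'I_l * 'I_N * 'I_N -> funfield X.
Notation at_F p := (eval_at_mx F (genring_val p)).
Hypothesis wF : coords (fun i => at_F (w i)) \in unitmx.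
Hypothesis zF : forall h i, rho (F h) *m at_F (w i) = \sum_j z (h, i, j) *: at_F (w j).

Lemma ev_mx_sum p q (I : Type) (s : seq I) (M : I -> 'M[funfield X]_(p, q)) :
  gen (fun a => ev_mx (\sum_(i <- s) M i) a = \sum_(i <- s) ev_mx (M i) a).
Proof.
apply: gen_mx => i j.
apply: (generically_impl _ (ev_sum s (fun t => M t i j))) => a _ E.
by rewrite [LHS]mxE !summxE E; apply: eq_bigr => t _; rewrite mxE.
Qed.

Lemma gen_basis :
  gen (fun a => coords (fun i => eval_mx (genring_val (w i)) (tuple_val F a)) \in unitmx).
Proof.
apply: (generically_and _ (ev_mx_unit wF)
  (gen_forall (fun i => ev_eval_at_mx F (genring_val (w i))))).
move=> a _ [uW _] E.
suff -> : coords (fun i => eval_mx (genring_val (w i)) (tuple_val F a)) =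
    ev_mx (coords (fun i => at_F (w i))) a by [].
by apply/row_matrixP => i; rewrite -map_row !rowK map_mxvec -E.
Qed.

Lemma gen_constants :
  gen (fun a => structure_constants w (fun t => ev (z t) a) (tuple_val F a)).
Proof.
apply: gen_forall => h; apply: gen_forall => i.
have E := zF h i; have := ev_mxM (rho (F h)) (at_F (w i)); rewrite E => gM.
apply: (generically_and4 _ (gen_and gM (ev_rho (F h)))
  (ev_mx_sum (index_enum _) (fun j => z (h, i, j) *: at_F (w j)))
  (gen_forall (fun j => ev_mxZ (z (h, i, j)) (at_F (w j))))
  (gen_forall (fun j => ev_eval_at_mx F (genring_val (w j))))).
move=> a _ /= [gMa hE] sE ZE wE; rewrite ffunE -hE -wE -gMa sE.
by apply: eq_bigr => j _; rewrite ZE wE.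
Qed.

End GenericConstants.

Section VanishingTransfer.
Variables (k : closedFieldType) (n l m1 m2 : nat).
Variables (X1 : irr_nvariety k n m1) (X2 : irr_nvariety k n m2).
Notation N := (n.+1 * n.+1)%N.
Notation I := ('I_l * 'I_N * 'I_N)%type.
Variables (F1 : 'I_l -> RMaps X1) (F2 : 'I_l -> RMaps X2) (w : 'I_N -> genring k n l).
Variables (z1 : I -> funfield X1) (z2 : I -> funfield X2).
Hypothesis wF1 : coords (fun i => eval_at_mx F1 (genring_val (w i))) \in unitmx.
Hypothesis wF2 : coords (fun i => eval_at_mx F2 (genring_val (w i))) \in unitmx.
Hypothesis zF1 : forall h i, rho (F1 h) *m eval_at_mx F1 (genring_val (w i)) =
  \sum_j z1 (h, i, j) *: eval_at_mx F1 (genring_val (w j)).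
Hypothesis zF2 : forall h i, rho (F2 h) *m eval_at_mx F2 (genring_val (w i)) =
  \sum_j z2 (h, i, j) *: eval_at_mx F2 (genring_val (w j)).
Hypothesis z12 : forall q : {mpoly k[#|{: I}|]},
  mmap (cst_K X1) (fun i => z1 (enum_val i)) q = 0 <->
  mmap (cst_K X2) (fun i => z2 (enum_val i)) q = 0.

Notation poly := {mpoly k[#|{: I}| + nvars n l]}.

(** Polynomials in the structure constants z and the point b; this one depends
    only on b. *)
Definition lift_b (P : cpoly k n l) : poly :=
  P \mPo [tuple 'X_(rshift #|{: I}| s) | s < nvars n l].

Definition var_z (t : I) : poly := 'X_(lshift (nvars n l) (enum_rank t)).

Lemma lift_bE P z (b : point k n l) : (lift_b P).@[join_env z (coord b)] = P.@[coord b].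
Proof.
rewrite comp_mpoly_meval; apply: meval_eq => s; rewrite tnth_mktuple mevalXU /join_env.
by case: split_ordP => j; [move/eqP; rewrite eq_rlshift|move/rshift_inj ->].
Qed.

Lemma var_zE t z (b : point k n l) : (var_z t).@[join_env z (coord b)] = z (enum_rank t).
Proof.
rewrite mevalXU /join_env.
by case: split_ordP => j; [move/lshift_inj ->|move/eqP; rewrite eq_lrshift].
Qed.

Definition constants_eq (u : 'I_l * 'I_N * 'I_n.+1 * 'I_n.+1) : poly :=
  let: (h, i, s, t) := u in
  lift_b ((generic_mx k n h *m genring_val (w i)) s t) -
  \sum_j var_z (h, i, j) * lift_b (genring_val (w j) s t).

Lemma constants_eqP z (b : point k n l) :
  (forall e, e \in codom constants_eq -> e.@[join_env z (coord b)] = 0) <->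
  structure_constants w (fun t => z (enum_rank t)) b.
Proof.
have eqE h i s t : (constants_eq (h, i, s, t)).@[join_env z (coord b)] =
    (b h *m eval_mx (genring_val (w i)) b) s t -
    (\sum_j z (enum_rank (h, i, j)) *: eval_mx (genring_val (w j)) b) s t.
  rewrite /constants_eq mevalB lift_bE; congr (_ - _).
    rewrite -[in RHS]eval_generic -[_ *m eval_mx _ _](eval_mxM (generic_mx k n h)).
    by rewrite [RHS]mxE.
  rewrite raddf_sum summxE; apply: eq_bigr => j _ /=.
  by rewrite mevalM var_zE lift_bE !mxE.
split=> [H h i|H e /codomP[[[[h i] s] t] ->]]; last by rewrite eqE H subrr.
apply/matrixP => s t; apply/eqP; rewrite -subr_eq0 -eqE; apply/eqP/H.
exact: codom_f.
Qed.

Definition point_of (c : 'I_(nvars n l) -> k) : point k n l :=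
  [ffun h => \matrix_(i, j) c (enum_rank (h, i, j))].

Lemma coord_point_of c : coord (point_of c) = c.
Proof.
apply/funext => r; rewrite /coord -{2}(enum_valK r).
by case: (enum_val r) => [[h i] j]; rewrite ffunE mxE.
Qed.

Definition basis_det : cpoly k n l := \det (coords (fun i => (genring_val (w i) : 'M_n.+1))).

Lemma basis_detE b : basis_det.@[coord b] =
  \det (coords (fun i => eval_mx (genring_val (w i)) b)).
Proof.
rewrite /basis_det -[LHS]det_map_mx; congr (\det _).
by apply/row_matrixP => i; rewrite -map_row !rowK map_mxvec.
Qed.

(** The condition C on structure constants says that every tuple which has
    them, and for which the w_i form a basis, is a zero of P. It holds at
    F1(a) for generic a, because such a tuple is conjugate to F1(a) and all
    conjugates of P vanish at F1. Being constructible, it also holds at F2(a)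
    for generic a, and F2(a) itself is one of these tuples. *)
Lemma vanishing_transfer P : eval_at F1 P = 0 -> eval_at F2 P = 0.
Proof.
move=> P0; pose C (z : 'I_#|{: I}| -> k) := forall c : 'I_(nvars n l) -> k,
  (forall e, e \in codom constants_eq -> e.@[join_env z c] = 0) ->
  (lift_b (basis_det * P)).@[join_env z c] = 0.
have conC : constructible C by exact: constructible_forall.
have constE (K : Type) (f : I -> K) : (fun t => f (enum_val (enum_rank t))) = f.
  by apply/funext => t; rewrite enum_rankK.
have C1 : generically X1 (fun a => C (fun i => ev (z1 (enum_val i)) a)).
  pose S Q := exists2 g, g \in unitmx & Q = conj_poly g P.
  have S0 Q : S Q -> eval_at F1 Q = 0 by case=> g ug ->; apply: eval_at_conj.
  apply: (generically_and3 _ (gen_basis wF1) (gen_constants zF1) (gen_all_at S0)).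
  move=> a _ wa ya Sa c; rewrite -(coord_point_of c); move: (point_of c) => b.
  move/constants_eqP; rewrite (constE _ (fun t => ev (z1 t) a)) => yb.
  rewrite lift_bE mevalM basis_detE; set d := \det _.
  have [->|Wb] := eqVneq d 0; first exact: mul0r.
  have wb : coords (fun i => eval_mx (genring_val (w i)) b) \in unitmx.
    by rewrite unitmxE unitfE.
  have [g ug ->] := same_constants_conjugate wa wb ya yb.
  by rewrite -[P.@[_]]conj_polyE Sa ?mulr0 //; exists g.
have C2 := generic_transfer z12 conC C1; apply/eval_at_eq0.
apply: (generically_and3 _ C2 (gen_basis wF2) (gen_constants zF2)) => a _ Ca wa ya.
have := Ca (coord (tuple_val F2 a)); rewrite lift_bE mevalM basis_detE.
have eqs : structure_constants w (fun t => ev (z2 (enum_val (enum_rank t))) a) (tuple_val F2 a).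
  by rewrite (constE _ (fun t => ev (z2 t) a)).
move=> /(_ ((constants_eqP _ _).2 eqs)) /eqP; rewrite mulf_eq0 => /orP[|/eqP//].
by move: wa; rewrite unitmxE unitfE => /negPf ->.
Qed.

End VanishingTransfer.

(** * Polynomial relations between the matrix entries *)

Section Homomorphic.
Variables (k : closedFieldType) (n m m1 l : nat).
Variables (X : irr_nvariety k n m) (X1 : irr_nvariety k n m1).
Notation A := (RMaps X).
Notation N := (n.+1 * n.+1)%N.
Notation I := ('I_l * 'I_N * 'I_N)%type.
Variable phi : {rmorphism A -> RMaps X1}.
Hypothesis phiA : forall c, phi c%:A = c%:A.
Hypothesis phi_span : exists v : 'I_N -> A, coords (fun i => rho (phi (v i))) \in unitmx.

(** A scalar element is central, and phi(A) spans the matrix algebra, whose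
    centre consists of scalars. *)
Lemma scalar_image c z : scalar_elt c z -> exists y, scalar_elt (phi c) y.
Proof.
move=> cz; have [v vU] := phi_span.
have [||y yE] := @proportional_mx _ _ (rho (phi c)) 1%:M.
- by rewrite -[1%:M]/(1 : 'M_n.+1) oner_eq0.
- move=> B; rewrite mulmx1 mul1mx (coords_span vU B) mulmx_sumr mulmx_suml.
  apply: eq_bigr => i _; rewrite -scalemxAr -scalemxAl; congr (_ *: _).
  have := scalar_elt_comm (v i) cz => /(congr1 phi) /(congr1 (@rho k n m1 X1)).
  by rewrite !rmorphM.
- by exists y; rewrite /scalar_elt yE scalemx1.
Qed.

Variables (G : 'I_l -> A) (w : 'I_N -> genring k n l).
Notation J := (eval_tuple G).
Notation F := (fun i => phi (G i)).
Hypothesis wG : coords (fun i => rho (J (w i))) \in unitmx.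

Lemma rho_phi_eval p : rho (phi (J p)) = eval_at_mx F (genring_val p).
Proof.
apply: (rho_genring_hom (phi := fun p => phi (J p))) => [c|h|p1 p2|p1 p2].
- by rewrite eval_tupleA phiA.
- by rewrite eval_tuple_var.
- by rewrite eval_tupleD rmorphD.
- by rewrite eval_tupleM rmorphM.
Qed.

(** A basis of A over the invariants spans phi(A) over the values of the
    invariants, hence it spans the matrix algebra over the function field of
    X1. *)
Lemma phi_basis : coords (fun i => eval_at_mx F (genring_val (w i))) \in unitmx.
Proof.
have [v vU] := phi_span.
have /choice[c cP] i : exists c : 'I_N -> funfield X1,
    rho (phi (v i)) = \sum_j c j *: eval_at_mx F (genring_val (w j)).
  have [d [z [dz -> _]]] := rho_basis wG (v i).
  have /choice[y yP] j := scalar_image (dz j).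
  exists y; rewrite !rmorph_sum; apply: eq_bigr => j _.
  by rewrite !rmorphM /= yP rho_phi_eval -[LHS]/(_ *m _) mul_scalar_mx.
have E : coords (fun i => rho (phi (v i))) = (\matrix_(i, j) c i j) *m
    coords (fun i => eval_at_mx F (genring_val (w i))).
  apply/row_matrixP => i; rewrite row_mul rowK cP linear_sum mulmx_sum_row.
  by apply: eq_bigr => j _; rewrite linearZ /= rowK !mxE.
by move: vU; rewrite E unitmx_mul => /andP[].
Qed.

Variables (c : I -> A) (z : I -> funfield X).
Hypothesis cz : forall t, scalar_elt (c t) (z t).
Hypothesis Gc : forall h i, G h * J (w i) = \sum_j c (h, i, j) * J (w j).

(** The structure constants are elements of the centre of A. A polynomial in
    them is zero or invertible in A, so phi neither creates nor destroys
    relations. *)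
Lemma phi_constants : exists y : I -> funfield X1,
  (forall h i, rho (F h) *m eval_at_mx F (genring_val (w i)) =
     \sum_j y (h, i, j) *: eval_at_mx F (genring_val (w j))) /\
  forall q : {mpoly k[#|{: I}|]}, mmap (cst_K X1) (fun i => y (enum_val i)) q = 0 <->
    mmap (cst_K X) (fun i => z (enum_val i)) q = 0.
Proof.
have /choice[y yP] t := scalar_image (cz t); exists y; split=> [h i|q].
  have /(congr1 phi)/(congr1 (@rho k n m1 X1)) := Gc h i.
  rewrite !rmorphM /= rho_phi_eval => E; rewrite -[LHS]/(rho (F h) * _) E !rmorph_sum.
  apply: eq_bigr => j _.
  by rewrite !rmorphM /= yP rho_phi_eval -[LHS]/(_ *m _) mul_scalar_mx.
have [e [ez ey]] : exists e : A, scalar_elt e (mmap (cst_K X) (fun i => z (enum_val i)) q) /\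
    scalar_elt (phi e) (mmap (cst_K X1) (fun i => y (enum_val i)) q).
  elim/mpoly_ring_ind: q => [a|i|p q [e [ez ey]] [f [fz fy]]|p q [e [ez ey]] [f [fz fy]]].
  - by exists a%:A; rewrite phiA !mmapC /scalar_elt !rhoA.
  - by exists (c (enum_val i)); rewrite !mmapX !mmap1U.
  - by exists (e + f); rewrite !rmorphD; split; apply: scalar_eltD.
  - by exists (e * f); rewrite !rmorphM; split; apply: scalar_eltM.
split=> [y0|z0]; last first.
  have e0 : e = 0 by apply: rho_inj; rewrite ez z0 raddf0 rmorph0.
  move: ey; rewrite e0 rmorph0 /scalar_elt rmorph0 => /matrixP/(_ 0 0).
  by rewrite !mxE eqxx mulr1n.
apply/eqP; apply: contrapT => /negP q0.
have [e' [ee' _]] : exists e', e * e' = 1 /\ e' * e = 1.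
  by apply: rho_unit; rewrite ez unitmxE det_scalar unitfE expf_neq0.
have : phi e = 0 by apply: rho_inj; rewrite ey y0 raddf0 rmorph0.
move=> pe0; have := congr1 phi ee'; rewrite rmorphM pe0 mul0r rmorph1 => /eqP.
by rewrite eq_sym oner_eq0.
Qed.

End Homomorphic.

Section SameZeros.
Variables (k : closedFieldType) (n m m1 m2 l : nat).
Variables (X : irr_nvariety k n m) (X1 : irr_nvariety k n m1) (X2 : irr_nvariety k n m2).
Notation A := (RMaps X).
Notation N := (n.+1 * n.+1)%N.
Variables (phi1 : {rmorphism A -> RMaps X1}) (phi2 : {rmorphism A -> RMaps X2}).
Hypotheses (phi1A : forall c, phi1 c%:A = c%:A) (phi2A : forall c, phi2 c%:A = c%:A).
Hypothesis span1 : exists v : 'I_N -> A, coords (fun i => rho (phi1 (v i))) \in unitmx.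
Hypothesis span2 : exists v : 'I_N -> A, coords (fun i => rho (phi2 (v i))) \in unitmx.
Variables (G : 'I_l -> A) (w : 'I_N -> genring k n l).
Hypothesis wG : coords (fun i => rho (eval_tuple G (w i))) \in unitmx.

(** The structure constants of G lie in the centre of A and are carried to
    both varieties, so [vanishing_transfer] applies. *)
Lemma same_zeros P :
  eval_at (fun i => phi1 (G i)) P = 0 -> eval_at (fun i => phi2 (G i)) P = 0.
Proof.
pose I := ('I_l * 'I_N * 'I_N)%type.
have /choice[c /choice[z cz]] (t : 'I_l * 'I_N) : exists (c : 'I_N -> A) (z : 'I_N -> funfield X),
    (forall j, scalar_elt (c j) (z j)) /\
    G t.1 * eval_tuple G (w t.2) = \sum_j c j * eval_tuple G (w j).
  by have [c [z [cz E _]]] := rho_basis wG (G t.1 * eval_tuple G (w t.2)); exists c, z.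
pose c' (t : I) := c t.1 t.2; pose z' (t : I) := z t.1 t.2.
have cz' t : scalar_elt (c' t) (z' t) by apply: (cz t.1).1.
have Gc h i : G h * eval_tuple G (w i) = \sum_j c' (h, i, j) * eval_tuple G (w j).
  exact: (cz (h, i)).2.
have [y1 [E1 q1]] := phi_constants phi1A span1 cz' Gc.
have [y2 [E2 q2]] := phi_constants phi2A span2 cz' Gc.
apply: (vanishing_transfer (phi_basis phi1A span1 wG) (phi_basis phi2A span2 wG) E1 E2).
by move=> q; rewrite q1 q2.
Qed.

End SameZeros.

Section FractionBasis.
Variables (k : closedFieldType) (n m l : nat).
Variables (X : irr_nvariety k n m) (Y : irr_nvariety k n l).
Notation N := (n.+1 * n.+1)%N.
Notation quo := (to_quot (vanishing_biideal Y)).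
Variable h : {lrmorphism kn_poly Y -> RMaps X}.
Hypothesis hfrac : total_ring_of_fractions h.

(** The image in RMaps of the generic matrix X_i. *)
Definition frac_gen (i : 'I_l) : RMaps X := h (quo (gen_var k n i)).

Lemma frac_gen_eval p : eval_tuple frac_gen p = h (quo p).
Proof.
apply: rho_inj; rewrite rho_eval_tuple; symmetry.
apply: (rho_genring_hom (phi := fun p => h (quo p))) => [c|i|p1 p2|p1 p2] //.
- by rewrite -[RHS]/(c *: 1) -(rmorph1 h) -linearZ; congr (h _); symmetry; apply: quot_scaleE.
- by rewrite to_quotD rmorphD.
- by rewrite -rmorphM; congr (h _); symmetry; apply: quot_mulE.
Qed.

(** A basis of RMaps over the invariants involves finitely many elements of
    k_n[Y], by [fraction_span]; they span the matrix algebra over the function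
    field of X, and a basis can be selected among them. *)
Lemma fraction_basis : exists w : 'I_N -> genring k n l,
  coords (fun i => rho (eval_tuple frac_gen (w i))) \in unitmx.
Proof.
have [v vU] := taut_basis X.
pose b i := rmap_of_genring X (v i).
have spanb i : exists s : seq (genring k n l), forall q (V : 'M[funfield X]_(q, N)),
    (forall p, p \in s -> (mxvec (rho (h (quo p))) <= V)%MS) ->
    (mxvec (rho (b i)) <= V)%MS.
  have [d [c [z [r [cz ->]]]]] := fraction_span hfrac (b i).
  exists (codom (fun j => repr (r j))) => q V sV.
  rewrite rmorph_sum linear_sum summx_sub // => j _.
  rewrite rmorphM /= cz -[_%:M * _]/(_ *m _) mul_scalar_mx linearZ scalemx_sub //.
  by rewrite -[r j]repr_quotK; apply: sV; apply: codom_f.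
have /choice[s sP] := spanb.
pose S := flatten [seq s i | i <- enum 'I_N].
pose V : 'M[funfield X]_(size S, N) := \matrix_j mxvec (rho (h (quo (nth 0 S j)))).
have VS p : p \in S -> (mxvec (rho (h (quo p))) <= V)%MS.
  move=> pS; have lt_i : (index p S < size S)%N by rewrite index_mem.
  have -> : mxvec (rho (h (quo p))) = row (Ordinal lt_i) V by rewrite rowK /= nth_index.
  exact: row_sub.
have fullV : row_full V.
  rewrite -sub1mx; have : (coords (fun i => rho (b i)) <= V)%MS.
    apply/row_subP => i; rewrite rowK; apply: sP => p ps; apply: VS.
    by apply/flatten_mapP; exists i; rewrite ?mem_enum.
  apply: submx_trans; rewrite sub1mx row_full_unit; exact: vU.
exists (fun i => nth 0 S (fullrankfun fullV i)).
rewrite -row_full_unit (_ : coords _ = rowsub (fullrankfun fullV) V).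
  exact: fullrowsub_full.
by apply/row_matrixP => i; rewrite row_rowsub !rowK frac_gen_eval.
Qed.

End FractionBasis.

(** * Uniqueness *)

Section Realization.
Variables (k : closedFieldType) (n m l : nat).
Variables (X : irr_nvariety k n m) (Y : irr_nvariety k n l).
Notation A := (RMaps X).

(** A presentation of RMaps X as the ring of fractions of k_n[Y], with the
    action of RMaps X on Y that extends it. *)
Record realization := Realization {
  frac_hom :> {lrmorphism kn_poly Y -> A};
  frac_homP : total_ring_of_fractions frac_hom;
  frac_emb : {rmorphism A -> RMaps Y};
  frac_embE : forall r, frac_emb (frac_hom r) = rmap_of_kn_poly r;
  frac_emb_kn : forall a, in_kn_frac (frac_emb a) }.

Lemma realization_ex : isomorphic_to_kn_frac Y A -> exists r : realization, True.
Proof.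
move=> [Q [j [jP AQ]]]; have [h hP] := fractions_iso jP AQ.
have [psi [psiE psi_kn]] := fraction_model hP.
by exists (Realization hP psiE psi_kn).
Qed.

Variable r : realization.

Lemma frac_embA c : frac_emb r c%:A = c%:A.
Proof.
have E : r c%:A = c%:A by rewrite linearZ rmorph1.
have cE : c%:A = to_quot (vanishing_biideal Y) c%:A :> kn_poly Y.
  exact: (quot_scaleE (vanishing_biideal Y) c 1).
rewrite -{1}E frac_embE cE rmap_of_kn_polyE; apply: rho_inj.
by rewrite rho_rmap_of_genring eval_at_mxA rhoA.
Qed.

Lemma frac_emb_gen i : frac_emb r (frac_gen r i) = taut Y i.
Proof. by rewrite /frac_gen frac_embE rmap_of_kn_polyE. Qed.

Lemma frac_emb_span : exists v : 'I_(n.+1 * n.+1) -> A,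
  coords (fun i => rho (frac_emb r (v i))) \in unitmx.
Proof.
have [w wU] := taut_basis Y.
exists (fun i => r (to_quot (vanishing_biideal Y) (w i))).
have -> : (fun i => rho (frac_emb r (r (to_quot (vanishing_biideal Y) (w i))))) =
    (fun i => rho (rmap_of_genring Y (w i))).
  by apply/funext => i; rewrite frac_embE rmap_of_kn_polyE.
exact: wU.
Qed.

End Realization.

Section Comparison.
Variables (k : closedFieldType) (n m l l' : nat).
Variables (X : irr_nvariety k n m) (Y : irr_nvariety k n l) (Y' : irr_nvariety k n l').
Variables (r : realization X Y) (r' : realization X Y').

(** The generators of k_n[Y'], acting on Y. *)
Definition comparison (i : 'I_l') : RMaps Y := frac_emb r (frac_gen r' i).

Lemma comparison_same_vanishing : same_vanishing Y' comparison.
Proof.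
have [w wG] := fraction_basis (frac_homP r').
have E : (fun i => frac_emb r' (frac_gen r' i)) = taut Y'.
  by apply/funext => i; apply: frac_emb_gen.
move=> P; rewrite -eval_taut_eq0 -E; split; apply: same_zeros wG _;
  by [apply: frac_embA|apply: frac_emb_span].
Qed.

Lemma comparison_into : maps_into Y' comparison.
Proof.
apply: (same_vanishing_into comparison_same_vanishing).
have [w wG] := fraction_basis (frac_homP r').
have := gen_basis (phi_basis (frac_embA r) (frac_emb_span r) wG).
by apply: generically_impl => a _; apply: generating_span.
Qed.

Lemma comparison_kn i : in_kn_frac (comparison i).
Proof. exact: frac_emb_kn. Qed.

Lemma rho_comparison p : rho (frac_emb r (eval_tuple (frac_gen r') p)) =
  eval_at_mx comparison (genring_val p).
Proof. exact/rho_phi_eval/frac_embA. Qed.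

End Comparison.

Section Inverse.
Variables (k : closedFieldType) (n m l l' : nat).
Variables (X : irr_nvariety k n m) (Y : irr_nvariety k n l) (Y' : irr_nvariety k n l').
Variables (r : realization X Y) (r' : realization X Y').
Notation F := (comparison r r').
Notation G := (comparison r' r).

Lemma gen_mul_eval q (Z : irr_nvariety k n q) (H : 'I_l' -> RMaps Z) (u : RMaps Z)
    (p s : genring k n l') :
  rho u *m eval_at_mx H (genring_val s) = eval_at_mx H (genring_val p) ->
  generically Z (fun a => rmap_val u a *m eval_mx (genring_val s) (tuple_val H a) =
    eval_mx (genring_val p) (tuple_val H a)).
Proof.
move=> E; have := ev_mxM (rho u) (eval_at_mx H (genring_val s)); rewrite E => gM.
apply: (generically_and4 _ gM (ev_rho u) (ev_eval_at_mx H (genring_val s))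
  (ev_eval_at_mx H (genring_val p))).
by move=> a _ + <- <- <-.
Qed.

(** Write the generator X_i of k_n[Y] as a fraction p s^-1 over k_n[Y']. Then
    G_i = p s^-1 on Y', hence G_i(F) = p(F) s(F)^-1, which is the value of X_i
    on Y. *)
Lemma comparisonK : generically Y (fun a => tuple_val G (tuple_val F a) = a).
Proof.
have Gi i : generically Y (fun a => rmap_val (G i) (tuple_val F a) = rmap_val (taut Y i) a).
  have [_ _ /(_ (frac_gen r i))[p [s [t [_ [st ts] iE]]]]] := frac_homP r'.
  pose quo := to_quot (vanishing_biideal Y').
  have hp : eval_tuple (frac_gen r') (repr p) = r' p by rewrite frac_gen_eval repr_quotK.
  have hs : eval_tuple (frac_gen r') (repr s) = r' s by rewrite frac_gen_eval repr_quotK.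
  have E : frac_gen r i * r' s = r' p by rewrite iE -mulrA ts mulr1.
  have E1 : rho (taut Y i) *m eval_at_mx F (genring_val (repr s)) =
      eval_at_mx F (genring_val (repr p)).
    rewrite -(frac_emb_gen r) -!rho_comparison hs hp -E.
    by rewrite !rmorphM.
  have E2 : rho (G i) *m eval_at_mx (taut Y') (genring_val (repr s)) =
      eval_at_mx (taut Y') (genring_val (repr p)).
    have /(congr1 (frac_emb r')) := E; rewrite rmorphM !frac_embE.
    by move=> /(congr1 (@rho k n l' Y')); rewrite rmorphM /= !rho_rmap_of_genring.
  have us : eval_at_mx F (genring_val (repr s)) \in unitmx.
    rewrite -rho_comparison hs; apply: (unit_rho (v := frac_emb r t) _).1.
    by rewrite -rmorphM st rmorph1.
  have gs : generically Y (fun a => eval_mx (genring_val (repr s)) (tuple_val F a) \in unitmx).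
    apply: (generically_and _ (ev_mx_unit us) (ev_eval_at_mx F (genring_val (repr s)))).
    by move=> a _ [+ _] <-.
  have g2 : generically Y' (fun b => rmap_val (G i) b *m eval_mx (genring_val (repr s)) b =
      eval_mx (genring_val (repr p)) b).
    apply: (generically_and _ (gen_mul_eval E2) (gen_taut_val Y')) => b _ + tb.
    by rewrite tb.
  have := gen_pullback (comparison_same_vanishing r r') (comparison_into r r') g2.
  move=> g2F; apply: (generically_and3 _ (gen_mul_eval E1) g2F gs) => a _ <- /= GE sa.
  exact: (can_inj (mulmxK sa) GE).
have := gen_and (gen_forall Gi) (gen_taut_val Y).
apply: generically_impl => a _ [GE tE]; rewrite -[RHS]tE.
by apply/ffunP => i; rewrite [LHS]ffunE GE [RHS]ffunE.
Qed.

End Inverse.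

Lemma realizations_birational (k : closedFieldType) (n m l l' : nat)
    (X : irr_nvariety k n m) (Y : irr_nvariety k n l) (Y' : irr_nvariety k n l') :
  isomorphic_to_kn_frac Y (RMaps X) -> isomorphic_to_kn_frac Y' (RMaps X) ->
  nvar_birational Y Y'.
Proof.
move=> /realization_ex[r _] /realization_ex[r' _].
exists (comparison r r'), (comparison r' r); split; try exact: comparison_kn.
split; first by split; apply: comparison_into.
  by split; apply: same_vanishing_dominant; exact: comparison_same_vanishing.
by split; apply: comparisonK.
Qed.

Theorem mainTheorem7 (k : closedFieldType) (n m : nat)
    (X : irr_nvariety k n m) :
  exists (l : nat) (Y : irr_nvariety k n l),
    [/\ isomorphic_to_kn_frac Y (RMaps X),
        forall (l' : nat) (Y' : irr_nvariety k n l'),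
          isomorphic_to_kn_frac Y' (RMaps X) -> nvar_birational Y Y'
      & PGL_birational X Y].
Proof.
have [r [c [ci cgen]]] := invariants_fg X.
have /choice[e ec] i := inv_scalar_elt (ci i).
exists (m + r)%N, (image_variety (gen_extended e)).
have YX := extended_kn_frac ec cgen; split=> //; last exact: extended_birational ec.
by move=> l' Y' Y'X; apply: realizations_birational YX Y'X.
Qed.
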